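(* Let $0<a\leq b$, $\mu,\nu>-1$, $\nu-\mu<1$ and $|\arg z|<\pi$. Then the following Stieltjes transform representation is valid: $$z^{\frac{\nu-\mu}{2}}I_{\mu}(a\sqrt{z})K_{\nu}(b\sqrt{z})=\frac{1}{2}\int_{0}^{\infty} \frac{t^{\frac{\nu-\mu}{2}}}{z+t}J_{\mu}(a\sqrt{t})J_{\nu}(b\sqrt{t})\,dt,$$ which in fact can be rewritten as $$z^{\frac{\nu-\mu}{2}}I_{\mu}(a\sqrt{z})K_{\nu}(b\sqrt{z})=\frac{1}{2}\int_{0}^{\infty}e^{-zs}\left[\int_{0}^{\infty}e^{-st}\,t^{\frac{\nu-\mu}{2}}J_{\mu}(a\sqrt{t})J_{\nu}(b\sqrt{t})\,dt\right]ds.$$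
   Context: $I_\mu$ and $K_\nu$ are the modified Bessel functions of the first and second kinds, and $J_\mu$ is the Bessel function of the first kind. The variable $z$ is complex and nonzero; powers, square roots and Bessel functions are taken with their principal branches ($|\arg z|<\pi$).
   Formalization: The second (iterated Laplace) formula is stated only for Re z ≥ 0, with the outer integral improper: for Re z < 0 the inner integral is ~ C s^{-ν-1} with C ≠ 0 as s → ∞, so the outer integral diverges. The Stieltjes formula covers all |arg z| < π. *)

(* Defs.v *)
From HB Require Import structures.
From mathcomp Require Import all_boot all_order all_algebra.
From mathcomp Require Import all_classical all_reals all_analysis.
From mathcomp.real_closed Require Import complex.

Set Implicit Arguments.
Unset Strict Implicit.
Unset Printing Implicit Defensive.

Import Order.TTheory GRing.Theory Num.Theory.
Import numFieldNormedType.Exports.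

Local Open Scope classical_set_scope.
Local Open Scope ring_scope.
Local Open Scope complex_scope.

Section ComplexFunctions.
Context {R : realType}.
Implicit Types (w z : R[i]) (mu nu x : R).

(* Principal argument, with values in (-pi, pi]; [carg 0] is a junk value. *)
Definition carg z : R :=
  if 0 <= complex.Im z then acos (complex.Re z / Normc.normc z)
  else - acos (complex.Re z / Normc.normc z).

Definition cexp w : R[i] :=
  (expR (complex.Re w))%:C * (cos (complex.Im w) +i* sin (complex.Im w)).

(* Principal logarithm and real powers of a nonzero complex number. The
   principal square root is [sqrtc], whose real part is nonnegative. *)
Definition clog z : R[i] := ln (Normc.normc z) +i* carg z.
Definition cpow z x : R[i] := cexp (x%:C * clog z).

Definition cseries (u : nat -> R[i]) : R[i] :=
  limn (series (fun k => complex.Re (u k)))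
  +i* limn (series (fun k => complex.Im (u k))).

(* The reciprocal Gamma function, by Gauss's product
   1 / Gamma(x) = lim_n x (x + 1) ... (x + n) / (n! n^x);
   it vanishes at the poles 0, -1, -2, ... of Gamma. *)
Definition rgamma x : R :=
  limn (fun n : nat =>
    (\prod_(k < n.+1) (x + k%:R)) / (n`!%:R * n%:R `^ x)).

Definition besselJ mu w : R[i] :=
  cpow (w / 2) mu *
  cseries (fun k => ((-1) ^+ k * rgamma (mu + k%:R + 1) / k`!%:R)%:C
                    * (w / 2) ^+ (2 * k)).

Definition besselI mu w : R[i] :=
  cpow (w / 2) mu *
  cseries (fun k => (rgamma (mu + k%:R + 1) / k`!%:R)%:C
                    * (w / 2) ^+ (2 * k)).

Definition besselK_nonint nu w : R[i] :=
  (pi / 2)%:C * ((besselI (- nu) w - besselI nu w) / (sin (nu * pi))%:C).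

(* At integer orders K is the limit of its values at nearby orders. *)
Definition besselK nu w : R[i] :=
  if nu \is a Num.int then
    lim (complex.Re (besselK_nonint x w) @[x --> nu^'])
    +i* lim (complex.Im (besselK_nonint x w) @[x --> nu^'])
  else besselK_nonint nu w.

Definition cintegrable (D : set R) (f : R -> R[i]) : Prop :=
  lebesgue_measure.-integrable D (fun t => (complex.Re (f t))%:E) /\
  lebesgue_measure.-integrable D (fun t => (complex.Im (f t))%:E).

Definition cintegral (D : set R) (f : R -> R[i]) : R[i] :=
  (\int[lebesgue_measure]_(t in D) complex.Re (f t))
  +i* (\int[lebesgue_measure]_(t in D) complex.Im (f t)).

(* The improper integral of f over (0, +oo), as the limit of the integrals over
   (0, A), converges to l; absolute convergence at +oo is not required. *)
Definition is_improper_cintegral (f : R -> R[i]) (l : R[i]) : Prop :=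
  [/\ forall A : R, 0 < A -> cintegrable `]0, A[ f,
      complex.Re (cintegral `]0, A[ f) @[A --> +oo%R] --> complex.Re l
    & complex.Im (cintegral `]0, A[ f) @[A --> +oo%R] --> complex.Im l].

End ComplexFunctions.

(* Main.v *)
Require Import Defs.
From HB Require Import structures.
From mathcomp Require Import all_boot all_order all_algebra.
From mathcomp Require Import all_classical all_reals all_analysis.
From mathcomp Require Import measurable_realfun lebesgue_integral_under.
From mathcomp Require Import ring lra.
From mathcomp.real_closed Require Import complex.

(* Put e_m(y) = sum_k (-y)^k / (k! Gamma(m+k+1)), E_m(y) = e_m(-y), alpha = a^2/4, beta = b^2/4
   and kappa_n = pi/sin(pi n) (beta^-n E_{-n}(beta z) - z^n E_n(beta z)). Up to elementary factors
   the claim is F_{m,n} = E_m(alpha z) kappa_n, where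
     F_{m,n} = int_0^oo t^n e_m(alpha t) e_n(beta t) / (z + t) dt.
   If alpha < beta then int_0^oo t^n e_m(alpha t) e_n(beta t) dt = 0 for m > n + 1 (integrate by
   parts repeatedly), hence m |-> F_{m,n} and m |-> E_m(alpha z) solve the same three-term
   recurrence. Both are recessive, so their Casoratian vanishes and F_{m,n} = C_n E_m(alpha z); for
   -1 < n < 0 the limit m -> oo gives C_n = int_0^oo t^n e_n(beta t) / (z + t) dt. Expanding e_n with
   its Taylor remainders turns C_n into int_0^oo t^n / (z + t) dt = z^n Gamma(n+1) Gamma(-n) and the
   Mellin moments of these remainders, and yields C_n = kappa_n. Differentiating in beta moves n to
   n + 1, a limit in n covers the integers, and alpha -> beta covers a = b. For the Laplace form,
   Fubini on 0 < s < A gives int g(t) (1 - exp(-A (z + t))) / (z + t) dt, and A -> oo. *)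

Set Implicit Arguments.
Unset Strict Implicit.
Unset Printing Implicit Defensive.

Import Order.TTheory GRing.Theory Num.Theory.
Import numFieldNormedType.Exports.

Local Open Scope classical_set_scope.
Local Open Scope ring_scope.
Local Open Scope complex_scope.

(** * Integrals over the half-line *)

Section RealDerivative.
Context {R : realType}.
Implicit Types (f g : R -> R) (x a b c d : R).

(** Since e_m(y) = O(y^(-m/2-1/4)), the integrand of F_{m,n} is O(t^((n-m-1)/2-1)) at infinity: the
    condition n - m < 1 is what makes F_{m,n} absolutely convergent. The recurrence in m rests on
    t/(z+t) = 1 - z/(z+t), which turns the relation for e_m into the one for E_m(alpha z), up to a
    leftover integral of t^n e_{m+1} e_n. This is a discontinuous integral of Weber-Schafheitlin
    type, and its vanishing is proved for alpha < beta: k integrations by parts gain a factor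
    (alpha/beta)^(k/2), provided that e_{m+k} and e_{n+k} are bounded with constants polynomial in
    k. The energy estimates supply these constants. Orders -1 < n < 0 come first because there the
    integrals of t^n/(z+t) and of t^n e_n/(z+t) converge absolutely without the help of e_m. No
    analytic continuation in z occurs: z = exp L, and the power integral is transported along exp(x
    L) for x from 0 to 1. In the Laplace form Re z >= 0 keeps exp(-z s) bounded, and the outer
    integral is a limit over (0, A). *)

Definition rderiv f x d := is_derive x 1 f d.

Lemma rd_eq f x a b : rderiv f x a -> a = b -> rderiv f x b.
Proof. by move=> h <-. Qed.

Lemma rd_ext f g x a : (forall t, f t = g t) -> rderiv f x a -> rderiv g x a.
Proof. by move=> /funext ->. Qed.

Lemma rd_cst c x : rderiv (fun=> c) x 0.
Proof. exact: is_derive_cst. Qed.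

Lemma rd_id x : rderiv (fun t => t) x 1.
Proof. exact: is_derive_id. Qed.

Lemma rd_add f g x a b : rderiv f x a -> rderiv g x b ->
  rderiv (fun t => f t + g t) x (a + b).
Proof. by move=> ha hb; exact: (is_deriveD ha hb). Qed.

Lemma rd_opp f x a : rderiv f x a -> rderiv (fun t => - f t) x (- a).
Proof. by move=> ha; exact: (is_deriveN ha). Qed.

Lemma rd_sub f g x a b : rderiv f x a -> rderiv g x b ->
  rderiv (fun t => f t - g t) x (a - b).
Proof. by move=> ha hb; exact: (is_deriveB ha hb). Qed.

Lemma rd_mul f g x a b : rderiv f x a -> rderiv g x b ->
  rderiv (fun t => f t * g t) x (a * g x + f x * b).
Proof.
move=> ha hb; apply: rd_eq (is_deriveM ha hb) _.
by rewrite /GRing.scale/= addrC (mulrC (g x)).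
Qed.

Lemma rd_scale c f x a : rderiv f x a -> rderiv (fun t => c * f t) x (c * a).
Proof.
by move=> ha; apply: rd_eq (rd_mul (rd_cst c x) ha) _; rewrite mul0r add0r.
Qed.

Lemma rd_comp f g x a b : rderiv f (g x) a -> rderiv g x b ->
  rderiv (fun t => f (g t)) x (a * b).
Proof. by move=> ha hb; apply: rd_eq (is_derive1_comp ha hb) _. Qed.

Lemma rd_powR r x : 0 < x -> rderiv (fun t => t `^ r) x (r * x `^ (r - 1)).
Proof. by move=> x0; exact: is_derive1_powR. Qed.

Lemma rd_expR x : rderiv expR x (expR x).
Proof. exact: is_derive_expR. Qed.

Lemma rd_expN c x : rderiv (fun t => expR (- (c * t))) x (- c * expR (- (c * x))).
Proof.
apply: rd_eq (rd_comp (rd_expR _) (rd_opp (rd_scale c (rd_id x)))) _.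
by rewrite mulr1 mulrC.
Qed.

Lemma rd_cont f x a : rderiv f x a -> {for x, continuous f}.
Proof.
move=> h; apply: differentiable_continuous; apply/derivable1_diffP.
exact: (@ex_derive _ _ _ _ _ _ _ h).
Qed.

Lemma powRDx x r s : 0 < x -> x `^ (r + s) = x `^ r * x `^ s.
Proof. by move=> x0; rewrite powRD// (gt_eqF x0) implybT. Qed.

Lemma powR_eqD x r s t : 0 < x -> t = r + s -> x `^ t = x `^ r * x `^ s.
Proof. by move=> x0 ->; exact: powRDx. Qed.

End RealDerivative.

Section HalfLine.
Context {R : realType}.
Local Notation mu := (@lebesgue_measure R).
Implicit Types (f g h G : R -> R).

Definition pos : set R := `]0, +oo[.
Definition int0 f := mu.-integrable pos (EFin \o f).
Definition I0 f : R := \int[mu]_(t in pos) f t.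
Definition mfun0 f := measurable_fun pos f.

Lemma posE t : pos t = (0 < t).
Proof. by rewrite /pos /= in_itv /= andbT. Qed.

Lemma measurable_pos : measurable pos.
Proof. exact: measurable_itv. Qed.

Hint Resolve measurable_pos : core.

Lemma mfun0_cont f : (forall t, 0 < t -> {for t, continuous f}) -> mfun0 f.
Proof.
move=> cf; apply: open_continuous_measurable_fun; first exact: interval_open.
by move=> t; rewrite inE posE => /cf.
Qed.

Lemma int0_mfun f : int0 f -> mfun0 f.
Proof. by move=> /integrableP[/measurable_EFinP]. Qed.

Lemma int0_le f g : mfun0 f -> int0 g -> (forall t, 0 < t -> `|f t| <= g t) ->
  int0 f.
Proof.
move=> mf ig fg; apply: le_integrable ig => //; first exact/measurable_EFinP.
move=> t; rewrite posE => t0 /=; rewrite lee_fin.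
by rewrite (le_trans (fg _ t0))// ler_norm.
Qed.

Lemma int0_eq f g : (forall t, 0 < t -> f t = g t) -> int0 f -> int0 g.
Proof.
move=> fg; apply: eq_integrable => // t; rewrite inE posE => t0 /=.
by rewrite fg.
Qed.

Lemma int0D f g : int0 f -> int0 g -> int0 (fun t => f t + g t).
Proof. by move=> intf intg; exact: (integrableD _ intf intg). Qed.

Lemma int0Z c f : int0 f -> int0 (fun t => c * f t).
Proof. by move=> intf; exact: (integrableZl _ _ intf). Qed.

Lemma int0B f g : int0 f -> int0 g -> int0 (fun t => f t - g t).
Proof. by move=> intf intg; exact: (integrableB _ intf intg). Qed.

Lemma int0_norm f : int0 f -> int0 (fun t => `|f t|).
Proof. exact: integrable_norm. Qed.

Lemma I0_eq f g : (forall t, 0 < t -> f t = g t) -> I0 f = I0 g.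
Proof.
by move=> fg; apply: eq_Rintegral => t; rewrite inE posE => /fg.
Qed.

Lemma I0D f g : int0 f -> int0 g -> I0 (fun t => f t + g t) = I0 f + I0 g.
Proof. exact: RintegralD. Qed.

Lemma I0B f g : int0 f -> int0 g -> I0 (fun t => f t - g t) = I0 f - I0 g.
Proof. exact: RintegralB. Qed.

Lemma I0Z c f : int0 f -> I0 (fun t => c * f t) = c * I0 f.
Proof. exact: RintegralZl. Qed.

Lemma le_I0 f g : int0 f -> int0 g -> (forall t, 0 < t -> f t <= g t) ->
  I0 f <= I0 g.
Proof.
by move=> intf intg fg; apply: le_Rintegral => // t; rewrite posE => /fg.
Qed.

Lemma normr_I0_le f g : int0 f -> int0 g -> (forall t, 0 < t -> `|f t| <= g t) ->
  `|I0 f| <= I0 g.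
Proof.
move=> intf intg fg; apply: le_trans (le_normr_Rintegral _ intf) _ => //.
by apply: le_I0 => //; exact: int0_norm.
Qed.

Lemma I0_ge0 f : (forall t, 0 < t -> 0 <= f t) -> 0 <= I0 f.
Proof. by move=> f0; apply: Rintegral_ge0 => t; rewrite posE => /f0. Qed.

Lemma EFin_I0 f : int0 f -> (\int[mu]_(t in pos) (f t)%:E)%E = (I0 f)%:E.
Proof.
by move=> intf; rewrite /I0 /Rintegral fineK//; exact: integrable_fin_num.
Qed.

Lemma cvg_ge_cst (u : nat -> R) l c : u @ \oo --> l -> (forall n, c <= u n) -> c <= l.
Proof.
move=> ul uc; rewrite -(cvg_lim _ ul)//; apply: limr_ge; first exact: cvgP ul.
exact: nearW.
Qed.

Lemma cvgn_uniq (u v : nat -> R) (l l' : R) : u @ \oo --> l -> v @ \oo --> l' ->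
  (forall n, u n = v n) -> l = l'.
Proof. by move=> ul vl /funext uv; rewrite -(cvg_lim _ ul)// uv (cvg_lim _ vl). Qed.

Lemma mfun0_restrict (A : set R) f : measurable A -> mfun0 f -> mfun0 (f \_ A).
Proof.
move=> mA mf; apply/measurable_restrict => //.
by apply: measurable_funS mf => //; exact: subIsetl.
Qed.

Lemma I0_dct (fn : nat -> R -> R) f g : (forall n, mfun0 (fn n)) -> int0 g ->
  (forall t, 0 < t -> fn n t @[n --> \oo] --> f t) ->
  (forall n t, 0 < t -> `|fn n t| <= g t) ->
  int0 f /\ I0 (fn n) @[n --> \oo] --> I0 f.
Proof.
move=> mfn ig cfn fng.
have mf : mfun0 f by apply: (measurable_fun_cvg mfn) => t; rewrite posE => /cfn.
have infn n : int0 (fn n) by apply: int0_le ig _ => // t /fng.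
have [| | | |intf _ cv] := @dominated_convergence _ _ _ mu pos measurable_pos
  (fun n t => (fn n t)%:E) (EFin \o f) (EFin \o g) _ _ _ ig.
- by move=> n; have /measurable_EFinP := mfn n.
- exact/measurable_EFinP.
- by apply: aeW => t; rewrite posE => t0; apply: cvg_EFin; [exact: nearW|exact: cfn].
- by apply: aeW => t n; rewrite posE => t0 /=; rewrite lee_fin; exact: fng.
split => //.
have -> : (fun n => I0 (fn n)) = fine \o (fun n => (\int[mu]_(t in pos) (fn n t)%:E)%E) by [].
apply: fine_cvg; move: cv; rewrite /= EFin_I0//.
Qed.

Lemma ftc_seg f F a b : a < b -> (forall x, x \in `[a, b] -> {for x, continuous f}) ->
  (forall x, x \in `[a, b] -> is_derive x 1 F (f x)) ->
  mu.-integrable `[a, b] (EFin \o f) /\ \int[mu]_(x in `[a, b]) f x = F b - F a.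
Proof.
move=> ab cf dF.
have cF x : x \in `[a, b] -> {for x, continuous F}.
  by move=> /dF h; apply/differentiable_continuous/derivable1_diffP/ex_derive.
have cw : {within `[a, b], continuous f} by apply: continuous_in_subspaceT => x /set_mem /cf.
split.
  by apply: continuous_compact_integrable => //; exact: segment_compact.
rewrite /Rintegral (@continuous_FTC2 _ f F a b)//.
- split.
  + by move=> x xab; have h := dF x (subset_itv_oo_cc xab); exact: ex_derive.
  + by apply: cvg_at_right_filter; apply: cF; rewrite in_itv/= lexx ltW.
  + by apply: cvg_at_left_filter; apply: cF; rewrite in_itv/= lexx ltW.
- by move=> x xab; have h := dF x (subset_itv_oo_cc xab); rewrite derive1E derive_val.
Qed.

(** Compact exhaustion of (0, oo). The segment of index 0 is the single point 1, so the fundamental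
    theorem is applied from index 1 on. *)
Definition seg n : set R := `[n.+1%:R^-1, n.+1%:R].

Lemma seg_sub n : seg n `<=` pos.
Proof.
move=> t; rewrite /seg/= posE in_itv/= => /andP[+ _]; apply: lt_le_trans.
by rewrite invr_gt0.
Qed.

Lemma seg_integral n f : \int[mu]_(t in seg n) f t = I0 (f \_ (seg n)).
Proof. by rewrite /I0 -Rintegral_mkcondr setIidr//; exact: seg_sub. Qed.

Lemma seg_cvg f t : 0 < t -> (f \_ (seg n)) t @[n --> \oo] --> f t.
Proof.
move=> t0; apply: cvg_near_cst; near=> n.
rewrite patchE ifT// inE /seg/= in_itv/=; apply/andP; split.
  rewrite -[leRHS]invrK lef_pV2 ?posrE ?invr_gt0//.
  rewrite (@le_trans _ _ n%:R) ?ler_nat//; near: n.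
  exact: nbhs_infty_ger.
rewrite (@le_trans _ _ n%:R) ?ler_nat//; near: n.
exact: nbhs_infty_ger.
Unshelve. all: by end_near. Qed.

Lemma mfun0_seg n f : mfun0 f -> mfun0 (f \_ (seg n)).
Proof.
move=> mf; apply/measurable_restrict => //; first exact: measurable_itv.
by apply: measurable_funS mf => //; exact: subIsetl.
Qed.

Lemma seg_dct f : int0 f -> \int[mu]_(t in seg n) f t @[n --> \oo] --> I0 f.
Proof.
move=> intf; under eq_fun do rewrite seg_integral.
apply: (@I0_dct (fun n => f \_ (seg n)) f (fun t => `|f t|) _ _ _ _).2.
- by move=> n; apply: mfun0_seg; exact: int0_mfun.
- exact: int0_norm.
- by move=> t; exact: seg_cvg.
- by move=> n t _; rewrite patchE; case: ifP => // _; rewrite normr0.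
Qed.

(** Monotone convergence along the segments: a common bound on their integrals suffices, and no
    majorant of f has to be known. *)
Lemma seg_ge0_int0 f M : mfun0 f -> (forall t, 0 < t -> 0 <= f t) ->
  (forall n, mu.-integrable (seg n) (EFin \o f)) ->
  (forall n, \int[mu]_(t in seg n) f t <= M) -> int0 f.
Proof.
move=> mf f0 ifn ifM; apply/integrableP; split; first exact/measurable_EFinP.
have -> : (\int[mu]_(t in pos) `|(EFin \o f) t| = \int[mu]_(t in pos) (f t)%:E)%E.
  by apply: eq_integral => t; rewrite inE posE => t0 /=; rewrite ger0_norm// f0.
suff : (\int[mu]_(t in pos) (f t)%:E <= M%:E)%E by move=> /le_lt_trans; apply; rewrite ltry.
have cv := @cvg_monotone_convergence _ _ _ mu pos measurable_pos
  (fun n t => ((f \_ (seg n)) t)%:E).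
have {cv} := cv _ _ _.
rewrite -/mu => cv.
have -> : (\int[mu]_(t in pos) (f t)%:E = \int[mu]_(t in pos) limn (fun n => ((f \_ (seg n)) t)%:E))%E.
  apply: eq_integral => t; rewrite inE posE => t0; apply/esym/cvg_lim => //.
  by apply: cvg_EFin; [exact: nearW|exact: seg_cvg].
have f0' n t : pos t -> (0%R <= ((f \_ (seg n)) t)%:E)%E.
  by rewrite posE => t0; rewrite lee_fin patchE; case: ifP => // _; exact: f0.
have mf' n : measurable_fun pos (fun t => ((f \_ (seg n)) t)%:E).
  by have /measurable_EFinP := mfun0_seg n mf.
have mono (t : R) : pos t -> {homo (fun n => ((f \_ (seg n)) t)%:E) : n m / (n <= m)%N >-> (n <= m)%E}.
  rewrite posE => t0 n m nm; rewrite lee_fin !patchE.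
  case: ifP => [|_]; last by case: ifP => // _; exact: f0.
  rewrite inE /seg/= in_itv/= => /andP[tn tm]; rewrite ifT//.
  rewrite inE /= in_itv/= (le_trans _ tn) ?(le_trans tm) ?ler_nat//.
  by rewrite lef_pV2 ?posrE// ler_nat.
have {}cv := cv mf' f0' mono.
rewrite -(cvg_lim _ cv)//; apply: lime_le; first by apply: cvgP; exact: cv.
apply: nearW => n.
have -> : (\int[mu]_(x in pos) ((f \_ (seg n)) x)%:E = \int[mu]_(x in seg n) (f x)%:E)%E.
  rewrite -[in RHS](setIidr (@seg_sub n)) integral_mkcondr restrict_EFin//.
rewrite -[leLHS]fineK ?lee_fin; first exact: ifM.
apply: integrable_fin_num; first exact: measurable_itv.
exact: ifn.
Qed.

Lemma seg_lt n : n.+2%:R^-1 < n.+2%:R :> R.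
Proof. by rewrite (@lt_trans _ _ 1) ?invf_lt1 ?ltr1n. Qed.

Section ftc.
Variables (f G : R -> R).
Hypothesis cf : forall t : R, 0 < t -> {for t, continuous f}.
Hypothesis dG : forall t : R, 0 < t -> is_derive t 1 G (f t).

Lemma ftc_segn n : mu.-integrable (seg n.+1) (EFin \o f) /\
  \int[mu]_(x in seg n.+1) f x = G n.+2%:R - G n.+2%:R^-1.
Proof.
have h (x : R) : x \in `[n.+2%:R^-1, n.+2%:R] -> 0 < x.
  by rewrite in_itv/= => /andP[+ _]; apply: lt_le_trans; rewrite invr_gt0.
apply: ftc_seg; first exact: seg_lt.
- by move=> x /h /cf.
- by move=> x /h /dG.
Qed.

(** Each segment integral is a difference of two values of [G], hence at most 2M. *)
Lemma ge0_int0 M : (forall t, 0 < t -> 0 <= f t) -> (forall t, 0 < t -> `|G t| <= M) -> int0 f.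
Proof.
move=> f0 GM; have mf : mfun0 f by exact: mfun0_cont.
have M0 : 0 <= M by rewrite (le_trans _ (GM 1 ltr01)).
apply: (@seg_ge0_int0 f (M + M)) => //.
  case=> [|n]; last by have [] := ftc_segn n.
  have [+ _] := ftc_segn 0; apply: integrableS; [exact: measurable_itv|exact: measurable_itv|].
  move=> t; rewrite /seg/= !in_itv/= invr1 => /andP[t1 t2].
  by rewrite (le_trans _ t1) ?(le_trans t2) ?invf_le1 ?ler1n.
case=> [|n].
  rewrite /seg invr1 set_itv1 Rintegral_set1; lra.
rewrite (ftc_segn n).2; have h1 := GM n.+2%:R ltac:(by []); have h2 := GM n.+2%:R^-1 ltac:(by rewrite invr_gt0).
by rewrite (le_trans (ler_norm _))// (le_trans (ler_normB _ _))// lerD.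
Qed.

Lemma ftc0 l0 l1 : int0 f -> G x @[x --> 0^'+] --> l0 -> G x @[x --> +oo] --> l1 ->
  I0 f = l1 - l0.
Proof.
move=> intf G0 G1.
have c1 : \int[mu]_(t in seg n.+1) f t @[n --> \oo] --> I0 f.
  by rewrite (cvg_shiftS (fun n => \int[mu]_(t in seg n) f t)); exact: seg_dct.
have c2 : (G n.+2%:R - G n.+2%:R^-1) @[n --> \oo] --> l1 - l0.
  apply: cvgB.
    move/cvg_pinftyP : G1; apply.
    rewrite (cvg_shiftS (fun n => n.+1%:R : R)) (cvg_shiftS (fun n => n%:R : R)); exact: cvgr_idn.
  move/cvg_at_rightP : G0; apply; split; first by move=> n; rewrite invr_gt0.
  rewrite (cvg_shiftS (fun n => n.+1%:R^-1 : R)); exact: cvg_harmonic.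
by apply: cvgn_uniq c1 c2 _ => n; exact: (ftc_segn n).2.
Qed.
End ftc.

Lemma int0_near_bounds (f : R -> R) (p q C : R) : -1 < p -> q < -1 -> mfun0 f ->
  (forall t, 0 < t -> t <= 1 -> `|f t| <= C * t `^ p) ->
  (forall t, 1 <= t -> `|f t| <= C * t `^ q) -> int0 f.
Proof.
move=> p1 q1 mf f1 f2.
have C0 : 0 <= C by have := f1 1 ltr01 (lexx _); rewrite powR1 mulr1; exact: le_trans.
have dpow r (t : R) : 0 < t -> rderiv (fun t => (1 + t) `^ r) t (r * (1 + t) `^ (r - 1)).
  move=> t0; apply: rd_eq (rd_comp (rd_powR _ _) (rd_add (rd_cst 1 t) (rd_id t))) _.
    by rewrite addr_gt0.
  by rewrite add0r mulr1.
have cpow r (t : R) (t0 : 0 < t) := rd_cont (dpow r t t0).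
(* Tail comparison: the antiderivative -(1 + t)^(q+1) is bounded because q < -1. *)
have i2 : int0 (fun t => (- q - 1) * (1 + t) `^ q).
  apply: (@ge0_int0 _ (fun t => - (1 + t) `^ (q + 1)) _ _ 1).
  - move=> t t0; apply: cvgM; [exact: cvg_cst|exact: cpow].
  - move=> t t0; apply: rd_eq (rd_opp (dpow (q + 1) t t0)) _.
    by rewrite addrK -mulNr opprD.
  - by move=> t t0; rewrite mulr_ge0 ?powR_ge0//; lra.
  - move=> t t0; rewrite normrN ger0_norm ?powR_ge0// -[leRHS](powRr0 (1 + t)).
    by apply: ler_powR; lra.
have cpow0 r (t : R) (t0 : 0 < t) := rd_cont (rd_powR r t0).
(* Comparison near 0: this is the derivative of (t / (1 + t))^(p+1), which stays between 0 and 1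
   because p > -1. *)
have i1 : int0 (fun t => (p + 1) * t `^ p * (1 + t) `^ (- p - 2)).
  apply: (@ge0_int0 _ (fun t => t `^ (p + 1) * (1 + t) `^ (- (p + 1))) _ _ 1).
  - move=> t t0; apply: cvgM; [apply: cvgM; [exact: cvg_cst|exact: cpow0]|exact: cpow].
  - move=> t t0; apply: rd_eq (rd_mul (rd_powR (p + 1) t0) (dpow (- (p + 1)) t t0)) _.
    rewrite addrK.
    have -> : - (p + 1) - 1 = - p - 2 by lra.
    rewrite (@powR_eqD _ (1 + t) 1 (- p - 2) (- (p + 1))) ?addr_gt0//; last by lra.
    rewrite (@powR_eqD _ t 1 p (p + 1))//; last by lra.
    rewrite !powRr1; [ring|lra|lra].
  - by move=> t t0; rewrite !mulr_ge0 ?powR_ge0//; lra.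
  - move=> t t0; rewrite ger0_norm ?mulr_ge0 ?powR_ge0// powRN ler_pdivrMr ?mul1r ?powR_gt0 ?addr_gt0//.
    by apply: ge0_ler_powR; rewrite ?nnegrE; lra.
have pos2 r : 0 < 2 `^ r :> R by rewrite powR_gt0.
apply: (@int0_le _ (fun t => C / 2 `^ (- p - 2) / (p + 1) * ((p + 1) * t `^ p * (1 + t) `^ (- p - 2)) +
   C / 2 `^ q / (- q - 1) * ((- q - 1) * (1 + t) `^ q))) => //.
  by apply: int0D; apply: int0Z.
move=> t t0.
have pp : p + 1 != 0 by rewrite gt_eqF//; lra.
have qq : - q - 1 != 0 by rewrite gt_eqF//; lra.
have -> : C / 2 `^ (- p - 2) / (p + 1) * ((p + 1) * t `^ p * (1 + t) `^ (- p - 2)) +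
   C / 2 `^ q / (- q - 1) * ((- q - 1) * (1 + t) `^ q) =
  C * t `^ p * ((1 + t) `^ (- p - 2) / 2 `^ (- p - 2)) + C * ((1 + t) `^ q / 2 `^ q).
  by field; rewrite !gt_eqF //=; lra.
have [t1|t1] := leP t 1.
  apply: le_trans (f1 _ t0 t1) _; rewrite ler_wpDr ?mulr_ge0 ?invr_ge0 ?powR_ge0//.
  rewrite ler_peMr ?mulr_ge0 ?powR_ge0// ler_pdivlMr// mul1r.
  rewrite -opprD !powRN lef_pV2 ?posrE ?powR_gt0//; [|lra].
  by apply: ge0_ler_powR; rewrite ?nnegrE; lra.
apply: le_trans (f2 _ (ltW t1)) _; rewrite ler_wpDl ?mulr_ge0 ?invr_ge0 ?powR_ge0//.
rewrite ler_wpM2l// ler_pdivlMr// -powRM; [|lra|lra].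
rewrite -[q]opprK !(powRN _ (- q)) lef_pV2 ?posrE ?powR_gt0//; [|lra|lra].
by apply: ge0_ler_powR; rewrite ?nnegrE; lra.
Qed.

Section scaling.
Variables (f : R -> R) (c : R).
Hypotheses (c0 : 0 < c) (cf : forall t : R, 0 < t -> {for t, continuous f}).

Let cseg n : set R := `[c * n.+2%:R^-1, c * n.+2%:R].

Lemma scale_seg n : \int[mu]_(t in cseg n) f t = c * \int[mu]_(t in seg n.+1) f (c * t).
Proof.
have dF (x : R) : rderiv (fun t => c * t) x c.
  by apply: rd_eq (rd_scale c (rd_id x)) _; rewrite mulr1.
have dF' : derive1 (fun t : R => c * t) = fun=> c.
  by apply: funext => x; rewrite derive1E (@derive_val _ _ _ _ _ _ _ (dF x)).
have sp (x : R) : x \in `[n.+2%:R^-1, n.+2%:R] -> 0 < x.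
  by rewrite in_itv/= => /andP[+ _]; apply: lt_le_trans; rewrite invr_gt0.
have cfc (x : R) : 0 < x -> {for x, continuous (fun t => f (c * t))}.
  move=> x0; apply: continuous_comp; first exact: rd_cont (dF x).
  by apply: cf; rewrite mulr_gt0.
have ifc : mu.-integrable (seg n.+1) (EFin \o (fun t => f (c * t))).
  apply: continuous_compact_integrable; first exact: segment_compact.
  by apply: continuous_in_subspaceT => x /set_mem /sp /cfc.
rewrite -RintegralZl//; last exact: measurable_itv.
rewrite /Rintegral (@integration_by_substitution_increasing _ (fun t : R => c * t) f n.+2%:R^-1 n.+2%:R).
- by congr fine; apply: eq_integral => x _; rewrite dF' /= mulrC.
- exact: ltW (seg_lt n).
- by move=> x y _ _; rewrite ltr_pM2l.
- by rewrite dF' => x _; exact: cvg_cst.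
- by rewrite dF'; exact: is_cvg_cst.
- by rewrite dF'; exact: is_cvg_cst.
- split; first by move=> x _; exact: (@ex_derive _ _ _ _ _ _ _ (dF x)).
  + exact/cvg_at_right_filter/(rd_cont (dF _)).
  + exact/cvg_at_left_filter/(rd_cont (dF _)).
- apply: continuous_in_subspaceT => x; rewrite inE/= in_itv/= => /andP[+ _] => h.
  by apply: cf; apply: lt_le_trans h; rewrite mulr_gt0// invr_gt0.
Qed.

Lemma cseg_sub n : cseg n `<=` pos.
Proof.
move=> t; rewrite /cseg/= posE in_itv/= => /andP[+ _]; apply: lt_le_trans.
by rewrite mulr_gt0// invr_gt0.
Qed.

Lemma cseg_cvg (h : R -> R) t : 0 < t -> (h \_ (cseg n)) t @[n --> \oo] --> h t.
Proof.
move=> t0; apply: cvg_near_cst; near=> n.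
rewrite patchE ifT// inE /cseg/= in_itv/=; apply/andP; split.
  rewrite ler_pdivrMr// -ler_pdivrMl//.
  rewrite (@le_trans _ _ n%:R) ?ler_nat//; last by rewrite ltnW.
  by near: n; exact: nbhs_infty_ger.
rewrite -ler_pdivrMl// (@le_trans _ _ n%:R) ?ler_nat//; last by rewrite ltnW.
by near: n; exact: nbhs_infty_ger.
Unshelve. all: by end_near. Qed.

Lemma cseg_dct (h : R -> R) : int0 h -> \int[mu]_(t in cseg n) h t @[n --> \oo] --> I0 h.
Proof.
move=> inth.
have -> : (fun n => \int[mu]_(t in cseg n) h t) = (fun n => I0 (h \_ (cseg n))).
  by apply: funext => n; rewrite /I0 -Rintegral_mkcondr setIidr//; exact: cseg_sub.
apply: (@I0_dct (fun n => h \_ (cseg n)) h (fun t => `|h t|) _ _ _ _).2.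
- move=> n; apply/measurable_restrict => //; first exact: measurable_itv.
  by apply: measurable_funS (int0_mfun inth) => //; exact: subIsetl.
- exact: int0_norm.
- by move=> t; exact: cseg_cvg.
- by move=> n t _; rewrite patchE; case: ifP => // _; rewrite normr0.
Qed.

End scaling.

Lemma cont_scale (f : R -> R) (c : R) : 0 < c -> (forall t : R, 0 < t -> {for t, continuous f}) ->
  forall t : R, 0 < t -> {for t, continuous (fun t => f (c * t))}.
Proof.
move=> c0 cf t t0; apply: continuous_comp; first exact: rd_cont (rd_scale c (rd_id t)).
by apply: cf; rewrite mulr_gt0.
Qed.

Lemma int0_scale (f : R -> R) (c : R) : 0 < c -> (forall t : R, 0 < t -> {for t, continuous f}) ->
  int0 f -> int0 (fun t => f (c * t)).
Proof.
move=> c0 cf intf.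
have cfc := cont_scale c0 cf.
have cn (g : R -> R) : (forall t : R, 0 < t -> {for t, continuous g}) ->
    forall t : R, 0 < t -> {for t, continuous (fun t => `|g t|)}.
  by move=> cg t t0; apply: continuous_comp; [exact: cg|exact: norm_continuous].
(* Passing to the absolute value makes the monotone criterion [seg_ge0_int0] available. *)
suff h : int0 (fun t => `|f (c * t)|) by apply: int0_le h _ => //; exact: mfun0_cont.
have hseg n : \int[mu]_(t in seg n.+1) `|f (c * t)| <= c^-1 * I0 (fun t => `|f t|).
  rewrite ler_pdivlMl// -(@scale_seg (fun t => `|f t|) c c0 (cn _ cf)) /I0.
  have sub := @cseg_sub c c0 n.
  rewrite -[in leLHS](setIidr sub) Rintegral_mkcondr; apply: le_I0.
  - apply: int0_le (int0_norm intf) _.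
      by apply: (@mfun0_restrict _ (fun t => `|f t|)); [exact: measurable_itv|exact: int0_mfun (int0_norm intf)].
    by move=> t _; rewrite patchE; case: ifP => _; rewrite ?normr_id ?normr0.
  - exact: int0_norm.
  - by move=> t _; rewrite patchE; case: ifP => _; rewrite ?lexx ?normr_ge0.
have int_seg n : mu.-integrable (seg n.+1) (EFin \o (fun t => `|f (c * t)|)).
  apply: continuous_compact_integrable; first exact: segment_compact.
  apply: continuous_in_subspaceT => x /set_mem; rewrite /seg/= in_itv/= => /andP[h _].
  by apply: cn => //; apply: lt_le_trans h; rewrite invr_gt0.
apply: (@seg_ge0_int0 _ (c^-1 * I0 (fun t => `|f t|))) => //.
- by apply: mfun0_cont; exact: cn.
- case=> [|n]; last exact: int_seg.
  apply: integrableS (int_seg 0%N); [exact: measurable_itv|exact: measurable_itv|].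
  move=> t; rewrite /seg/= !in_itv/= invr1 => /andP[t1 t2].
  by rewrite (le_trans _ t1) ?(le_trans t2) ?invf_le1 ?ler1n.
- case=> [|n]; last exact: hseg.
  rewrite /seg invr1 set_itv1 Rintegral_set1 mulr_ge0 ?invr_ge0 ?I0_ge0//; exact: ltW.
Qed.

Lemma I0_scale (f : R -> R) (c : R) : 0 < c -> (forall t : R, 0 < t -> {for t, continuous f}) ->
  int0 f -> I0 f = c * I0 (fun t => f (c * t)).
Proof.
move=> c0 cf intf.
have h1 := cseg_dct c0 intf.
have h2 : \int[mu]_(t in seg n.+1) f (c * t) @[n --> \oo] --> I0 (fun t => f (c * t)).
  rewrite (cvg_shiftS (fun n => \int[mu]_(t in seg n) f (c * t))).
  by apply: seg_dct; exact: int0_scale.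
apply: cvgn_uniq h1 (cvgM (cvg_cst c) h2) _ => n; exact: scale_seg.
Qed.

Section fubini0.
Variable F : R -> R -> R.
Hypothesis mF : measurable_fun setT (fun x : R * R => F x.1 x.2).
Hypothesis F1 : forall t, 0 < t -> int0 (F t).
Hypothesis F2 : forall s, 0 < s -> int0 (fun t => F t s).
Hypothesis F3 : exists2 H, int0 H & forall t, 0 < t -> I0 (fun s => `|F t s|) <= H t.

(** Extension by zero off the open quadrant, so that Fubini's theorem on the whole plane applies. *)
Let f (x : R * R) : \bar R := (F x.1 x.2 * (\1_pos x.1 * \1_pos x.2))%:E.

Let ind1 (g : R -> R) : (\int[mu]_(s in pos) (g s)%:E = \int[mu]_s (g s * \1_pos s)%:E)%E.
Proof.
rewrite integral_mkcond; apply: eq_integral => s _; rewrite patchE indicE.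
by case: ifP => _; rewrite ?mulr1 ?mulr0.
Qed.

Let mf : measurable_fun setT f.
Proof.
apply/measurable_EFinP; apply: measurable_funM => //; apply: measurable_funM.
  exact: (measurableT_comp (measurable_indic measurable_pos) measurable_fst).
exact: (measurableT_comp (measurable_indic measurable_pos) measurable_snd).
Qed.

Let fin1 t : (\int[mu]_s f (t, s) = (I0 (F t) * \1_pos t)%:E)%E.
Proof.
rewrite indicE; case: (boolP (t \in pos)) => tp; last first.
  rewrite mulr0; apply: integral0_eq => s _.
  by rewrite /f/= indicE (negbTE tp) mul0r mulr0.
rewrite mulr1 -EFin_I0 ?ind1; last by apply: F1; move: tp; rewrite inE posE.
by apply: eq_integral => s _; rewrite /f/= [\1_pos t]indicE tp mul1r.
Qed.

Let fin2 s : (\int[mu]_t f (t, s) = (I0 (fun t => F t s) * \1_pos s)%:E)%E.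
Proof.
rewrite indicE; case: (boolP (s \in pos)) => tp; last first.
  rewrite mulr0; apply: integral0_eq => t _.
  by rewrite /f/= [\1_pos s]indicE (negbTE tp) !mulr0.
rewrite mulr1 -EFin_I0 ?ind1; last by apply: F2; move: tp; rewrite inE posE.
by apply: eq_integral => t _; rewrite /f/= [\1_pos s]indicE tp mulr1.
Qed.

Let fin1a t : (\int[mu]_s `|f (t, s)| = (I0 (fun s => `|F t s|) * \1_pos t)%:E)%E.
Proof.
rewrite indicE; case: (boolP (t \in pos)) => tp; last first.
  rewrite mulr0; apply: integral0_eq => s _.
  by rewrite /f/= indicE (negbTE tp) mul0r mulr0 normr0.
have t0 : 0 < t by move: tp; rewrite inE posE.
rewrite mulr1 -EFin_I0 ?ind1; last by apply: int0_norm; exact: F1.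
apply: eq_integral => s _; rewrite /f/= [\1_pos t]indicE tp mul1r normrM.
by congr (_ * _)%:E; rewrite indicE; case: (_ \in _); rewrite ?normr1 ?normr0.
Qed.

Let mfun_norm : mfun0 (fun t => I0 (fun s => `|F t s|)).
Proof.
have h : measurable_fun setT (fun t => (\int[mu]_s `|f (t, s)|)%E).
  apply: (measurable_fun_fubini_tonelli_F (m2 := mu) (abse \o f)) => //=.
  exact: measurableT_comp.
apply/measurable_EFinP; apply: (eq_measurable_fun (fun t => \int[mu]_s `|f (t, s)|)%E).
  by move=> t tp; rewrite fin1a indicE tp mulr1.
exact: measurable_funS h.
Qed.

(** Tonelli: the iterated integral of |f| is finite because [F3] bounds the inner one by an
    integrable function. *)
Let intf : (mu \x mu)%E.-integrable setT f.
Proof.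
apply/(integrable12ltyP mu mu mf); have [H iH FH] := F3.
have -> : (\int[mu]_x \int[mu]_y `|f (x, y)| = \int[mu]_(x in pos) (I0 (fun s => `|F x s|))%:E)%E.
  by rewrite ind1; apply: eq_integral => t _; rewrite fin1a.
have iN : int0 (fun t => I0 (fun s => `|F t s|)).
  apply: int0_le mfun_norm iH _ => t t0.
  by rewrite ger0_norm ?FH//; apply: I0_ge0.
by rewrite EFin_I0// ltry.
Qed.

Let int1 (g : R -> R) : mu.-integrable setT (fun t => (g t * \1_pos t)%:E) -> int0 g.
Proof.
move=> ig; apply: (@eq_integrable _ _ _ mu pos _ (fun t => (g t * \1_pos t)%:E)) => //.
  by move=> t tp; rewrite indicE tp mulr1.
by apply: integrableS ig.
Qed.

Lemma fubini0 : [/\ int0 (fun t => I0 (F t)), int0 (fun s => I0 (fun t => F t s)) &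
  I0 (fun t => I0 (F t)) = I0 (fun s => I0 (fun t => F t s))].
Proof.
have i1 : int0 (fun t => I0 (F t)).
  apply: int1; have := integrable_fubini_F intf.
  by apply: eq_integrable => // t _; exact: fin1.
(* In the other order, integrability follows from |int f dt| <= int |f| dt and the finiteness of the
   iterated integral of |f|. *)
have i2 : int0 (fun s => I0 (fun t => F t s)).
  apply: int1; apply: (@eq_integrable _ _ _ mu setT measurableT (fun s => \int[mu]_t f (t, s))%E).
    by move=> s _; exact: fin2.
  apply/integrableP; split; first exact: (measurable_fubini_G intf).
  apply: le_lt_trans ((integrable21ltyP mu mu mf).1 intf).
  have mna : measurable_fun setT (abse \o f) by exact: measurableT_comp.
  apply: ge0_le_integral => //.
  - by apply: measurableT_comp => //; exact: (measurable_fubini_G intf).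
  - by apply: (measurable_fun_fubini_tonelli_G (m1 := mu) (abse \o f)) => //= x; exact: abse_ge0.
  - move=> s _; apply: le_abse_integral => //.
    by apply: (measurableT_comp mf); exact: pair2_measurable.
split; [exact: i1|exact: i2|].
apply: EFin_inj; rewrite -(EFin_I0 i1) -(EFin_I0 i2) !ind1.
under eq_integral do rewrite -fin1.
under [RHS]eq_integral do rewrite -fin2.
exact: Fubini.
Qed.

End fubini0.

End HalfLine.

(** * The reciprocal gamma function *)

Section Limits.
Context {R : realType}.
Implicit Types (f G : R -> R) (p q r t x C : R).

Lemma powR_le1 t p q : 0 < t -> t <= 1 -> p <= q -> t `^ q <= t `^ p.
Proof. by move=> t0 t1; apply: ger_powR; rewrite t0 t1. Qed.

Lemma powR_small p C (e : R) : 0 < p -> 0 < e -> exists2 d : R, 0 < d &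
  forall t, 0 < t -> t < d -> `|C * t `^ p| < e.
Proof.
move=> p0 e0; pose K := `|C| + 1; have K0 : 0 < K by rewrite ltr_wpDl.
exists ((e / K) `^ p^-1); first by rewrite powR_gt0// divr_gt0.
move=> t t0 td; rewrite normrM (ger0_norm (powR_ge0 _ _)).
apply: (@le_lt_trans _ _ (K * t `^ p)).
  by rewrite ler_wpM2r ?powR_ge0// lerDl.
rewrite mulrC -ltr_pdivlMr//.
have -> : e / K = ((e / K) `^ p^-1) `^ p.
  by rewrite -powRrM mulVf ?gt_eqF// powRr1// ltW// divr_gt0.
by apply: gt0_ltr_powR; rewrite // nnegrE ?powR_ge0// ltW.
Qed.

Lemma cvg0_pow f p C : 0 < p ->
  (forall t, 0 < t -> t <= 1 -> `|f t| <= C * t `^ p) -> f x @[x --> 0^'+] --> 0.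
Proof.
move=> p0 fC; apply/cvgrPdist_lt => e e0; have [d d0 h] := powR_small C p0 e0.
near=> t; rewrite sub0r normrN.
have t0 : 0 < t by near: t; exact: nbhs_right_gt.
apply: le_lt_trans (fC t t0 _) (le_lt_trans (ler_norm _) (h t t0 _)).
- by near: t; exact: nbhs_right_le.
- by near: t; exact: nbhs_right_lt.
Unshelve. all: by end_near. Qed.

Lemma cvgy_pow f q C : q < 0 ->
  (forall t, 1 <= t -> `|f t| <= C * t `^ q) -> f x @[x --> +oo] --> 0.
Proof.
move=> q0 fC; apply/cvgrPdist_lt => e e0.
have [d d0 h] := @powR_small (- q) C e ltac:(by rewrite oppr_gt0) e0.
near=> t; rewrite sub0r normrN.
have t1 : 1 <= t by near: t; exact: nbhs_pinfty_ge.
have t0 : 0 < t by exact: lt_le_trans t1.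
apply: le_lt_trans (fC t t1) (le_lt_trans (ler_norm _) _).
have -> : t `^ q = (t^-1) `^ (- q).
  by rewrite -powR_inv1 ?(ltW t0)// -powRrM; congr (_ `^ _); ring.
apply: h; first by rewrite invr_gt0.
rewrite -[d]invrK ltf_pV2 ?posrE ?invr_gt0//.
by near: t; apply: nbhs_pinfty_gt; exact: num_real.
Unshelve. all: by end_near. Qed.

(** The power bounds make [G] vanish at both ends. Most integrations by parts below take this form:
    the difference of the two sides is the derivative of a product without boundary terms. *)
Lemma ftc0_zero (f G : R -> R) p q C : 0 < p -> q < 0 ->
  (forall t : R, 0 < t -> {for t, continuous f}) ->
  (forall t : R, 0 < t -> rderiv G t (f t)) -> int0 f ->
  (forall t, 0 < t -> t <= 1 -> `|G t| <= C * t `^ p) ->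
  (forall t, 1 <= t -> `|G t| <= C * t `^ q) -> I0 f = 0.
Proof.
move=> p0 q0 cf dG intf h0 h1.
by rewrite (ftc0 cf dG intf (cvg0_pow p0 h0) (cvgy_pow q0 h1)) subr0.
Qed.

Lemma expR_ge_powR r : exists2 C : R, 0 <= C & forall t, 1 <= t -> t `^ r <= C * expR t.
Proof.
have [n rn] : exists n : nat, r <= n.+1%:R.
  exists (Num.truncn r); have [r0|r0] := leP 0 r; last by rewrite (le_trans (ltW r0)).
  exact/ltW/truncnS_gt.
exists n.+1`!%:R => // t t1; have t0 : 0 <= t by apply: le_trans t1.
apply: le_trans (ler_powR t1 rn) _; rewrite powR_mulrn//.
rewrite mulrC -ler_pdivrMr ?ltr0n ?fact_gt0//.
by apply: le_trans (expR_ge1Dxn n t0); rewrite lerDr.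
Qed.

Lemma powR_expR_decay r c q : 0 < c -> exists2 C : R, 0 <= C &
  forall t, 1 <= t -> t `^ r * expR (- (c * t)) <= C * t `^ q.
Proof.
move=> c0; have [C C0 h] := expR_ge_powR (r - q).
pose M := Num.max 1 c^-1; have M1 : 1 <= M by rewrite le_max lexx.
have Mc : 1 <= M * c.
  by rewrite -ler_pdivrMr// div1r le_max lexx orbT.
pose s := r - q.
exists (C * `|M `^ s|  + C * `|c `^ (- s)| + `|M `^ `|s| |) => [|t t1].
  by rewrite !addr_ge0 ?mulr_ge0.
have t0 : 0 < t by apply: lt_le_trans t1.
suff h2 : t `^ s <= (C * `|M `^ s| + C * `|c `^ (- s)| + `|M `^ `|s| |) * expR (c * t).
  rewrite expRN ler_pdivrMr ?expR_gt0// mulrAC.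
  rewrite (@powR_eqD _ t s q r t0); last by rewrite /s; ring.
  by rewrite ler_wpM2r ?powR_ge0.
(* If ct >= 1, the bound for c = 1 is rescaled. Otherwise t lies between 1 and 1/c, and a constant
   majorant is enough. *)
have [ct1|ct1] := leP 1 (c * t).
  have -> : t `^ s = c `^ (- s) * (c * t) `^ s.
    by rewrite powRM ?(ltW c0) ?(ltW t0)// mulrA -powRDx// addNr powRr0 mul1r.
  apply: (@le_trans _ _ (`|c `^ (- s)| * (C * expR (c * t)))).
    by rewrite ger0_norm ?powR_ge0// ler_wpM2l ?powR_ge0// h.
  rewrite mulrA ler_wpM2r ?expR_ge0// mulrC -addrAC lerDr.
  by rewrite addr_ge0 ?mulr_ge0.
have tM : t <= M.
  rewrite le_max; apply/orP; right; rewrite -[t]invrK lef_pV2 ?posrE ?invr_gt0//.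
  by rewrite -[leRHS]mul1r ler_pdivlMr// ltW.
have tMs : t `^ s <= M `^ `|s|.
  apply: (@le_trans _ _ (t `^ `|s|)); first by apply: ler_powR => //; exact: ler_norm.
  apply: ge0_ler_powR => //; rewrite nnegrE ?(ltW t0)//.
  exact: le_trans M1.
apply: le_trans tMs _; apply: (@le_trans _ _ (`|M `^ `|s| | * expR (c * t))).
  rewrite -[leLHS]mulr1 ler_pM ?powR_ge0 ?ler_norm// -expR0 ler_expR.
  by rewrite mulr_ge0// ltW.
by rewrite ler_wpM2r ?expR_ge0// lerDr addr_ge0 ?mulr_ge0.
Qed.

Lemma cont_powR r t : 0 < t -> {for t, continuous (fun t => t `^ r)}.
Proof. by move=> t0; apply: rd_cont (rd_powR r t0). Qed.

Lemma cont_expN (c : R) t : {for t, continuous (fun t => expR (- (c * t)))}.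
Proof. exact: rd_cont (rd_expN c t). Qed.

Lemma cont_exprN t : {for t, continuous (fun t : R => expR (- t))}.
Proof. exact: rd_cont (rd_comp (rd_expR _) (rd_opp (rd_id t))). Qed.

Lemma cvgn_ext (u v : nat -> R) (l l' : R) : v @ \oo --> l' -> (forall n, u n = v n) ->
  l' = l -> u @ \oo --> l.
Proof. by move=> vl /funext -> <-. Qed.

Lemma int0_powR_expR p c : -1 < p -> 0 < c ->
  int0 (fun t => t `^ p * expR (- (c * t))).
Proof.
move=> p1 c0; have [C C0 h] := powR_expR_decay p (-2) c0.
apply: (@int0_near_bounds _ _ p (-2) (Num.max 1 C)) => //; first by lra.
- by apply: mfun0_cont => t t0; apply: cvgM; [exact: cont_powR|exact: cont_expN].
- move=> t t0 t1; rewrite ger0_norm ?mulr_ge0 ?powR_ge0 ?expR_ge0// mulrC ler_wpM2r ?powR_ge0//.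
  rewrite le_max; apply/orP; left; rewrite -expR0 ler_expR oppr_le0 mulr_ge0// ltW//.
- move=> t t1; rewrite ger0_norm ?mulr_ge0 ?powR_ge0 ?expR_ge0//.
  by apply: le_trans (h t t1) _; rewrite ler_wpM2r ?powR_ge0// le_max lexx orbT.
Qed.

End Limits.

Section Gamma.
Context {R : realType}.
Implicit Types (x y a h t N : R).

Definition Gam x := I0 (fun t : R => t `^ (x - 1) * expR (- t)).

Lemma int0_Gam x : 0 < x -> int0 (fun t : R => t `^ (x - 1) * expR (- t)).
Proof.
move=> x0; apply: int0_eq (@int0_powR_expR R (x - 1) 1 _ ltr01); last by lra.
by move=> t _; rewrite mul1r.
Qed.

(** A zero integral would make f vanish almost everywhere, so ]0, 1[, where f is positive, would be
    a null set. *)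
Lemma I0_gt0 (f : R -> R) : int0 f -> (forall t : R, 0 < t -> {for t, continuous f}) ->
  (forall t : R, 0 < t -> 0 < f t) -> 0 < I0 f.
Proof.
move=> intf cf f0.
have ge : 0 <= I0 f by apply: I0_ge0 => t /f0/ltW.
rewrite lt_neqAle ge andbT; apply/eqP => I00.
have mf := int0_mfun intf.
have : (\int[@lebesgue_measure R]_(t in pos) `|(f t)%:E| = 0)%E.
  have -> : (\int[@lebesgue_measure R]_(t in pos) `|(f t)%:E| = \int[@lebesgue_measure R]_(t in pos) (f t)%:E)%E.
    by apply: eq_integral => t; rewrite inE posE => t0 /=; rewrite ger0_norm// ltW// f0.
  by rewrite EFin_I0// -I00.
move/(@ae_eq_integral_abs _ _ _ (@lebesgue_measure R) pos (measurable_pos) (EFin \o f)).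
move/measurable_EFinP : mf => mf /(_ mf) [N [mN N0 sub]].
have : (@lebesgue_measure R `]0%R, 1%R[%classic <= @lebesgue_measure R N)%E.
  apply: le_measure; rewrite ?inE//.
  move=> t /=; rewrite in_itv/= => /andP[t0 _]; apply: sub => /=.
  rewrite /pos/= in_itv/= t0 /= => /(_ isT) [] ft; have := f0 t t0.
  by rewrite ft ltxx.
by rewrite N0 lebesgue_measure_itv/= lte_fin ltr01 sube0 lee_fin ler10.
Qed.

Lemma Gam_gt0 x : 0 < x -> 0 < Gam x.
Proof.
move=> x0; apply: I0_gt0; first exact: int0_Gam.
- move=> t t0; apply: cvgM; first exact: cont_powR.
  exact: cont_exprN.
- by move=> t t0; rewrite mulr_gt0 ?powR_gt0 ?expR_gt0.
Qed.

Lemma GamS x : 0 < x -> Gam (x + 1) = x * Gam x.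
Proof.
move=> x0; rewrite /Gam addrK -I0Z; last exact: int0_Gam.
have [C C0 hC] := @powR_expR_decay R x 1 (-1) ltr01.
have i1 : int0 (fun t : R => t `^ x * expR (- t)).
  by have := @int0_Gam (x + 1); rewrite addrK; apply; lra.
apply/eqP; rewrite -subr_eq0 -I0B//; last by apply: int0Z; exact: int0_Gam.
apply/eqP; apply: (@ftc0_zero R _ (fun t => - (t `^ x * expR (- t))) x (-1) (1 + C)) => //.
- move=> t t0; apply: cvgB.
    apply: cvgM; first exact: cont_powR.
    exact: cont_exprN.
  apply: cvgM; first exact: cvg_cst.
  apply: cvgM; first exact: cont_powR.
  exact: cont_exprN.
- move=> t t0; apply: rd_eq (rd_opp (rd_mul (rd_powR x t0) (rd_comp (rd_expR _) (rd_opp (rd_id t))))) _.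
  by ring.
- by apply: int0B => //; apply: int0Z; exact: int0_Gam.
- move=> t t0 t1; rewrite normrN ger0_norm ?mulr_ge0 ?powR_ge0 ?expR_ge0// mulrC.
  apply: ler_wpM2r; first exact: powR_ge0.
  rewrite (@le_trans _ _ 1)//; last by lra.
  by rewrite -expR0 ler_expR; lra.
- move=> t t1; rewrite normrN ger0_norm ?mulr_ge0 ?powR_ge0 ?expR_ge0//.
  have := hC t t1; rewrite mul1r => /le_trans; apply.
  by apply: ler_wpM2r; [exact: powR_ge0|lra].
Qed.

Lemma Gam1 : Gam 1 = 1.
Proof.
rewrite /Gam.
have cE t : {for t, continuous (fun t : R => expR (- t))}.
  exact: cont_exprN.
have e (t : R) : 0 < t -> t `^ (1 - 1) * expR (- t) = expR (- t).
  by move=> t0; rewrite subrr powRr0 mul1r.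
rewrite (I0_eq e) (@ftc0 R _ (fun t => - expR (- t)) _ _ (-1) 0) ?subrr ?opprK ?sub0r ?add0r//.
- move=> t t0; apply: rd_eq (rd_opp (rd_comp (rd_expR _) (rd_opp (rd_id t)))) _.
  by rewrite mulrN1 opprK.
- by apply: int0_eq e _; exact: int0_Gam.
- apply: cvgN; rewrite -[X in _ --> X]expR0 -[X in expR X]oppr0; exact: cvg_at_right_filter (cE 0).
- rewrite -[X in _ --> X]oppr0; apply: cvgN; exact: cvgr_expR.
Qed.

(** Weighted arithmetic-geometric inequality for t and 1: the logarithms of both are compared with
    the tangent line of ln at the weighted mean c. *)
Lemma wpowR_le h t : 0 <= h -> h <= 1 -> 0 < t -> t `^ h <= 1 - h + h * t.
Proof.
move=> h0 h1 t0; set c := 1 - h + h * t.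
have c0 : 0 < c.
  have [h_1|hn] := eqVneq h 1; first by rewrite /c h_1; lra.
  have : h < 1 by rewrite lt_neqAle hn.
  by move=> ?; rewrite /c ltr_wpDr ?mulr_ge0 ?(ltW t0)// subr_gt0.
rewrite -[leRHS]lnK ?posrE// /powR gt_eqF// ler_expR.
have h2 y : 0 < y -> ln y - ln c <= y / c - 1.
  move=> y0; have := expR_ge1Dx (ln y - ln c).
  by rewrite expRB !lnK ?posrE//; lra.
have a1 := h2 t t0; have a2 := h2 1 ltr01; rewrite ln1 in a2.
have e : h * (t / c - 1) + (1 - h) * (1 / c - 1) = 0.
  by rewrite /c; field; rewrite -/c gt_eqF.
have b1 : h * (ln t - ln c) <= h * (t / c - 1) by apply: ler_wpM2l.
have b2 : (1 - h) * (0 - ln c) <= (1 - h) * (1 / c - 1) by apply: ler_wpM2l; rewrite ?subr_ge0.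
move: e b1 b2; lra.
Qed.

(** Integrates [wpowR_le] at t / N against t^(a-1) exp(-t). It plays the part of log-convexity, and
    the free scale N is adapted to each use. *)
Lemma Gam_interp a h N : 0 < a -> 0 <= h -> h <= 1 -> 0 < N ->
  Gam (a + h) <= N `^ h * ((1 - h) * Gam a + h * Gam (a + 1) / N).
Proof.
move=> a0 h0 h1 N0; have ia := int0_Gam a0.
have iah : int0 (fun t : R => t `^ (a + h - 1) * expR (- t)) by apply: int0_Gam; lra.
have ia1 : int0 (fun t : R => t `^ (a + 1 - 1) * expR (- t)) by apply: int0_Gam; lra.
have -> : N `^ h * ((1 - h) * Gam a + h * Gam (a + 1) / N) =
  (N `^ h * (1 - h)) * Gam a + (N `^ h * h / N) * Gam (a + 1) by ring.
rewrite -!I0Z// -I0D; [|exact: int0Z|exact: int0Z].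
apply: le_I0 => //; first by apply: int0D; exact: int0Z.
move=> t t0; rewrite (@powR_eqD R t h (a - 1) _ t0); last by lra.
rewrite (@powR_eqD R t 1 (a - 1) (a + 1 - 1) t0); last by lra.
rewrite powRr1 ?(ltW t0)//.
have -> : t `^ h = N `^ h * (t / N) `^ h.
  by rewrite -powRM ?ltW ?divr_gt0// mulrCA divff ?gt_eqF// mulr1.
have -> : N `^ h * (1 - h) * (t `^ (a - 1) * expR (- t)) + N `^ h * h / N * (t * t `^ (a - 1) * expR (- t))
  = N `^ h * (1 - h + h * (t / N)) * t `^ (a - 1) * expR (- t) by ring.
apply: ler_wpM2r; first exact: expR_ge0.
apply: ler_wpM2r; first exact: powR_ge0.
by rewrite ler_wpM2l ?powR_ge0// wpowR_le// divr_gt0.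
Qed.

Lemma Gam_nat n : Gam (n.+1%:R) = n`!%:R.
Proof.
elim: n => [|n IH]; first by rewrite Gam1 fact0.
by rewrite -[n.+2%:R]natr1 GamS ?ltr0n// IH factS natrM.
Qed.

Definition rgs x (n : nat) : R := (\prod_(k < n.+1) (x + k%:R)) / (n`!%:R * n%:R `^ x).

Lemma Gam_prod x n : 0 < x -> Gam (x + n.+1%:R) = (\prod_(k < n.+1) (x + k%:R)) * Gam x.
Proof.
move=> x0; elim: n => [|n IH]; first by rewrite big_ord_recr big_ord0 /= mul1r addr0 GamS.
rewrite big_ord_recr /= -addn1 natrD addrA GamS; last by rewrite ltr_wpDr.
by rewrite IH; ring.
Qed.

(** The ratio Gamma(x+n+2) / ((n+1)! (n+1)^x) is squeezed to 1: interpolating from n+2 by x bounds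
    it above, and interpolating from x+n+2 by 1-x up to n+3 bounds it below. *)
Lemma rgs_Gam01 x : 0 < x -> x <= 1 -> rgs x n @[n --> \oo] --> (Gam x)^-1.
Proof.
move=> x0 x1; have G0 := Gam_gt0 x0.
rewrite -(cvg_shiftS (rgs x)).
have e n : rgs x n.+1 = (Gam x)^-1 * (Gam (x + n.+2%:R) / (n.+1`!%:R * n.+1%:R `^ x)).
  by rewrite Gam_prod// /rgs; field; rewrite !gt_eqF ?powR_gt0 ?ltr0n ?fact_gt0.
apply: (cvgn_ext _ e (mulr1 _)); apply: cvgM; first exact: cvg_cst.
have inv0 : (n.+1%:R^-1 : R) @[n --> \oo] --> 0 by exact: cvg_harmonic.
apply: (@squeeze_cvgr _ _ _ _ (fun n => (n.+2%:R) / (n.+1%:R + (1 - x) * (x + 1))) (fun n => 1 + x / n.+1%:R)).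
- near=> n; set N : R := n.+1%:R; have N0 : 0 < N by rewrite ltr0n.
  have f0 : 0 < n.+1`!%:R :> R by rewrite ltr0n fact_gt0.
  have p0 : 0 < N `^ x by rewrite powR_gt0.
  have n2 : n.+2%:R = N + 1 :> R by rewrite /N -natr1.
  apply/andP; split.
  + have h := @Gam_interp (x + n.+2%:R) (1 - x) N ltac:(by rewrite ltr_wpDr) ltac:(lra) ltac:(lra) N0.
    have e1 : x + n.+2%:R + (1 - x) = n.+3%:R :> R by rewrite -[n.+3%:R]natr1; ring.
    move: h; rewrite e1 Gam_nat GamS ?ltr_wpDr// (@powR_eqD _ N 1 (- x) _ N0)// powRr1 ?(ltW N0)// powRN => h.
    have D0 : 0 < N + (1 - x) * (x + 1) by rewrite ltr_wpDr// mulr_ge0; lra.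
    rewrite ler_pdivrMr// mulrAC ler_pdivlMr ?mulr_gt0//.
    have e2 : n.+2`!%:R = (N + 1) * n.+1`!%:R :> R by rewrite factS natrM n2.
    move: h; rewrite e2 n2 => h.
    have e3 : Gam (x + (N + 1)) * (N + (1 - x) * (x + 1)) = N `^ x * (N * (N `^ x)^-1 *
       ((1 - (1 - x)) * Gam (x + (N + 1)) + (1 - x) * ((x + (N + 1)) * Gam (x + (N + 1))) / N)).
      by field; rewrite !gt_eqF.
    have e4 : (N + 1) * (n.+1`!%:R * N `^ x) = N `^ x * ((N + 1) * n.+1`!%:R) by ring.
    by rewrite e3 e4 ler_wpM2l// ltW.
  + have h := @Gam_interp n.+2%:R x N ltac:(by []) (ltW x0) x1 N0.
    rewrite ler_pdivrMr ?mulr_gt0// addrC; apply: le_trans h _.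
    rewrite GamS// Gam_nat n2 le_eqVlt; apply/orP; left; apply/eqP.
    by field; rewrite gt_eqF.
- have e2 n : n.+2%:R / (n.+1%:R + (1 - x) * (x + 1)) = (1 + n.+1%:R^-1) / (1 + (1 - x) * (x + 1) * n.+1%:R^-1) :> R.
    have N0 : 0 < n.+1%:R :> R by rewrite ltr0n.
    have D0 : 0 < n.+1%:R + (1 - x) * (x + 1) by rewrite ltr_wpDr// mulr_ge0; lra.
    rewrite -[n.+2%:R]natr1; move: (n.+1%:R : R) N0 D0 => N N0 D0; field.
    by rewrite !gt_eqF//= (_ : N + _ = N + (1 - x) * (x + 1)) ?gt_eqF//.
  have l1 : (1 + 0) / (1 + (1 - x) * (x + 1) * 0) = 1 :> R by rewrite mulr0 addr0 divr1.
  apply: (cvgn_ext _ e2 l1); apply: cvgM; first by apply: cvgD; [exact: cvg_cst|exact: inv0].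
  apply: cvgV; first by rewrite mulr0 addr0 oner_neq0.
  by apply: cvgD; [exact: cvg_cst|apply: cvgM; [exact: cvg_cst|exact: inv0]].
- have l1 : 1 + x * 0 = 1 by rewrite mulr0 addr0.
  apply: (cvgn_ext _ (fun=> erefl) l1); apply: cvgD; first exact: cvg_cst.
  by apply: cvgM; [exact: cvg_cst|exact: inv0].
Unshelve. all: by end_near. Qed.

(** Finite-level functional equation, up to a factor tending to 1. It carries convergence from x + 1
    down to x for every x, and upwards when x is nonzero. *)
Lemma rgs_shift x n : rgs (x + 1) n.+1 * x = rgs x n.+1 * (1 + (x + 1) / n.+1%:R).
Proof.
have pS m : (\prod_(k < m.+1) (x + 1 + k%:R)) * x = (\prod_(k < m.+1) (x + k%:R)) * (x + m.+1%:R).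
  elim: m => [|m IH]; first by rewrite !big_ord_recr !big_ord0 /= !mul1r !addr0 mulrC.
  rewrite big_ord_recr /= mulrAC IH [in RHS]big_ord_recr /= -[m.+2%:R]natr1 -!mulrA.
  by congr (_ * _); ring.
have N0 : 0 < n.+1%:R :> R by rewrite ltr0n.
rewrite /rgs mulrAC pS (powRDx _ _ N0) powRr1 ?(ltW N0)// -[n.+2%:R]natr1.
by field; rewrite !gt_eqF ?powR_gt0 ?ltr0n ?fact_gt0.
Qed.

Lemma cvg_1harm (c : R) : (1 + c / n.+1%:R) @[n --> \oo] --> (1 : R).
Proof.
have l1 : 1 + c * 0 = 1 by rewrite mulr0 addr0.
apply: (cvgn_ext _ (fun=> erefl) l1); apply: cvgD; first exact: cvg_cst.
by apply: cvgM; [exact: cvg_cst|exact: cvg_harmonic].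
Qed.

Lemma rgs_cvgN x (l : R) : rgs (x + 1) n @[n --> \oo] --> l -> rgs x n @[n --> \oo] --> x * l.
Proof.
rewrite -(cvg_shiftS (rgs (x + 1))) -(cvg_shiftS (rgs x)) => cv.
have v1 := cvg_1harm (x + 1).
have h : rgs x n.+1 * (1 + (x + 1) / n.+1%:R) / (1 + (x + 1) / n.+1%:R) @[n --> \oo] --> x * l.
  have l1 : l * x / 1 = x * l by rewrite divr1 mulrC.
  apply: (cvgn_ext _ (fun=> erefl) l1); apply: cvgM; last by apply: cvgV; rewrite ?oner_neq0.
  apply: (cvgn_ext _ (fun n => esym (rgs_shift x n)) erefl).
  by apply: cvgM => //; exact: cvg_cst.
(* For negative x the factor can vanish at some n, so it is cancelled only for n large. *)
apply: cvg_trans h; apply: near_eq_cvg; near=> n; rewrite mulfK//.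
near: n; have : \forall n \near \oo, `|1 - (1 + (x + 1) / n.+1%:R)| < 1.
  by move/cvgrPdist_lt : v1; apply.
apply: filterS => n; apply: contraTneq => ->.
by rewrite subr0 normr1 ltxx.
Unshelve. all: by end_near. Qed.

Lemma rgs_cvgP x (l : R) : x != 0 -> rgs x n @[n --> \oo] --> l -> rgs (x + 1) n @[n --> \oo] --> l / x.
Proof.
move=> x0; rewrite -(cvg_shiftS (rgs (x + 1))) -(cvg_shiftS (rgs x)) => cv.
have e n : rgs (x + 1) n.+1 = rgs x n.+1 * (1 + (x + 1) / n.+1%:R) / x.
  by rewrite -rgs_shift mulfK.
have l1 : l * 1 / x = l / x by rewrite mulr1.
apply: (cvgn_ext _ e l1); apply: cvgM; last exact: cvg_cst.
by apply: cvgM => //; exact: cvg_1harm.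
Qed.

Lemma pos_ind (P : R -> Prop) : (forall x, 0 < x -> x <= 1 -> P x) ->
  (forall x, 0 < x -> P x -> P (x + 1)) -> forall x, 0 < x -> P x.
Proof.
move=> P1 PS x x0; have [n xn] : exists n : nat, x <= n.+1%:R.
  by exists (Num.truncn x); exact/ltW/truncnS_gt.
elim: n x x0 xn => [|n IH] x x0 xn; first exact: P1.
have [x1|x1] := leP x 1; first exact: P1.
rewrite -(subrK 1 x); apply: PS; first by rewrite subr_gt0.
by apply: IH; [rewrite subr_gt0|rewrite lerBlDr natr1].
Qed.

Lemma real_ind (P : R -> Prop) : (forall x, 0 < x -> P x) ->
  (forall x, P (x + 1) -> P x) -> forall x, P x.
Proof.
move=> P1 PS x; have [n xn] : exists n : nat, 0 < x + n%:R.
  exists (Num.truncn (- x)).+1; rewrite -ltrBlDl sub0r; exact: truncnS_gt.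
elim: n x xn => [|n IH] x xn; first by apply: P1; rewrite addr0 in xn.
by apply: PS; apply: IH; rewrite -addrA (addrC 1) natr1.
Qed.

Lemma rgs_Gam x : 0 < x -> rgs x n @[n --> \oo] --> (Gam x)^-1.
Proof.
move: x; apply: pos_ind; first exact: rgs_Gam01.
move=> x x0 cv; have := rgs_cvgP (lt0r_neq0 x0) cv.
by rewrite GamS// invfM mulrC.
Qed.

Lemma rgamma_cvg x : rgs x n @[n --> \oo] --> rgamma x.
Proof.
rewrite -[rgamma x]/(limn (rgs x)); move: x; apply: real_ind.
  by move=> x x0; apply: cvgP; exact: rgs_Gam.
by move=> x cv; apply: cvgP; exact: rgs_cvgN cv.
Qed.

Lemma rgammaS x : rgamma x = x * rgamma (x + 1).
Proof. have h1 := @rgamma_cvg x; have h2 := rgs_cvgN (@rgamma_cvg (x + 1)).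
by rewrite -(cvg_lim _ h1)// (cvg_lim _ h2). Qed.

Lemma rgammaE x : 0 < x -> rgamma x = (Gam x)^-1.
Proof. move=> x0; have h1 := @rgamma_cvg x; have h2 := rgs_Gam x0.
by rewrite -(cvg_lim _ h1)// (cvg_lim _ h2). Qed.

Lemma rgamma_gt0 x : 0 < x -> 0 < rgamma x.
Proof. by move=> x0; rewrite rgammaE// invr_gt0 Gam_gt0. Qed.

Lemma rgammaSn x n : 0 < x -> rgamma (x + n%:R) <= rgamma x / (\prod_(k < n) (x + k%:R)).
Proof.
move=> x0; elim: n => [|n IH]; first by rewrite big_ord0 divr1 addr0.
rewrite big_ord_recr /= -natr1 addrA.
have xn : 0 < x + n%:R by rewrite ltr_wpDr.
have := IH; rewrite rgammaS invfM mulrA -ler_pdivlMl// mulrC; exact.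
Qed.

Lemma rgamma_fact x n : 1 <= x -> rgamma (x + n%:R) <= rgamma x / n`!%:R.
Proof.
move=> x1; have x0 : 0 < x by apply: lt_le_trans x1.
apply: le_trans (rgammaSn n x0) _; rewrite ler_wpM2l ?(ltW (rgamma_gt0 x0))//.
have pp : n`!%:R <= \prod_(k < n) (x + k%:R).
  elim: n => [|n IH]; first by rewrite big_ord0 fact0.
  rewrite big_ord_recr /= factS natrM mulrC ler_pM//.
  by rewrite -natr1 addrC lerD2r.
rewrite lef_pV2// posrE; first by apply: lt_le_trans pp; rewrite ltr0n fact_gt0.
by rewrite ltr0n fact_gt0.
Qed.

(** Beyond an index K with m + K > 0, [rgamma_fact] bounds every value by the one at K; the finitely
    many earlier ones are covered by their sum. The order m may be negative. *)
Lemma rgamma_bound (m : R) : exists2 C : R, 0 < C & forall k, `|rgamma (m + k%:R + 1)| <= C.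
Proof.
have [K mK] : exists K : nat, 0 < m + K%:R.
  exists (Num.truncn (- m)).+1; rewrite -ltrBlDl sub0r; exact: truncnS_gt.
exists (1 + \sum_(k < K.+1) `|rgamma (m + k%:R + 1)|).
  by rewrite ltr_wpDr// sumr_ge0.
have small k : (k < K.+1)%N -> `|rgamma (m + k%:R + 1)| <= \sum_(k < K.+1) `|rgamma (m + k%:R + 1)|.
  by move=> kK; rewrite (bigD1 (Ordinal kK))//= lerDl sumr_ge0.
move=> k; apply: (@le_trans _ _ (\sum_(k < K.+1) `|rgamma (m + k%:R + 1)|)); last by rewrite lerDr.
have [kK|kK] := ltnP k K.+1; first exact: small.
apply: le_trans (small K (ltnSn K)).
have x1 : 1 <= m + K%:R + 1 by rewrite lerDr ltW.
have x0 : 0 < m + K%:R + 1 by apply: lt_le_trans x1.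
have -> : m + k%:R + 1 = (m + K%:R + 1) + (k - K)%:R.
  by rewrite natrB; [ring|exact: ltnW].
rewrite !gtr0_norm ?rgamma_gt0//; last by rewrite ltr_wpDr.
apply: le_trans (rgamma_fact _ x1) _; rewrite ler_piMr ?(ltW (rgamma_gt0 x0))//.
by rewrite invf_le1 ?ler1n ?ltr0n fact_gt0.
Qed.

(** * Euler's sine product and the reflection formula *)

Local Notation mu := (@lebesgue_measure R).
Local Notation hp := (`[0, pi / 2]%classic : set R).
(** Wallis-type integrals whose recurrence in m generates the factors 1 - x^2/k^2 of the sine
    product. *)
Definition wal (x : R) (m : nat) : R := \int[mu]_(t in hp) (cos (2 * x * t) * cos t ^+ (2 * m)).

Lemma rd_cos t : rderiv cos t (- sin t).
Proof. exact: is_derive_cos. Qed.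

Lemma rd_sin t : rderiv sin t (cos t).
Proof. exact: is_derive_sin. Qed.

Lemma rd_exprn (f : R -> R) t d n : rderiv f t d ->
  rderiv (fun t => f t ^+ n.+1) t (n.+1%:R * f t ^+ n * d).
Proof.
move=> h; elim: n => [|n IH].
  by apply: rd_ext (rd_eq h _); [move=> u; rewrite expr1|rewrite expr0 !mul1r].
apply: rd_ext (rd_eq (rd_mul h IH) _); first by move=> u; rewrite -exprS.
by rewrite -[n.+2%:R]natr1 !exprS; ring.
Qed.

Lemma pi2_gt0 : 0 < pi / 2 :> R.
Proof. by rewrite divr_gt0// pi_gt0. Qed.

Lemma rd_cosM a t : rderiv (fun t => cos (a * t)) t (- a * sin (a * t)).
Proof.
apply: rd_eq (rd_comp (rd_cos _) (rd_scale a (rd_id t))) _.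
by rewrite mulr1 mulNr mulNr mulrC.
Qed.

Lemma rd_sinM a t : rderiv (fun t => sin (a * t)) t (a * cos (a * t)).
Proof.
apply: rd_eq (rd_comp (rd_sin _) (rd_scale a (rd_id t))) _.
by rewrite mulr1 mulrC.
Qed.

Let wf (x : R) (m : nat) (t : R) : R := cos (2 * x * t) * cos t ^+ (2 * m).

Let wf_cont x m t : {for t, continuous (wf x m)}.
Proof.
case: m => [|m].
  apply: (@rd_cont _ _ _ (- (2 * x) * sin (2 * x * t))).
  by apply: rd_ext (rd_cosM _ _) => u; rewrite /wf muln0 expr0 mulr1.
apply: rd_cont (rd_mul (rd_cosM _ _) _); rewrite mulnS; exact: rd_exprn (rd_cos _).
Qed.

Let hp_int (f : R -> R) : (forall t, {for t, continuous f}) -> mu.-integrable hp (EFin \o f).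
Proof.
move=> cf; apply: continuous_compact_integrable; first exact: segment_compact.
by apply: continuous_in_subspaceT => t _; exact: cf.
Qed.

Let wf_int x m : mu.-integrable hp (EFin \o wf x m).
Proof.
apply: continuous_compact_integrable; first exact: segment_compact.
by apply: continuous_in_subspaceT => t _; exact: wf_cont.
Qed.

Let wfZ_int c x m : mu.-integrable hp (EFin \o (fun t => c * wf x m t)).
Proof. by apply: hp_int => t; apply: cvgM; [exact: cvg_cst|exact: wf_cont]. Qed.

Lemma wal_step x m : (m.+1%:R ^+ 2 - x ^+ 2) * wal x m.+1 =
  m.+1%:R * (m.+1%:R - 2^-1) * wal x m.
Proof.
apply/eqP; rewrite -subr_eq0; apply/eqP.
rewrite /wal -!RintegralZl; [|exact: measurable_itv|exact: (wf_int x)|exact: measurable_itv|exact: (wf_int x)].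
rewrite -RintegralB; [|exact: measurable_itv|exact: (wfZ_int _ x)|exact: (wfZ_int _ x)].
pose M : R := m.+1%:R.
(* Antiderivative of the difference of the two sides. It vanishes at 0 through the sines and at pi/2
   through the cosine. *)
pose G t : R := (M / 2) * (cos (2 * x * t) * (cos t ^+ (2 * m).+1 * sin t)) - (x / 2) * (sin (2 * x * t) * cos t ^+ (2 * m.+1)).
have hc t : t \in `[0, pi / 2] -> {for t, continuous (fun t => (M ^+ 2 - x ^+ 2) * wf x m.+1 t - M * (M - 2^-1) * wf x m t)}.
  move=> _; apply: cvgB; apply: cvgM; by [exact: cvg_cst|exact: wf_cont].
have hd t : t \in `[0, pi / 2] -> rderiv G t ((M ^+ 2 - x ^+ 2) * wf x m.+1 t - M * (M - 2^-1) * wf x m t).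
  move=> _; have e2 : (2 * m.+1)%N = (2 * m).+2 by rewrite mulnS.
  have dc := rd_exprn (2 * m).+1 (rd_cos t); have dc' := rd_exprn (2 * m) (rd_cos t).
  rewrite /G /wf e2.
  apply: rd_eq (rd_sub (rd_scale (M / 2) (rd_mul (rd_cosM _ _) (rd_mul dc' (rd_sin t))))
                       (rd_scale (x / 2) (rd_mul (rd_sinM _ _) dc))) _.
  have -> : (2 * m).+2%:R = 2 * M by rewrite /M -e2 natrM.
  have -> : (2 * m).+1%:R = 2 * M - 1 by rewrite /M -[m.+1%:R]natr1 mulrDr mulr1 -natrM -[in LHS]natr1; ring.
  rewrite !exprS; have := cos2Dsin2 t; move: (cos t) (sin t) (cos (2 * x * t)) (sin (2 * x * t)) => c s C S cs.
  apply/eqP; rewrite -subr_eq0; apply/eqP.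
  transitivity (- (M / 2) * C * (2 * M - 1) * c ^+ (2 * m) * (c ^+ 2 + s ^+ 2 - 1)).
    by field.
  by rewrite cs subrr mulr0.
have [_ ->] := @ftc_seg R _ _ 0 (pi / 2) pi2_gt0 hc hd.
by rewrite /G cos_pihalf sin0 mulr0 sin0 mulnS !exprS; ring.
Qed.

Lemma wal0 x : x * wal x 0 = sin (pi * x) / 2.
Proof.
have [->|x0] := eqVneq x 0; first by rewrite mul0r mulr0 sin0 mul0r.
rewrite /wal -RintegralZl; [|exact: measurable_itv|exact: (wf_int x 0)].
have hc t : t \in `[0, pi / 2] -> {for t, continuous (fun t => x * wf x 0 t)}.
  by move=> _; apply: cvgM; [exact: cvg_cst|exact: wf_cont].
have hd t : t \in `[0, pi / 2] -> rderiv (fun t => 2^-1 * sin (2 * x * t)) t (x * wf x 0 t).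
  move=> _; apply: rd_eq (rd_scale _ (rd_sinM _ _)) _.
  by rewrite /wf muln0 expr0; field.
have [_ ->] := @ftc_seg R _ _ 0 (pi / 2) pi2_gt0 hc hd.
have -> : 2 * x * (pi / 2) = pi * x by field.
by rewrite mulr0 sin0; ring.
Qed.

Lemma wal00 : wal 0 0 = pi / 2.
Proof.
have hc (t : R) : t \in `[0, pi / 2] -> {for t, continuous (wf 0 0)} by move=> _; exact: wf_cont.
have hd (t : R) : t \in `[0, pi / 2] -> rderiv (fun t => t) t (wf 0 0 t).
  by move=> _; apply: rd_eq (rd_id _) _; rewrite /wf mulr0 mul0r cos0 muln0 expr0 mulr1.
by have [_ ] := @ftc_seg R _ _ 0 (pi / 2) pi2_gt0 hc hd; rewrite subr0.
Qed.

Lemma mvt_nondecr (f g : R -> R) a b : (forall t, rderiv f t (g t)) ->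
  (forall t, a < t -> t < b -> 0 <= g t) -> a <= b -> f a <= f b.
Proof.
move=> df g0; rewrite le_eqVlt => /predU1P[->//|ab].
have [|c /[!in_itv]/= /andP[ac cb] e] := @MVT _ f g a b ab (fun t _ => df t).
  by apply: continuous_subspaceT => t; exact: rd_cont (df t).
by rewrite -subr_ge0 e mulr_ge0 ?g0// subr_ge0 ltW.
Qed.

Lemma sin_le_id t : 0 <= t -> sin t <= t.
Proof.
move=> t0; rewrite -subr_ge0; have -> : 0 = 0 - sin 0 :> R by rewrite sin0 subrr.
apply: (@mvt_nondecr (fun t => t - sin t) (fun t => 1 - cos t)) => // u.
  exact: rd_sub (rd_id u) (rd_sin u).
Qed.

Lemma one_sub_cos_le t : 1 - cos t <= t ^+ 2 / 2.
Proof.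
wlog t0 : t / 0 <= t.
  move=> h; have [|/ltW t0] := leP 0 t; first exact: h.
  by have := h (- t); rewrite oppr_ge0 cosN sqrrN => /(_ t0).
rewrite -subr_ge0; have -> : 0 = 0 ^+ 2 / 2 - (1 - cos 0) :> R by rewrite cos0; ring.
apply: (@mvt_nondecr (fun t => t ^+ 2 / 2 - (1 - cos t)) (fun t => t - sin t)) => // u.
  apply: rd_ext (rd_eq (rd_sub (rd_scale 2^-1 (rd_exprn 1 (rd_id u))) (rd_sub (rd_cst 1 u) (rd_cos u))) _).
    by move=> v; rewrite mulrC.
  by rewrite expr1; field.
by move=> u0 _; rewrite subr_ge0 sin_le_id// ltW.
Qed.

Lemma mul_cos_le_sin t : 0 <= t -> t <= pi / 2 -> t * cos t <= sin t.
Proof.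
move=> t0 tp; rewrite -subr_ge0; have -> : 0 = sin 0 - 0 * cos 0 :> R by rewrite sin0; ring.
apply: (@mvt_nondecr (fun t => sin t - t * cos t) (fun t => t * sin t)) => // u.
  by apply: rd_eq (rd_sub (rd_sin u) (rd_mul (rd_id u) (rd_cos u))) _; ring.
move=> u0 ut; rewrite mulr_ge0 ?(ltW u0)//; apply: sin_ge0_pi.
by rewrite (ltW u0)/= (le_trans (ltW ut))// (le_trans tp)// ler_pdivrMr// ler_pMr ?pi_gt0// ler1n.
Qed.

Lemma wal_gt0 m : 0 < wal 0 m.
Proof.
elim: m => [|m IH]; first by rewrite wal00 pi2_gt0.
have := wal_step 0 m; rewrite expr0n /= subr0 => h.
have m0 : 0 < m.+1%:R :> R by rewrite ltr0n.
have m1 : 1 <= m.+1%:R :> R by rewrite ler1n.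
have : 0 < m.+1%:R ^+ 2 * wal 0 m.+1 by rewrite h !mulr_gt0//; lra.
by rewrite pmulr_rgt0// exprn_gt0.
Qed.

(** From 1 - cos(2xt) <= 2 x^2 t^2 and t cos t <= sin t the difference is at most 2 x^2 times the
    integral of sin^2 t cos^(2m) t, which is [wal 0 m] - [wal 0 m.+1]. *)
Lemma wal_close x m : `|wal x m.+1 - wal 0 m.+1| <= x ^+ 2 / (m.+1%:R - 2^-1) * wal 0 m.+1.
Proof.
have m1 : 1 <= m.+1%:R :> R by rewrite ler1n.
have step := wal_step 0 m; rewrite expr0n /= subr0 in step.
have -> : x ^+ 2 / (m.+1%:R - 2^-1) * wal 0 m.+1 = 2 * x ^+ 2 * wal 0 m - 2 * x ^+ 2 * wal 0 m.+1.
  have -> : wal 0 m = m.+1%:R / (m.+1%:R - 2^-1) * wal 0 m.+1.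
    apply: (@mulfI _ (m.+1%:R * (m.+1%:R - 2^-1))); first by rewrite mulf_neq0 ?gt_eqF//; lra.
    by rewrite -step; field; rewrite gt_eqF//; lra.
  by field; rewrite gt_eqF//; lra.
rewrite /wal -RintegralB; [|exact: measurable_itv|exact: (wf_int x)|exact: (wf_int 0)].
have iB : mu.-integrable hp (EFin \o (fun t => wf x m.+1 t - wf 0 m.+1 t)).
  by apply: hp_int => t; apply: cvgB; exact: wf_cont.
apply: le_trans (le_normr_Rintegral _ iB) _; first exact: measurable_itv.
rewrite -!RintegralZl; [|exact: measurable_itv|exact: (wf_int 0)|exact: measurable_itv|exact: (wf_int 0)].
rewrite -RintegralB; [|exact: measurable_itv|exact: (wfZ_int _ 0)|exact: (wfZ_int _ 0)].
apply: le_Rintegral; [exact: measurable_itv|exact: integrable_norm| |].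
  by apply: hp_int => t; apply: cvgB; apply: cvgM; by [exact: cvg_cst|exact: wf_cont].
move=> t; rewrite /= in_itv/= => /andP[t0 tp]; rewrite /wf.
have c0 : 0 <= cos t by apply: cos_ge0_pihalf; rewrite tp andbT (le_trans _ t0)// oppr_le0 ltW// pi2_gt0.
rewrite mulr0 mul0r cos0 -mulrBl !mul1r normrM (ger0_norm (exprn_ge0 _ c0)).
rewrite distrC ger0_norm ?subr_ge0 ?cos_le1//.
have e2 : (2 * m.+1)%N = (2 * m).+2 by rewrite mulnS.
rewrite -mulrBr e2 !(exprS (cos t)).
apply: (@le_trans _ _ (((2 * x * t) ^+ 2 / 2) * (cos t * (cos t * cos t ^+ (2 * m))))).
  by rewrite ler_wpM2r ?one_sub_cos_le// !mulr_ge0// exprn_ge0.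
have -> : (2 * x * t) ^+ 2 / 2 * (cos t * (cos t * cos t ^+ (2 * m))) =
   2 * x ^+ 2 * ((t * cos t) ^+ 2 * cos t ^+ (2 * m)) by rewrite !expr2; field.
apply: ler_wpM2l; first by apply: mulr_ge0 => //; exact: sqr_ge0.
have -> : cos t ^+ (2 * m) - cos t * (cos t * cos t ^+ (2 * m)) = sin t ^+ 2 * cos t ^+ (2 * m).
  by rewrite sin2cos2; ring.
rewrite ler_wpM2r ?exprn_ge0// ler_sqr ?nnegrE ?mul_cos_le_sin ?mulr_ge0//.
by rewrite (le_trans _ (mul_cos_le_sin t0 tp))// mulr_ge0.
Qed.

(** Euler's product truncated at m with an exact correction [wal x m] / [wal 0 m], obtained by
    running [wal_step] at x and at 0 in parallel. *)
Lemma euler_sin_wal x m :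
  sin (pi * x) / pi * wal 0 m = x * \prod_(k < m) (1 - x ^+ 2 / k.+1%:R ^+ 2) * wal x m.
Proof.
have p0 : pi != 0 :> R by rewrite gt_eqF// pi_gt0.
elim: m => [|m IH].
  rewrite big_ord0 mulr1 wal0 wal00; move: (sin (pi * x)) => sn; move: (pi : R) p0 => p p0; field.
  exact: p0.
have M0 : m.+1%:R != 0 :> R by rewrite pnatr_eq0.
have m1 : 1 <= m.+1%:R :> R by rewrite ler1n.
have M2 : m.+1%:R - 2^-1 != 0 :> R by rewrite gt_eqF//; lra.
have s0 := wal_step 0 m; have sx := wal_step x m; rewrite expr0n /= subr0 in s0.
apply: (@mulfI _ (m.+1%:R ^+ 2)); first by rewrite expf_neq0.
rewrite mulrCA s0 mulrCA IH big_ord_recr /=.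
transitivity (x * \prod_(k < m) (1 - x ^+ 2 / k.+1%:R ^+ 2) * (m.+1%:R * (m.+1%:R - 2^-1) * wal x m)); first by ring.
by rewrite -sx; move: (\prod_(k < m) _) => P; field.
Qed.

Lemma rgs_reflect x m :
  rgs x m.+1 * rgs (1 - x) m.+1 =
  x * \prod_(k < m.+1) (1 - x ^+ 2 / k.+1%:R ^+ 2) * (1 + (1 - x) / m.+1%:R).
Proof.
have e1 n : \prod_(k < n.+1) (x + k%:R) * \prod_(k < n.+1) (1 - x + k%:R) =
   x * (\prod_(k < n) (1 - x ^+ 2 / k.+1%:R ^+ 2)) * n`!%:R ^+ 2 * (n.+1%:R - x).
  elim: n => [|n IH]; first by rewrite !big_ord_recr !big_ord0 /= fact0; ring.
  rewrite big_ord_recr [X in _ * X = _]big_ord_recr /= mulrACA IH [in RHS]big_ord_recr /= factS natrM.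
  rewrite -[n.+2%:R]natr1; move: (\prod_(k < n) _) => P; field.
  by rewrite addrC natr1 pnatr_eq0.
have N0 : 0 < m.+1%:R :> R by rewrite ltr0n.
rewrite /rgs mulrACA e1 -invfM.
have -> : m.+1`!%:R * m.+1%:R `^ x * (m.+1`!%:R * m.+1%:R `^ (1 - x)) = m.+1`!%:R ^+ 2 * m.+1%:R :> R.
  rewrite (@powR_eqD R _ 1 (- x) (1 - x) N0)// powRN powRr1 ?(ltW N0)//.
  by field; rewrite gt_eqF// powR_gt0.
rewrite -[m.+2%:R]natr1; move: (\prod_(k < _) _) => P.
have f0 : m.+1`!%:R != 0 :> R by rewrite pnatr_eq0 -lt0n fact_gt0.
move: (m.+1`!%:R) f0 (m.+1%:R) N0 => f f0 N N0; field.
by rewrite f0 gt_eqF.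
Qed.

(** The Gauss products at x and 1 - x pair up to a truncated sine product times a factor tending to
    1, while the correction in [euler_sin_wal] tends to 1 by [wal_close]. *)
Lemma rgamma_reflect x : rgamma x * rgamma (1 - x) = sin (pi * x) / pi.
Proof.
have v1 := cvg_1harm (1 - x).
have h1 := @rgamma_cvg x; have h2 := @rgamma_cvg (1 - x).
rewrite -(cvg_shiftS (rgs x)) in h1; rewrite -(cvg_shiftS (rgs (1 - x))) in h2.
have r1 : wal x n.+1 / wal 0 n.+1 @[n --> \oo] --> (1 : R).
  have b0 : x ^+ 2 / (n.+1%:R - 2^-1) @[n --> \oo] --> (0 : R).
    have e n : x ^+ 2 / (n.+1%:R - 2^-1) = x ^+ 2 * n.+1%:R^-1 / (1 + (- 2^-1) / n.+1%:R).
      have m1 : 1 <= n.+1%:R :> R by rewrite ler1n.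
      move: (n.+1%:R : R) m1 => N m1; field; rewrite !gt_eqF//; lra.
    have l1 : x ^+ 2 * 0 / 1 = 0 by rewrite mulr0 mul0r.
    apply: (cvgn_ext _ e l1); apply: cvgM; last by apply: cvgV; [rewrite oner_neq0|exact: cvg_1harm].
    by apply: cvgM; [exact: cvg_cst|exact: cvg_harmonic].
  have c0 : `|wal x n.+1 / wal 0 n.+1 - 1| @[n --> \oo] --> (0 : R).
    apply: (@squeeze_cvgr _ _ _ _ (fun=> 0) (fun n => x ^+ 2 / (n.+1%:R - 2^-1))) => //; last exact: cvg_cst.
    apply: nearW => n; rewrite normr_ge0 /=; have w0 := wal_gt0 n.+1.
    have -> : wal x n.+1 / wal 0 n.+1 - 1 = (wal x n.+1 - wal 0 n.+1) / wal 0 n.+1.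
      by field; rewrite gt_eqF.
    by rewrite normrM normfV (gtr0_norm w0) ler_pdivrMr// wal_close.
  by move/norm_cvg0P : c0 => /subr_cvg0.
rewrite -[LHS]mulr1 -[RHS]mulr1.
apply: (cvgn_uniq (cvgM (cvgM h1 h2) r1) (cvgM (cvg_cst (sin (pi * x) / pi)) v1)) => n /=.
have w0 := wal_gt0 n.+1.
rewrite /= rgs_reflect mulrAC; congr (_ * _).
by rewrite mulrA -euler_sin_wal mulfK// gt_eqF.
Qed.

End Gamma.

(** * Complex series and the entire functions E_m *)

Section ComplexSeries.
Context {R : realType}.
Implicit Types (z w h : R[i]) (u v : nat -> R[i]) (r C x y : R).
Local Notation Re := (@complex.Re R).
Local Notation Im := (@complex.Im R).

(** The l1 norm: submultiplicative, exact on real multiples, and directly comparable with both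
    components, to which convergence and integrability are reduced. *)
Definition cabs z : R := `|Re z| + `|Im z|.

Lemma ReD z w : Re (z + w) = Re z + Re w. Proof. by case: z w => a b [c d]. Qed.
Lemma ImD z w : Im (z + w) = Im z + Im w. Proof. by case: z w => a b [c d]. Qed.
Lemma ReN z : Re (- z) = - Re z. Proof. by case: z. Qed.
Lemma ImN z : Im (- z) = - Im z. Proof. by case: z. Qed.
Lemma ReM z w : Re (z * w) = Re z * Re w - Im z * Im w. Proof. by case: z w => a b [c d]. Qed.
Lemma ImM z w : Im (z * w) = Re z * Im w + Im z * Re w. Proof. by case: z w => a b [c d]. Qed.
Lemma ReZ x z : Re (x%:C * z) = x * Re z. Proof. by rewrite ReM /= mul0r subr0. Qed.
Lemma ImZ x z : Im (x%:C * z) = x * Im z. Proof. by rewrite ImM /= mul0r addr0. Qed.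

Lemma complexP z w : Re z = Re w -> Im z = Im w -> z = w.
Proof. by case: z w => a b [c d] /= -> ->. Qed.

Lemma cabs_ge0 z : 0 <= cabs z.
Proof. by rewrite addr_ge0. Qed.

Lemma cabs0 : cabs 0 = 0.
Proof. by rewrite /cabs /= normr0 addr0. Qed.

Lemma cabs1 : cabs 1 = 1.
Proof. by rewrite /cabs /= normr1 normr0 addr0. Qed.

Lemma cabs_eq0 z : cabs z = 0 -> z = 0.
Proof.
move=> /eqP; rewrite paddr_eq0// !normr_eq0 => /andP[/eqP a /eqP b].
exact: complexP.
Qed.

Lemma cabsC x : cabs x%:C = `|x|.
Proof. by rewrite /cabs /= normr0 addr0. Qed.

Lemma cabsN z : cabs (- z) = cabs z.
Proof. by rewrite /cabs ReN ImN !normrN. Qed.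

Lemma cabsD z w : cabs (z + w) <= cabs z + cabs w.
Proof. by rewrite /cabs ReD ImD addrACA lerD// ler_normD. Qed.

Lemma cabsB z w : cabs (z - w) <= cabs z + cabs w.
Proof. by rewrite (le_trans (cabsD _ _))// cabsN. Qed.

Lemma cabsM z w : cabs (z * w) <= cabs z * cabs w.
Proof.
rewrite /cabs ReM ImM.
apply: (@le_trans _ _ ((`|Re z * Re w| + `|Im z * Im w|) + (`|Re z * Im w| + `|Im z * Re w|))).
  by rewrite lerD ?ler_normB ?ler_normD.
by rewrite !normrM; lra.
Qed.

Lemma cabsZ x z : cabs (x%:C * z) = `|x| * cabs z.
Proof. by rewrite /cabs ReZ ImZ !normrM mulrDr. Qed.

Lemma cabsX z n : cabs (z ^+ n) <= cabs z ^+ n.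
Proof.
elim: n => [|n IH]; first by rewrite !expr0 cabs1.
by rewrite !exprS (le_trans (cabsM _ _))// ler_wpM2l// cabs_ge0.
Qed.

Lemma Re_le_cabs z : `|Re z| <= cabs z. Proof. by rewrite lerDl. Qed.
Lemma Im_le_cabs z : `|Im z| <= cabs z. Proof. by rewrite lerDr. Qed.

(** Convergence together with the value, whereas [cseries] yields a default value on divergent
    series. *)
Definition csum u (S : R[i]) : Prop :=
  series (fun k => Re (u k)) @ \oo --> Re S /\ series (fun k => Im (u k)) @ \oo --> Im S.

Lemma csumE u S : csum u S -> cseries u = S.
Proof. by case=> h1 h2; apply: complexP => /=; exact: cvg_lim. Qed.

Lemma csum_uniq u S T : csum u S -> csum u T -> S = T.
Proof. by move=> /csumE <- /csumE <-. Qed.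

Lemma csum_ext u v S : (forall k, u k = v k) -> csum u S -> csum v S.
Proof. by move=> /funext ->. Qed.

Lemma csumD u v S T : csum u S -> csum v T -> csum (fun k => u k + v k) (S + T).
Proof.
move=> [h1 h2] [h3 h4]; split; rewrite ?ReD ?ImD.
  apply: (cvgn_ext (cvgD h1 h3) _ erefl) => n.
  transitivity (series (fun k => Re (u k)) n + series (fun k => Re (v k)) n) => //.
  by rewrite /series/= -big_split; apply: eq_bigr => k _; rewrite ReD.
apply: (cvgn_ext (cvgD h2 h4) _ erefl) => n.
transitivity (series (fun k => Im (u k)) n + series (fun k => Im (v k)) n) => //.
by rewrite /series/= -big_split; apply: eq_bigr => k _; rewrite ImD.
Qed.

Lemma csumM w u S : csum u S -> csum (fun k => w * u k) (w * S).
Proof.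
move=> [h1 h2]; split; rewrite ?ReM ?ImM.
  apply: (cvgn_ext (cvgB (cvgM (cvg_cst (Re w)) h1) (cvgM (cvg_cst (Im w)) h2)) _ erefl) => n.
  transitivity (Re w * series (fun k => Re (u k)) n - Im w * series (fun k => Im (u k)) n) => //.
  rewrite /series/= !mulr_sumr -sumrB; apply: eq_bigr => k _; exact: ReM.
apply: (cvgn_ext (cvgD (cvgM (cvg_cst (Re w)) h2) (cvgM (cvg_cst (Im w)) h1)) _ erefl) => n.
transitivity (Re w * series (fun k => Im (u k)) n + Im w * series (fun k => Re (u k)) n) => //.
rewrite /series/= !mulr_sumr -big_split; apply: eq_bigr => k _; exact: ImM.
Qed.

Lemma csumB u v S T : csum u S -> csum v T -> csum (fun k => u k - v k) (S - T).
Proof.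
move=> h1 h2; have := csumD h1 (csumM (-1) h2); rewrite mulN1r.
by apply: csum_ext => k; rewrite mulN1r.
Qed.

Lemma csum_S u S : csum (fun k => u k.+1) S -> csum u (u 0%N + S).
Proof.
move=> [h1 h2]; split; rewrite ?ReD ?ImD.
  rewrite -(cvg_shiftS (series _)).
  apply: (cvgn_ext (cvgD (cvg_cst (Re (u 0%N))) h1) _ erefl) => n.
  by rewrite /series/= big_nat_recl.
rewrite -(cvg_shiftS (series _)).
apply: (cvgn_ext (cvgD (cvg_cst (Im (u 0%N))) h2) _ erefl) => n.
by rewrite /series/= big_nat_recl.
Qed.

Let expc C r : cvgn (series (fun k => C * (r ^+ k / k`!%:R))) /\
  limn (series (fun k => C * (r ^+ k / k`!%:R))) = C * expR r.
Proof.
suff h : series (fun k => C * (r ^+ k / k`!%:R)) @ \oo --> C * expR r.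
  by split; [exact: cvgP h|exact: cvg_lim h].
apply: (cvgn_ext (cvgM (cvg_cst C) (is_cvg_series_exp_coeff r : series _ @ \oo --> expR r)) _ erefl) => n.
by rewrite /= /series/= mulr_sumr.
Qed.

Let rdom (f : nat -> R) C r : 0 <= C -> 0 <= r -> (forall k, `|f k| <= C * (r ^+ k / k`!%:R)) ->
  cvgn (series f) /\ `|limn (series f)| <= C * expR r.
Proof.
move=> C0 r0 fk; have [c1 l1] := expc C r.
have cn : cvgn [normed series f].
  apply: series_le_cvg c1 => [k|k|k]; [exact: normr_ge0| |exact: fk].
  by rewrite !mulr_ge0 ?exprn_ge0// invr_ge0.
split; first exact: normed_cvg.
apply: le_trans (lim_series_norm cn) _; rewrite -l1.
exact: lim_series_le.
Qed.

Lemma csum_dom u C r : 0 <= C -> 0 <= r ->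
  (forall k, cabs (u k) <= C * (r ^+ k / k`!%:R)) ->
  exists2 S, csum u S & cabs S <= 2 * C * expR r.
Proof.
move=> C0 r0 uk.
have [c1 l1] := rdom C0 r0 (fun k => le_trans (Re_le_cabs _) (uk k)).
have [c2 l2] := rdom C0 r0 (fun k => le_trans (Im_le_cabs _) (uk k)).
exists (limn (series (fun k => Re (u k))) +i* limn (series (fun k => Im (u k)))).
  by split.
by rewrite /cabs /=; lra.
Qed.

Lemma csum_bound u S C r : 0 <= C -> 0 <= r ->
  (forall k, cabs (u k) <= C * (r ^+ k / k`!%:R)) -> csum u S -> cabs S <= 2 * C * expR r.
Proof.
move=> C0 r0 uk uS; have [T uT] := csum_dom C0 r0 uk.
by rewrite (csum_uniq uS uT).
Qed.

Fact Ec_key : unit. Proof. exact: tt. Qed.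
(** The branch-free part of the Bessel function: I_m(w) = (w/2)^m E_m(w^2/4). Locked, so that
    unification never unfolds the series. *)
Definition Ec : R -> R[i] -> R[i] := locked_with Ec_key (fun m z =>
  cseries (fun k => (rgamma (m + k%:R + 1) / k`!%:R)%:C * z ^+ k)).

Lemma EcE m z : Ec m z = cseries (fun k => (rgamma (m + k%:R + 1) / k`!%:R)%:C * z ^+ k).
Proof. by rewrite /Ec unlock. Qed.

Let term (m : R) z (k : nat) : R[i] := (rgamma (m + k%:R + 1) / k`!%:R)%:C * z ^+ k.

Let term_bound m z C k : (forall k, `|rgamma (m + k%:R + 1)| <= C) ->
  cabs (term m z k) <= C * (cabs z ^+ k / k`!%:R).
Proof.
move=> h; rewrite /term cabsZ normrM mulrAC -mulrA.
rewrite (@ger0_norm _ (_^-1)) ?invr_ge0//.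
apply: ler_pM => //; first by rewrite mulr_ge0 ?cabs_ge0// invr_ge0.
by rewrite ler_wpM2r ?invr_ge0// cabsX.
Qed.

Lemma csum_Ec m z : csum (term m z) (Ec m z).
Proof.
have [C C0 h] := rgamma_bound m.
have [S uS _] := csum_dom (ltW C0) (cabs_ge0 z) (fun k => term_bound z k h).
by rewrite EcE (csumE uS).
Qed.

Lemma cabs_Ec m C z : (forall k, `|rgamma (m + k%:R + 1)| <= C) ->
  cabs (Ec m z) <= 2 * C * expR (cabs z).
Proof.
move=> h; have C0 : 0 <= C by apply: le_trans (h 0%N).
exact: csum_bound C0 (cabs_ge0 z) (fun k => term_bound z k h) (csum_Ec m z).
Qed.

Lemma EcS m z : Ec (m - 1) z = m%:C * Ec m z + z * Ec (m + 1) z.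
Proof.
apply: (csum_uniq (csum_Ec (m - 1) z)).
have h1 := csumM m%:C (csum_Ec m z).
have h2 := csumM z (csum_Ec (m + 1) z).
(* The factor z shifts the second series by one index; with this alignment the identity is [rgammaS]
   coefficient by coefficient. *)
pose u k : R[i] := if k is k'.+1 then z * term (m + 1) z k' else 0.
have h3 : csum u (z * Ec (m + 1) z).
  by have := @csum_S u _ h2; rewrite add0r.
apply: csum_ext (csumD h1 h3) => k; rewrite /term.
have e : m - 1 + k%:R + 1 = m + k%:R :> R by ring.
rewrite e (rgammaS (m + k%:R)); case: k {e} => [|k] /=.
  by rewrite expr0 addr0 fact0 !mulr1 addr0 !divr1 -rmorphM.
rewrite /term exprS !mulrA !(mulrC _ z) -!mulrA -mulrDr; congr (_ * _).
rewrite !mulrA -mulrDl; congr (_ * _); rewrite -rmorphM -rmorphD; congr _%:C.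
have -> : m + 1 + k%:R + 1 = m + k.+1%:R + 1 by rewrite -natr1; ring.
rewrite factS natrM -[k.+1%:R]natr1; field.
by rewrite natr1 !pnatr_eq0 -lt0n fact_gt0.
Qed.

(** Second-order Taylor remainder of a power. Degrees 0 and 1 have none, which is why the indexing
    starts at 2. *)
Let dk z h (k : nat) := (z + h) ^+ k.+2 - z ^+ k.+2 - k.+2%:R * h * z ^+ k.+1.

Let dk_bound z h k : cabs (dk z h k) <=
  k.+2%:R * k.+1%:R / 2 * (cabs h ^+ 2 * (cabs z + cabs h) ^+ k).
Proof.
set r := cabs z + cabs h; set q := cabs h.
have q0 : 0 <= q by exact: cabs_ge0.
have r0 : 0 <= r by rewrite addr_ge0// cabs_ge0.
have zr : cabs z <= r by rewrite lerDl.
elim: k => [|k IH].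
  have -> : dk z h 0 = h ^+ 2 by rewrite /dk; ring.
  by rewrite (le_trans (cabsX _ _))// expr0 -/q; lra.
have -> : dk z h k.+1 = (z + h) * dk z h k + k.+2%:R * h ^+ 2 * z ^+ k.+1.
  by rewrite /dk !exprS -[k.+3%:R]natr1; ring.
apply: le_trans (cabsD _ _) _.
have -> : k.+2%:R * h ^+ 2 * z ^+ k.+1 = k.+2%:R%:C * (h ^+ 2 * z ^+ k.+1) :> R[i].
  by rewrite rmorph_nat mulrA.
rewrite cabsZ ger0_norm//.
have a1 : cabs ((z + h) * dk z h k) <= r * (k.+2%:R * k.+1%:R / 2 * (q ^+ 2 * r ^+ k)).
  apply: le_trans (cabsM _ _) _; apply: ler_pM => //; try exact: cabs_ge0.
  exact: cabsD.
have a2 : k.+2%:R * cabs (h ^+ 2 * z ^+ k.+1) <= k.+2%:R * (q ^+ 2 * r ^+ k.+1).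
  rewrite ler_wpM2l// (le_trans (cabsM _ _))// ler_pM ?cabs_ge0 ?cabsX//.
  by rewrite (le_trans (cabsX _ _))// lerXn2r ?nnegrE// cabs_ge0.
apply: le_trans (lerD a1 a2) _; rewrite (exprS r) -[k.+3%:R]natr1 -[k.+2%:R]natr1.
by rewrite le_eqVlt; apply/orP; left; apply/eqP; field.
Qed.

(** E_m' = E_{m+1} with an explicit quadratic error: the binomial (k+2)(k+1)/2 in the remainder of
    the power cancels against (k+2)!, so an exponential series remains. *)
Lemma Ec_taylor m C z h : (forall k, `|rgamma (m + k%:R + 1)| <= C) ->
  cabs (Ec m (z + h) - Ec m z - h * Ec (m + 1) z) <=
  C * cabs h ^+ 2 * expR (cabs z + cabs h).
Proof.
move=> hC; have C0 : 0 <= C by apply: le_trans (hC 0%N).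
pose u k : R[i] := if k is k'.+1 then h * term (m + 1) z k' else 0.
have hu : csum u (h * Ec (m + 1) z).
  by have := @csum_S u _ (csumM h (csum_Ec (m + 1) z)); rewrite add0r.
have s1 := csumB (csumB (csum_Ec m (z + h)) (csum_Ec m z)) hu.
set v := (fun k => _) in s1.
have v0 : v 0%N = 0 by rewrite /v /term !expr0 subrr subr0.
have v1 : v 1%N = 0.
  rewrite /v /= /term !expr1 expr0 fact0 (_ : 1`! = 1%N)//.
  by rewrite (_ : m + 1 + 0%:R + 1 = m + 1%:R + 1); ring.
have v2 k : v k.+2 = (rgamma (m + k.+2%:R + 1) / k.+2`!%:R)%:C * dk z h k.
  rewrite /v /= /term /dk.
  have -> : m + 1 + k.+1%:R + 1 = m + k.+2%:R + 1 by rewrite -[k.+2%:R]natr1; ring.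
  have -> : (rgamma (m + k.+2%:R + 1) / k.+1`!%:R)%:C =
     (rgamma (m + k.+2%:R + 1) / k.+2`!%:R)%:C * k.+2%:R :> R[i].
    rewrite -(rmorph_nat (real_complex R)) -rmorphM; congr _%:C.
    have a0 : k.+2%:R != 0 :> R by rewrite pnatr_eq0.
    have b0 : k.+1`!%:R != 0 :> R by rewrite pnatr_eq0 -lt0n fact_gt0.
    rewrite [k.+2`!]factS natrM; move: (k.+2%:R : R) a0 (k.+1`!%:R : R) b0 (rgamma _) => a a0 b b0 g.
    by field; rewrite a0 b0.
  by ring.
have b k : cabs (v k.+2) <= C * cabs h ^+ 2 / 2 * ((cabs z + cabs h) ^+ k / k`!%:R).
  rewrite v2 cabsZ normrM (@ger0_norm _ (_^-1)) ?invr_ge0//.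
  apply: (@le_trans _ _ (C / k.+2`!%:R * (k.+2%:R * k.+1%:R / 2 * (cabs h ^+ 2 * (cabs z + cabs h) ^+ k)))).
    by apply: ler_pM; [by rewrite mulr_ge0 ?invr_ge0|exact: cabs_ge0|by rewrite ler_wpM2r ?invr_ge0|exact: dk_bound].
  have a0 : k.+2%:R != 0 :> R by rewrite pnatr_eq0.
  have a1 : k.+1%:R != 0 :> R by rewrite pnatr_eq0.
  have b0 : k`!%:R != 0 :> R by rewrite pnatr_eq0 -lt0n fact_gt0.
  rewrite !factS !natrM le_eqVlt; apply/orP; left; apply/eqP.
  move: (k.+2%:R : R) a0 (k.+1%:R : R) a1 (k`!%:R : R) b0 => a a0 a' a1 b b0.
  by field; rewrite a0 a1 b0.
have c0 : 0 <= C * cabs h ^+ 2 / 2 by rewrite divr_ge0// mulr_ge0// exprn_ge0// cabs_ge0.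
have r0 : 0 <= cabs z + cabs h by rewrite addr_ge0// cabs_ge0.
have [S vS bS] := csum_dom c0 r0 b.
have := @csum_S v _ (@csum_S (fun k => v k.+1) _ vS); rewrite v0 v1 !add0r => vS'.
rewrite (csum_uniq s1 vS'); apply: le_trans bS _.
by rewrite le_eqVlt; apply/orP; left; apply/eqP; field.
Qed.

Lemma Ec_real m y : Ec m y%:C = (Re (Ec m y%:C))%:C.
Proof.
apply: complexP => //=; have [_] := csum_Ec m y%:C.
have -> : (fun k => Im (term m y%:C k)) = fun=> 0.
  by apply: funext => k; rewrite /term -rmorphXn -rmorphM.
move=> h; have h0 : series (fun=> 0 : R) @ \oo --> (0 : R).
  by apply: (cvgn_ext (cvg_cst 0) _ erefl) => n; rewrite /series/= big1.
exact: (cvgn_uniq h h0).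
Qed.

(** Every later coefficient is at most 1/Gamma(m+2) = (1/Gamma(m+1))/(m+1) divided by its factorial.
    So the relative distance to the constant term is O(1/(m+1)), and E_m(z) is nonzero for large
    m. *)
Lemma Ec_large m z : 0 <= m -> cabs (Ec m z - (rgamma (m + 1))%:C) <=
  2 * (rgamma (m + 1) / (m + 1)) * expR (cabs z).
Proof.
move=> m0; have m1 : 0 < m + 1 by rewrite ltr_wpDl.
have g0 := rgamma_gt0 m1.
pose u k : R[i] := if k is k'.+1 then term m z k'.+1 else 0.
have c0 : 0 <= rgamma (m + 1) / (m + 1) by rewrite divr_ge0// ltW.
have ub k : cabs (u k) <= rgamma (m + 1) / (m + 1) * (cabs z ^+ k / k`!%:R).
  case: k => [|k].
    by rewrite /u cabs0 expr0 fact0 divr1 mulr1.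
  rewrite /u /term cabsZ normrM (@ger0_norm _ (_^-1)) ?invr_ge0//.
  have -> : `|rgamma (m + k.+1%:R + 1)| * (k.+1`!%:R)^-1 * cabs (z ^+ k.+1) =
    `|rgamma (m + k.+1%:R + 1)| * (cabs (z ^+ k.+1) / k.+1`!%:R) by ring.
  apply: ler_pM => //.
  - by rewrite mulr_ge0 ?cabs_ge0// invr_ge0.
  - have -> : m + k.+1%:R + 1 = (m + 1 + 1) + k%:R by rewrite -[k.+1%:R]natr1; ring.
    have x1 : 1 <= m + 1 + 1 by lra.
    rewrite gtr0_norm ?rgamma_gt0//; last by rewrite ltr_wpDr//; lra.
    apply: le_trans (rgamma_fact k x1) _.
    have -> : rgamma (m + 1) / (m + 1) = rgamma (m + 1 + 1).
      by rewrite [in LHS]rgammaS mulrC mulKf// gt_eqF.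
    rewrite ler_piMr ?(ltW (rgamma_gt0 _))//; first by lra.
    by rewrite invf_le1 ?ler1n ?ltr0n fact_gt0.
  - by rewrite ler_wpM2r ?invr_ge0// cabsX.
have [S uS bS] := csum_dom c0 (cabs_ge0 z) ub.
pose w k : R[i] := if k is k'.+1 then 0 else (rgamma (m + 1))%:C.
have hw : csum w (rgamma (m + 1))%:C.
  have h0 : csum (fun k => w k.+1) 0.
    split; by apply: (cvgn_ext (cvg_cst 0) _ erefl) => n; rewrite /series/= big1.
  by have := csum_S h0; rewrite addr0.
suff -> : Ec m z = (rgamma (m + 1))%:C + S by rewrite addrC addKr.
apply: (csum_uniq (csum_Ec m z)); apply: csum_ext (csumD hw uS) => -[|k].
  by rewrite /= /term expr0 fact0 divr1 mulr1 !addr0.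
by rewrite /= add0r.
Qed.

End ComplexSeries.

(** * Decay of the entire Bessel functions on the real line *)

Section RealBessel.
Context {R : realType}.
Implicit Types (m y t h p x : R).
Local Notation Re := (@complex.Re R).
Local Notation Im := (@complex.Im R).

Lemma rd_taylor (f : R -> R) x a (C d : R) : 0 < d ->
  (forall h, `|h| < d -> `|f (x + h) - f x - h * a| <= C * h ^+ 2) -> rderiv f x a.
Proof.
move=> d0 hC.
have lim : h^-1 *: (f (h *: 1 + x) - f x) @[h --> 0^'] --> a.
  apply/cvgrPdist_le => e e0.
  pose d' := Num.min d (e / (`|C| + 1)).
  have d'0 : 0 < d' by rewrite lt_min d0 divr_gt0// ltr_wpDl.
  near=> h.
  have h0 : h != 0 by near: h; exact: nbhs_dnbhs_neq.
  have hd : `|h| < d' by near: h; apply: dnbhs0_lt.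
  have [hd1 hd2] : `|h| < d /\ `|h| < e / (`|C| + 1) by move: hd; rewrite lt_min => /andP[].
  have := hC h hd1; rewrite /GRing.scale/= mulr1 (addrC h x) => le1.
  have -> : a - h^-1 * (f (x + h) - f x) = - (h^-1 * (f (x + h) - f x - h * a)).
    by field.
  rewrite normrN normrM normfV ler_pdivrMl ?normr_gt0//.
  apply: le_trans le1 _; rewrite -real_normK ?num_real// expr2 mulrA mulrC.
  rewrite ler_wpM2l// (le_trans (ler_norm _))// normrM normr_id.
  apply: (@le_trans _ _ ((`|C| + 1) * `|h|)); first by rewrite ler_wpM2r// lerDl.
  by rewrite mulrC -ler_pdivlMr ?ltr_wpDl// ltW.
by split; [exact: cvgP lim|exact: cvg_lim lim].
Unshelve. all: by end_near. Qed.

Fact em_key : unit. Proof. exact: tt. Qed.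
(** The oscillating counterpart: J_m(x) = (x/2)^m e_m(x^2/4). Taking the real part loses nothing, by
    [emC]. *)
Definition em : R -> R -> R := locked_with em_key (fun m y => Re (Ec m (- y)%:C)).

Lemma emE m y : em m y = Re (Ec m (- y)%:C).
Proof. by rewrite /em unlock. Qed.

Lemma emC m y : Ec m (- y)%:C = (em m y)%:C.
Proof. by rewrite emE; exact: Ec_real. Qed.

Lemma emS m y : em (m - 1) y = m * em m y - y * em (m + 1) y.
Proof.
have := EcS m (- y)%:C; rewrite !emC -!rmorphM -rmorphD.
by move/complexI => ->; rewrite mulNr.
Qed.

Lemma em_next m y : y * em (m + 1 + 1) y = (m + 1) * em (m + 1) y - em m y.
Proof. by have := emS (m + 1) y; rewrite addrK => ->; ring. Qed.

Lemma em_taylor m : exists2 C : R, 0 <= C & forall y h,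
  `|em m (y + h) - em m y + h * em (m + 1) y| <= C * h ^+ 2 * expR (`|y| + `|h|).
Proof.
have [C C0 hC] := rgamma_bound m; exists C; first exact: ltW.
move=> y h; have := Ec_taylor (- y)%:C (- h)%:C hC.
rewrite -rmorphD -opprD !emC -rmorphM -!rmorphB /= !cabsC !normrN.
by rewrite mulNr opprK real_normK// num_real.
Qed.

Lemma em_bound m C y : (forall k, `|rgamma (m + k%:R + 1)| <= C) ->
  `|em m y| <= 2 * C * expR `|y|.
Proof.
by move=> hC; have := cabs_Ec (- y)%:C hC; rewrite emC !cabsC normrN.
Qed.

Lemma em0 m : em m 0 = rgamma (m + 1).
Proof.
rewrite emE oppr0; have h := csum_Ec m (0 : R)%:C.
pose u k : R[i] := if k is k'.+1 then 0 else (rgamma (m + 1))%:C.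
have h2 : csum u (rgamma (m + 1))%:C.
  have h0 : csum (fun k => u k.+1) 0.
    by split; apply: (cvgn_ext (cvg_cst 0) _ erefl) => n; rewrite /series/= big1.
  by have := csum_S h0; rewrite addr0.
have -> // : Ec m (0 : R)%:C = (rgamma (m + 1))%:C.
apply: (csum_uniq h); apply: csum_ext h2 => -[|k].
  by rewrite /= expr0 fact0 divr1 mulr1 addr0.
by rewrite expr0n /= mulr0.
Qed.

Lemma rd_em m y : rderiv (em m) y (- em (m + 1) y).
Proof.
have [C C0 hC] := em_taylor m.
apply: (@rd_taylor _ _ _ (C * expR (`|y| + 1)) 1 ltr01) => h h1.
rewrite mulrN opprK (le_trans (hC y h))// mulrAC ler_wpM2r ?sqr_ge0//.
by rewrite ler_wpM2l// ler_expR lerD2l ltW.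
Qed.

Lemma cont_em m y : {for y, continuous (em m)}.
Proof. exact: rd_cont (rd_em m y). Qed.

Lemma mvt_noninc (f g : R -> R) a b : (forall t, a <= t -> t <= b -> rderiv f t (g t)) ->
  (forall t, a < t -> t < b -> g t <= 0) -> a <= b -> f b <= f a.
Proof.
move=> df g0; rewrite le_eqVlt => /predU1P[->//|ab].
have [t||c /[!in_itv]/= /andP[ac cb] e] := @MVT _ f g a b ab.
- by rewrite in_itv/= => /andP[ta tb]; apply: df; exact: ltW.
- by apply: continuous_in_subspaceT => t /set_mem /=; rewrite in_itv/= => /andP[ta tb]; exact: rd_cont (df t ta tb).
- by rewrite -subr_le0 e mulr_le0_ge0 ?g0// subr_ge0 ltW.
Qed.

(** The left side has derivative -(2m+1) e_{m+1}(y)^2, which is nonpositive for m >= -1/2, and it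
    starts from the right side at y = 0. *)
Lemma em_energy m y : - 2^-1 <= m -> 0 <= y ->
  em m y ^+ 2 + y * em (m + 1) y ^+ 2 <= rgamma (m + 1) ^+ 2.
Proof.
move=> m0 y0.
have -> : rgamma (m + 1) ^+ 2 = em m 0 ^+ 2 + 0 * em (m + 1) 0 ^+ 2 by rewrite em0; ring.
apply: (@mvt_noninc (fun y => em m y ^+ 2 + y * em (m + 1) y ^+ 2)
  (fun y => - (2 * m + 1) * em (m + 1) y ^+ 2)) => //.
  move=> t _ _.
  apply: rd_eq (rd_add (rd_exprn 1 (rd_em m t)) (rd_mul (rd_id t) (rd_exprn 1 (rd_em (m + 1) t)))) _.
  have -> : t * (2 * em (m + 1) t ^+ 1 * - em (m + 1 + 1) t) =
    - 2 * em (m + 1) t * (t * em (m + 1 + 1) t) by ring.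
  by rewrite em_next; ring.
by move=> t _ _; rewrite mulNr oppr_le0 mulr_ge0 ?sqr_ge0//; lra.
Qed.

Lemma em_le m y : - 2^-1 <= m -> 0 <= y -> `|em m y| <= rgamma (m + 1).
Proof.
move=> m0 y0; have g0 : 0 < rgamma (m + 1) by apply: rgamma_gt0; lra.
rewrite -ler_sqr ?nnegrE ?(ltW g0)// real_normK ?num_real//.
apply: le_trans (em_energy m0 y0); rewrite lerDl mulr_ge0 ?sqr_ge0//.
Qed.

(** With x = 2 sqrt y this is sqrt y (J_m(x)^2 + J_{m+1}(x)^2), and [Qm] is sqrt y J_m(x)
    J_{m+1}(x). The first stays bounded at infinity; the second corrects it. *)
Definition Pm : R -> R -> R := locked_with em_key
  (fun m y => y `^ (m + 2^-1) * (em m y ^+ 2 + y * em (m + 1) y ^+ 2)).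
Definition Qm : R -> R -> R := locked_with em_key
  (fun m y => y `^ (m + 1) * (em m y * em (m + 1) y)).

Lemma PmE m : Pm m = fun y => y `^ (m + 2^-1) * (em m y ^+ 2 + y * em (m + 1) y ^+ 2).
Proof. by rewrite /Pm unlock. Qed.

Lemma QmE m : Qm m = fun y => y `^ (m + 1) * (em m y * em (m + 1) y).
Proof. by rewrite /Qm unlock. Qed.

Lemma powR_half y : 0 < y -> y `^ 2^-1 * y `^ 2^-1 = y.
Proof. by move=> y0; rewrite -powRDx// -[RHS](powRr1 (ltW y0)); congr (_ `^ _); field. Qed.

Lemma Qm_le m y : 0 < y -> `|Qm m y| <= Pm m y / 2.
Proof.
move=> y0; rewrite QmE PmE (@powR_eqD _ y (m + 2^-1) 2^-1 (m + 1) y0); last by field.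
have h := powR_half y0; set s := y `^ 2^-1 in h *.
have s0 : 0 <= s by exact: powR_ge0.
rewrite -!mulrA normrM (ger0_norm (powR_ge0 _ _)) ler_wpM2l ?powR_ge0//.
move: (em m y) (em (m + 1) y) => e e1; rewrite -h ler_norml.
have a1 := sqr_ge0 (e + s * e1); have a2 := sqr_ge0 (e - s * e1).
have e2 : (e ^+ 2 + s * s * e1 ^+ 2) / 2 - s * (e * e1) = (e - s * e1) ^+ 2 / 2 by field.
have e3 : s * (e * e1) + (e ^+ 2 + s * s * e1 ^+ 2) / 2 = (e + s * e1) ^+ 2 / 2 by field.
by apply/andP; split; rewrite -subr_ge0 ?opprK ?e2 ?e3 divr_ge0.
Qed.

Lemma Pm_ge0 m y : 0 <= y -> 0 <= Pm m y.
Proof.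
move=> y0; rewrite PmE; apply: mulr_ge0; first exact: powR_ge0.
by rewrite addr_ge0 ?sqr_ge0// mulr_ge0// sqr_ge0.
Qed.

Lemma rd_Pm m y : 0 < y -> rderiv (Pm m) y
  ((m + 2^-1) * y `^ (m - 2^-1) * (em m y ^+ 2 - y * em (m + 1) y ^+ 2)).
Proof.
move=> y0; rewrite PmE.
apply: rd_eq (rd_mul (rd_powR (m + 2^-1) y0) (rd_add (rd_exprn 1 (rd_em m y)) (rd_mul (rd_id y) (rd_exprn 1 (rd_em (m + 1) y))))) _.
have -> : m + 2^-1 - 1 = m - 2^-1 by field.
rewrite (@powR_eqD _ y (m - 2^-1) 1 (m + 2^-1) y0); last by field.
rewrite powRr1 ?(ltW y0)//.
have -> : y * (2 * em (m + 1) y ^+ 1 * - em (m + 1 + 1) y) =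
    - 2 * em (m + 1) y * (y * em (m + 1 + 1) y) by ring.
by rewrite em_next; field.
Qed.

Lemma rd_Qm m y : 0 < y -> rderiv (Qm m) y (y `^ m * (em m y ^+ 2 - y * em (m + 1) y ^+ 2)).
Proof.
move=> y0; rewrite QmE.
apply: rd_eq (rd_mul (rd_powR (m + 1) y0) (rd_mul (rd_em m y) (rd_em (m + 1) y))) _.
rewrite addrK (@powR_eqD _ y m 1 (m + 1) y0)// powRr1 ?(ltW y0)//.
have -> : (m + 1) * y `^ m * (em m y * em (m + 1) y) + y `^ m * y * (- em (m + 1) y * em (m + 1) y + em m y * - em (m + 1 + 1) y)
  = y `^ m * ((m + 1) * (em m y * em (m + 1) y) - y * em (m + 1) y ^+ 2 - em m y * (y * em (m + 1 + 1) y)) by ring.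
by rewrite em_next; ring.
Qed.

(** With p = m + 1/2 one has P' = p y^(-1/2) Q', so V = P - p y^(-1/2) Q has the small derivative
    (p/2) y^(-3/2) Q. For y >= p^2, V lies between P/2 and 3P/2, and |Q| <= P/2 <= V makes V exp(|p|
    y^(-1/2)) nonincreasing. The constant is 2 (3/2) e. *)
Lemma Pm_decay m y0 y : 0 < y0 -> (m + 2^-1) ^+ 2 <= y0 -> y0 <= y -> Pm m y <= 3 * expR 1 * Pm m y0.
Proof.
move=> y00 py0 y0y; set p := m + 2^-1.
pose V t := Pm m t - p * t `^ (- 2^-1) * Qm m t.
have small t : y0 <= t -> `|p| * t `^ (- 2^-1) <= 1.
  move=> ht; have t0 : 0 < t by exact: lt_le_trans ht.
  rewrite powRN ler_pdivrMr ?powR_gt0// mul1r.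
  rewrite -ler_sqr ?nnegrE ?powR_ge0// real_normK ?num_real// [leRHS]expr2 powR_half//.
  exact: le_trans ht.
have PQ t : y0 <= t -> `|p * t `^ (- 2^-1) * Qm m t| <= Pm m t / 2.
  move=> ht; have t0 : 0 < t by exact: lt_le_trans ht.
  rewrite normrM -[leRHS]mul1r normrM (ger0_norm (powR_ge0 _ _)).
  by apply: ler_pM (small t ht) (Qm_le m t0) => //; rewrite mulr_ge0// powR_ge0.
have V1 t : y0 <= t -> Pm m t / 2 <= V t.
  by move=> ht; have := PQ t ht; rewrite ler_norml /V => /andP[_]; lra.
have V2 t : y0 <= t -> V t <= Pm m t * (3 / 2).
  by move=> ht; have := PQ t ht; rewrite ler_norml /V => /andP[+ _]; lra.
pose W t := V t * expR (`|p| * t `^ (- 2^-1)).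
have dV t : 0 < t -> rderiv V t (p / 2 * t `^ (- (3 / 2)) * Qm m t).
  move=> t0; apply: rd_eq (rd_sub (rd_Pm m t0) (rd_mul (rd_scale p (rd_powR (- 2^-1) t0)) (rd_Qm m t0))) _.
  have -> : - 2^-1 - 1 = - (3 / 2) :> R by field.
  by rewrite -/p (@powR_eqD _ t (- 2^-1) m (m - 2^-1) t0); [field|ring].
have dW t : 0 < t -> rderiv W t ((p / 2 * t `^ (- (3 / 2)) * Qm m t - `|p| / 2 * t `^ (- (3/2)) * V t) * expR (`|p| * t `^ (- 2^-1))).
  move=> t0; apply: rd_eq (rd_mul (dV t t0) (rd_comp (rd_expR _) (rd_scale `|p| (rd_powR (- 2^-1) t0)))) _.
  have -> : - 2^-1 - 1 = - (3 / 2) :> R by field.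
  by field.
have Wle : W y <= W y0.
  have dW' t : y0 <= t -> t <= y -> rderiv W t ((p / 2 * t `^ (- (3 / 2)) * Qm m t - `|p| / 2 * t `^ (- (3/2)) * V t) * expR (`|p| * t `^ (- 2^-1))).
    by move=> h _; apply: dW; exact: lt_le_trans h.
  apply: (mvt_noninc dW') => // t /ltW ht _.
  have t0 : 0 < t by exact: lt_le_trans ht.
  rewrite mulr_le0_ge0 ?expR_ge0// subr_le0.
  apply: (@le_trans _ _ (`|p| / 2 * t `^ (- (3 / 2)) * (Pm m t / 2))); last first.
    by rewrite ler_wpM2l ?V1// !mulr_ge0// powR_ge0.
  apply: le_trans (ler_norm _) _; rewrite !normrM (ger0_norm (powR_ge0 _ _)) normfV (@ger0_norm _ 2)//.
  by rewrite ler_wpM2l ?Qm_le// !mulr_ge0// powR_ge0.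
have Wy : Pm m y / 2 <= W y.
  apply: le_trans (V1 y y0y) _; rewrite /W ler_peMr//.
    by rewrite (le_trans _ (V1 y y0y))// divr_ge0// Pm_ge0// (le_trans _ y0y)// ltW.
  by rewrite -expR0 ler_expR mulr_ge0// powR_ge0.
have Wy0 : W y0 <= Pm m y0 * (3 / 2) * expR 1.
  apply: ler_pM; [|exact: expR_ge0|exact: V2|].
    by rewrite (le_trans _ (V1 y0 (lexx _)))// divr_ge0// Pm_ge0// ltW.
  by rewrite ler_expR small.
have -> : 3 * expR 1 * Pm m y0 = Pm m y0 * (3 / 2) * expR 1 * 2 by field.
move: (W y) (W y0) (_ * expR 1) (Pm m y) Wy Wle Wy0; clear => v w x q; lra.
Qed.

Lemma Pm_bound m y0 : 0 < y0 -> (m + 2^-1) ^+ 2 <= y0 -> exists2 C, 0 <= C &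
  forall y, y0 <= y -> y `^ (m + 2^-1) * em m y ^+ 2 <= C.
Proof.
move=> y00 py0; exists (3 * expR 1 * Pm m y0).
  by apply: mulr_ge0; [apply: mulr_ge0 => //; exact: expR_ge0|apply: Pm_ge0; exact: ltW].
move=> y yy; apply: le_trans (Pm_decay y00 py0 yy).
have ? : 0 < y by exact: lt_le_trans yy.
rewrite PmE ler_wpM2l ?powR_ge0// lerDl mulr_ge0 ?sqr_ge0//; exact: ltW.
Qed.

Lemma em_decay m : exists2 C : R, 0 <= C & forall y, 1 <= y ->
  `|em m y| <= C * y `^ (- (m / 2) - 4^-1).
Proof.
pose y0 := 1 + (m + 2^-1) ^+ 2; have y01 : 1 <= y0 by rewrite lerDl sqr_ge0.
have y00 : 0 < y0 by exact: lt_le_trans y01.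
have py0 : (m + 2^-1) ^+ 2 <= y0 by rewrite lerDr.
have [C C0 hC] := Pm_bound y00 py0.
have [B B0 hB] := rgamma_bound m.
set s := - (m / 2) - 4^-1.
(* The first term serves y >= y0, where the energy bound holds; the second is the crude bound on
   [1, y0]. *)
pose K := Num.sqrt C + 2 * B * expR y0 * y0 `^ `|s|.
have K0 : 0 <= 2 * B * expR y0 * y0 `^ `|s|.
  by rewrite !mulr_ge0 ?powR_ge0 ?expR_ge0// ltW.
exists K => [|y y1]; first by rewrite addr_ge0 ?sqrtr_ge0.
have yp : 0 < y by exact: lt_le_trans y1.
have [yy|yy] := leP y0 y.
  apply: (@le_trans _ _ (Num.sqrt C * y `^ s)); last first.
    by rewrite ler_wpM2r ?powR_ge0// lerDl.
  rewrite -ler_sqr ?nnegrE ?mulr_ge0 ?sqrtr_ge0 ?powR_ge0//.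
  rewrite real_normK ?num_real// exprMn sqr_sqrtr// [y `^ s ^+ 2]expr2 -powRDx//.
  have -> : s + s = - (m + 2^-1) by rewrite /s; field.
  by rewrite powRN ler_pdivlMr ?powR_gt0// mulrC hC.
apply: (@le_trans _ _ (2 * B * expR y0 * y0 `^ `|s| * y `^ s)); last first.
  by rewrite ler_wpM2r ?powR_ge0// lerDr sqrtr_ge0.
rewrite -mulrA; apply: (@le_trans _ _ (2 * B * expR y0)).
  apply: le_trans (em_bound y hB) _; rewrite ler_wpM2l ?mulr_ge0 ?(ltW B0)// ler_expR.
  by rewrite gtr0_norm// ltW.
rewrite ler_peMr ?mulr_ge0 ?expR_ge0 ?(ltW B0)//.
have a1 : y `^ (- s) <= y0 `^ `|s|.
  apply: (@le_trans _ _ (y `^ `|s|)); first by apply: ler_powR => //; rewrite -normrN ler_norm.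
  by apply: ge0_ler_powR => //; rewrite ?nnegrE; exact: ltW.
rewrite powRN in a1; have b0 : 0 < y `^ s by rewrite powR_gt0.
by rewrite -(@mulVf _ (y `^ s)) ?gt_eqF// ler_wpM2r// ltW.
Qed.

Lemma em_bounded m : exists2 C : R, 0 <= C & forall y, 0 <= y -> y <= 1 -> `|em m y| <= C.
Proof.
have [B B0 hB] := rgamma_bound m; exists (2 * B * expR 1).
  by rewrite !mulr_ge0 ?expR_ge0// ltW.
move=> y y0 y1; apply: le_trans (em_bound y hB) _.
by rewrite ler_wpM2l ?mulr_ge0 ?(ltW B0)// ler_expR ger0_norm.
Qed.

(** * Bounds uniform in the order *)

Section uniform.
Variable m0 : R.
Hypothesis m00 : 0 <= m0.

Let mm (n : nat) := m0 + n%:R.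
(** A sum of squares of Bessel functions J of consecutive orders at 2 sqrt y. Its derivative
    telescopes to two [cross] terms, so the lowest order controls all others. *)
Let SN (N : nat) y := \sum_(n < N) (y `^ mm n.+1 * em (mm n.+1) y ^+ 2).
Let cross (n : nat) y := y `^ mm n * (em (mm n) y * em (mm n.+1) y).

Lemma mmS n : mm n.+1 = mm n + 1. Proof. by rewrite /mm -natr1 addrA. Qed.
Lemma mm_ge0 n : 0 <= mm n. Proof. by rewrite addr_ge0. Qed.

Lemma rd_sum (N : nat) (f g : nat -> R -> R) y : (forall n, rderiv (f n) y (g n y)) ->
  rderiv (fun t => \sum_(n < N) f n t) y (\sum_(n < N) g n y).
Proof.
move=> h; elim: N => [|N IH].
  rewrite big_ord0; apply: rd_ext (rd_cst 0 y) => t; by rewrite big_ord0.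
rewrite big_ord_recr /=; apply: rd_ext (rd_add IH (h N)) => t.
by rewrite big_ord_recr.
Qed.

Lemma rd_SN N y : 0 < y -> rderiv (SN N) y (cross 0 y - cross N y).
Proof.
move=> y0; have -> : cross 0 y - cross N y = \sum_(n < N) (cross n y - cross n.+1 y).
  elim: N => [|N IH]; first by rewrite big_ord0 subrr.
  by rewrite big_ord_recr /= -IH addrA subrK.
apply: (@rd_sum N (fun n y => y `^ mm n.+1 * em (mm n.+1) y ^+ 2) (fun n y => cross n y - cross n.+1 y)) => n.
apply: rd_eq (rd_mul (rd_powR (mm n.+1) y0) (rd_exprn 1 (rd_em (mm n.+1) y))) _.
rewrite /cross -mmS.
have -> : em (mm n) y = mm n.+1 * em (mm n.+1) y - y * em (mm n.+2) y.
  by rewrite (mmS n.+1) -emS mmS addrK.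
rewrite !mmS addrK (@powR_eqD _ y (mm n) 1 (mm n + 1) y0)// powRr1 ?(ltW y0)//.
by rewrite expr1; move: (em _ y) (em _ y) (y `^ _) => a b c; ring.
Qed.

(** The first summand of the constant serves y >= y0, through [Qm_le] and [Pm_decay]; the second
    serves y < y0, through the uniform bound [em_le]. *)
Lemma cross0_bound : exists2 K : R, 0 <= K & forall y, 0 < y -> `|cross 0 y| <= K * y `^ (- 2^-1).
Proof.
pose y0 := 1 + (mm 0 + 2^-1) ^+ 2; have y01 : 1 <= y0 by rewrite lerDl sqr_ge0.
have y00 : 0 < y0 by exact: lt_le_trans y01.
have g1 : 0 < rgamma (mm 0 + 1) by rewrite rgamma_gt0// ltr_wpDl// mm_ge0.
have g2 : 0 < rgamma (mm 1 + 1) by rewrite rgamma_gt0// ltr_wpDl// mm_ge0.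
have A0 : 0 <= 3 * expR 1 * Pm (mm 0) y0 / 2.
  apply: divr_ge0 (ler0n _ 2); apply: mulr_ge0 (Pm_ge0 _ (ltW y00)).
  exact: mulr_ge0 (ler0n _ 3) (expR_ge0 _).
have B0 : 0 <= y0 `^ (mm 0 + 2^-1) * (rgamma (mm 0 + 1) * rgamma (mm 1 + 1)).
  exact: mulr_ge0 (powR_ge0 _ _) (mulr_ge0 (ltW g1) (ltW g2)).
exists (3 * expR 1 * Pm (mm 0) y0 / 2 + y0 `^ (mm 0 + 2^-1) * (rgamma (mm 0 + 1) * rgamma (mm 1 + 1))).
  exact: addr_ge0.
move=> y yp; rewrite powRN ler_pdivlMr ?powR_gt0//.
have e : `|cross 0 y| * y `^ 2^-1 = y `^ (mm 0 + 2^-1) * `|em (mm 0) y * em (mm 1) y|.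
  by rewrite /cross normrM (ger0_norm (powR_ge0 _ _)) powRDx// mulrAC.
rewrite e; have [yy|yy] := leP y0 y.
  have py : (mm 0 + 2^-1) ^+ 2 <= y0 by rewrite lerDr.
  apply: (@le_trans _ _ (3 * expR 1 * Pm (mm 0) y0 / 2)); last first.
    by rewrite lerDl.
  apply: (@le_trans _ _ (Pm (mm 0) y / 2)); last by rewrite ler_pM2r// Pm_decay.
  apply: le_trans (Qm_le (mm 0) yp).
  have -> : `|Qm (mm 0) y| = y `^ (mm 0 + 1) * `|em (mm 0) y * em (mm 1) y|.
    by rewrite QmE [LHS]normrM (ger0_norm (powR_ge0 _ _)) -mmS.
  rewrite ler_wpM2r//.
  by apply: ler_powR; [exact: le_trans yy|rewrite lerD2l; lra].
apply: (@le_trans _ _ (y0 `^ (mm 0 + 2^-1) * (rgamma (mm 0 + 1) * rgamma (mm 1 + 1)))); last first.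
  by rewrite lerDr.
apply: ler_pM; [exact: powR_ge0|exact: normr_ge0| |].
  have h0 := mm_ge0 0; apply: ge0_ler_powR; rewrite ?nnegrE; [lra|exact: ltW|exact: ltW|exact: ltW].
have := mm_ge0 0; have := mm_ge0 1 => h1 h0.
rewrite normrM; apply: (ler_pM (normr_ge0 _) (normr_ge0 _)); apply: em_le (ltW yp).
  by apply: le_trans h0; rewrite oppr_le0.
by apply: le_trans h1; rewrite oppr_le0.
Qed.

(** On a bounded range the order factorial in [rgamma_fact] beats y^N; this disposes of the upper
    end of the telescoping sum. *)
Lemma cross_small (y : R) : 0 < y -> exists N0, forall N, (N0 <= N)%N -> forall t, 0 < t -> t <= y ->
  `|cross N t| <= t `^ (- 2^-1).
Proof.
move=> y0; have g1 : 0 < rgamma (m0 + 1) by rewrite rgamma_gt0// ltr_wpDl.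
pose c := rgamma (m0 + 1) ^+ 2 * y `^ (m0 + 2^-1).
have lim0 : c * (y ^+ n / n`!%:R) @[n --> \oo] --> (0 : R).
  have l1 : c * 0 = 0 by rewrite mulr0.
  apply: (cvgn_ext _ (fun=> erefl) l1); apply: cvgM; first exact: cvg_cst.
  exact: cvg_exp_coeff.
have [N0 _ hN] : \forall n \near \oo, `|0 - c * (y ^+ n / n`!%:R)| <= 1.
  by move/cvgrPdist_le : lim0; apply.
exists N0 => N /hN; rewrite sub0r normrN => h1 t t0 ty.
rewrite powRN -[leRHS]mul1r ler_pdivlMr ?powR_gt0//.
rewrite /cross normrM (ger0_norm (powR_ge0 _ _)) mulrAC -powRDx//.
apply: le_trans (le_trans (ler_norm _) h1).
have a1 : t `^ (mm N + 2^-1) <= y `^ (m0 + 2^-1) * y ^+ N.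
  apply: (@le_trans _ _ (y `^ (mm N + 2^-1))).
    by apply: ge0_ler_powR; rewrite ?nnegrE ?addr_ge0 ?mm_ge0 ?(ltW t0) ?(ltW y0) ?invr_ge0.
  by rewrite -powR_mulrn ?(ltW y0)// -powRDx// /mm addrAC.
have e1 n : `|em (mm n) t| <= rgamma (m0 + 1) / n`!%:R.
  have := mm_ge0 n => h; apply: le_trans (em_le _ (ltW t0)) _; first by lra.
  by rewrite /mm addrAC; apply: rgamma_fact; rewrite lerDr.
have -> : c * (y ^+ N / N`!%:R) = (y `^ (m0 + 2^-1) * y ^+ N) * (rgamma (m0 + 1) / N`!%:R * rgamma (m0 + 1)).
  by rewrite /c; ring.
apply: ler_pM => //; first exact: powR_ge0.
rewrite normrM; apply: ler_pM => //.
apply: le_trans (e1 N.+1) _; rewrite ler_piMr ?(ltW g1)//.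
by rewrite invf_le1 ?ler1n ?ltr0n fact_gt0.
Qed.

(** A single square is at most the sum [SN], whose derivative is at most (K+1) t^(-1/2) for N large;
    integrating gives 2(K+1) sqrt y. The constant depends neither on n nor on y. *)
Lemma em_sqrt_bound : exists2 L : R, 0 <= L & forall n y, 0 < y ->
  y `^ mm n.+1 * em (mm n.+1) y ^+ 2 <= L * y `^ 2^-1.
Proof.
have [K K0 hK] := cross0_bound; exists (2 * (K + 1) + 1); first by lra.
move=> n y y0; have [N0 hN0] := cross_small y0.
pose N := maxn N0 n.+1; have N1 : (n < N)%N by rewrite leq_max leqnn orbT.
have hN := hN0 N (leq_maxl _ _).
pose f t := SN N t - 2 * (K + 1) * t `^ 2^-1.
have df t : 0 < t -> rderiv f t (cross 0 t - cross N t - (K + 1) * t `^ (- 2^-1)).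
  move=> t0; apply: rd_eq (rd_sub (rd_SN N t0) (rd_scale (2 * (K + 1)) (rd_powR 2^-1 t0))) _.
  by rewrite (_ : 2^-1 - 1 = - 2^-1 :> R); field.
pose B := \sum_(n < N) rgamma (mm n.+1 + 1) ^+ 2.
have B0 : 0 <= B by apply: sumr_ge0 => k _; exact: sqr_ge0.
have SNB t : 0 < t -> t <= 1 -> SN N t <= B * t.
  move=> t0 t1; rewrite /SN /B mulr_suml; apply: ler_sum => k _.
  rewrite mulrC; apply: ler_pM; [exact: sqr_ge0|exact: powR_ge0| |].
    have := mm_ge0 k.+1 => h; have e := em_le (_ : - 2^-1 <= mm k.+1) (ltW t0).
    rewrite -real_normK ?num_real// ler_sqr ?nnegrE//; first by apply: e; lra.
    by apply: ltW; apply: rgamma_gt0; lra.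
  rewrite -[leRHS](powRr1 (ltW t0)); apply: powR_le1 => //.
  by rewrite mmS lerDr mm_ge0.
pose r := y `^ 2^-1; have r0 : 0 < r by rewrite powR_gt0.
have BB : 0 < B + 1 by rewrite ltr_wpDl.
(* The comparison starts at a point d so close to 0 that the sum there is at most sqrt y. *)
pose d := Num.min y (Num.min 1 (r / (B + 1))).
have d0 : 0 < d by rewrite !lt_min y0 ltr01 divr_gt0.
have [dy d1 dr] : [/\ d <= y, d <= 1 & d <= r / (B + 1)].
  by split; rewrite !ge_min lexx ?orbT.
have SNd : SN N d <= r.
  apply: le_trans (SNB d d0 d1) _; apply: (@le_trans _ _ ((B + 1) * (r / (B + 1)))).
    by apply: ler_pM; rewrite ?(ltW d0)// lerDl.
  by rewrite mulrC divfK// gt_eqF.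
have fyd : f y <= f d.
  have df' t : d <= t -> t <= y -> rderiv f t (cross 0 t - cross N t - (K + 1) * t `^ (- 2^-1)).
    by move=> dt _; apply: df; exact: lt_le_trans dt.
  apply: (mvt_noninc df') => // t dt /ltW ty.
  have t0 : 0 < t by exact: lt_trans dt.
  have := hK t t0; have := hN t t0 ty; have := powR_ge0 t (- 2^-1).
  rewrite !ler_norml; move: (t `^ _) => u u0 /andP[a1 a2] /andP[a3 a4].
  by rewrite mulrDl; lra.
have p0 : 0 <= d `^ 2^-1 by exact: powR_ge0.
have SNy : SN N y <= (2 * (K + 1) + 1) * r.
  have : 0 <= 2 * (K + 1) * d `^ 2^-1 by rewrite !mulr_ge0//; lra.
  by move: fyd SNd; rewrite /f -/r mulrDl mul1r; lra.
apply: le_trans SNy; rewrite /SN (bigD1 (Ordinal N1))//= lerDl.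
by apply: sumr_ge0 => k _; rewrite mulr_ge0 ?powR_ge0// sqr_ge0.
Qed.

(** Below y1 = (m + 1/2)^2 the bound [em_sqrt_bound] is multiplied by sqrt y; above it [Pm_decay]
    starts from y1, where [Pm] is at most 2 L y1. Quadratic growth in the order is harmless against
    a geometric factor. *)
Lemma em_uniform : exists2 L : R, 0 <= L & forall n y, 0 < y ->
  y `^ (mm n.+1 + 2^-1) * em (mm n.+1) y ^+ 2 <= L * (mm n.+1 + 1) ^+ 2.
Proof.
have [L L0 hL] := em_sqrt_bound; have E0 : 0 < expR 1 :> R by exact: expR_gt0.
exists (6 * expR 1 * L + L) => [|n y y0].
  by apply: addr_ge0 => //; apply: mulr_ge0 => //; rewrite mulr_ge0// ltW.
set m := mm n.+1; have m1 : 0 <= m by exact: mm_ge0.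
pose y1 := (m + 2^-1) ^+ 2.
have y10 : 0 < y1 by rewrite exprn_gt0//; lra.
have y1le : y1 <= (m + 1) ^+ 2 by rewrite ler_sqr ?nnegrE; lra.
have bound t : 0 < t -> t `^ (m + 2^-1) * em m t ^+ 2 <= L * t.
  move=> t0; rewrite powRDx// mulrAC; apply: (@le_trans _ _ (L * t `^ 2^-1 * t `^ 2^-1)).
    by rewrite ler_wpM2r ?powR_ge0// hL.
  by rewrite -mulrA powR_half.
have [yy|yy] := leP y1 y; last first.
  apply: le_trans (bound y y0) _; apply: ler_pM => //; first exact: ltW.
    by rewrite lerDr !mulr_ge0// ltW.
  exact: le_trans (ltW yy) y1le.
have P1 : Pm m y1 <= 2 * L * y1.
  have h1 := hL n _ y10; have h2 := hL n.+1 _ y10; rewrite PmE.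
  have -> : y1 `^ (m + 2^-1) * (em m y1 ^+ 2 + y1 * em (m + 1) y1 ^+ 2) =
     (y1 `^ m * em m y1 ^+ 2 + y1 `^ (mm n.+2) * em (mm n.+2) y1 ^+ 2) * y1 `^ 2^-1.
    by rewrite (mmS n.+1) -/m !powRDx// powRr1 ?(ltW y10)//; ring.
  apply: (@le_trans _ _ ((L * y1 `^ 2^-1 + L * y1 `^ 2^-1) * y1 `^ 2^-1)).
    by rewrite ler_wpM2r ?powR_ge0// lerD.
  rewrite -mulrDl -mulrA powR_half//; lra.
apply: (@le_trans _ _ (Pm m y)).
  by rewrite PmE ler_wpM2l ?powR_ge0// lerDl mulr_ge0 ?sqr_ge0// ltW.
apply: le_trans (Pm_decay y10 (lexx _) yy) _.
apply: (@le_trans _ _ (3 * expR 1 * (2 * L * y1))).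
  by rewrite ler_wpM2l// mulr_ge0// ltW.
have -> : 3 * expR 1 * (2 * L * y1) = 6 * expR 1 * L * y1 by ring.
apply: ler_pM => //; [by rewrite !mulr_ge0// ltW|exact: ltW|by rewrite lerDl].
Qed.

End uniform.

End RealBessel.

(** * Vanishing of the weighted product integrals *)

Section Weights.
Context {R : realType}.
Implicit Types (m n t p q x y : R).

Lemma powR_cmp x y c q : 0 < x -> 0 < y -> 1 <= c -> x <= c * y -> y <= c * x ->
  x `^ q <= c `^ `|q| * y `^ q.
Proof.
move=> x0 y0 c1 xy yx; have c0 : 0 < c by exact: lt_le_trans c1.
have [q0|q0] := leP 0 q.
  rewrite ger0_norm// -powRM ?(ltW c0) ?(ltW y0)//.
  by apply: ge0_ler_powR; rewrite ?nnegrE ?mulr_ge0 ?(ltW x0) ?(ltW y0) ?(ltW c0).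
rewrite ltr0_norm// -[in x `^ q](opprK q) -[in y `^ q](opprK q) !(powRN _ (- q)).
rewrite ler_pdivlMr ?powR_gt0// mulrC ler_pdivrMr ?powR_gt0// -powRM ?(ltW c0) ?(ltW x0)//.
by apply: ge0_ler_powR; rewrite ?nnegrE ?mulr_ge0 ?(ltW x0) ?(ltW y0) ?(ltW c0) ?oppr_ge0 ?(ltW q0).
Qed.

(** A single majorant for both ends: of order t^p at 0 and of order t^(p+q) at infinity. *)
Definition wt p q t : R := t `^ p * (1 + t) `^ q.

Lemma wt_ge0 p q t : 0 <= wt p q t. Proof. by rewrite mulr_ge0 ?powR_ge0. Qed.

Lemma cont_powR1 q t : 0 < t -> {for t, continuous (fun t => (1 + t) `^ q)}.
Proof.
move=> t0; apply: rd_cont (rd_comp (rd_powR _ _) (rd_add (rd_cst 1 t) (rd_id t))).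
by rewrite addr_gt0.
Qed.

Lemma cont_wt p q t : 0 < t -> {for t, continuous (wt p q)}.
Proof. by move=> t0; apply: cvgM; [exact: cont_powR|exact: cont_powR1]. Qed.

Lemma int0_wt p q : -1 < p -> p + q < -1 -> int0 (wt p q).
Proof.
move=> p1 pq; apply: (@int0_near_bounds _ _ p (p + q) (2 `^ `|q|)) => //.
- by apply: mfun0_cont => t t0; exact: cont_wt.
- move=> t t0 t1; rewrite ger0_norm ?wt_ge0// /wt mulrC ler_wpM2r ?powR_ge0//.
  by have := @powR_cmp (1 + t) 1 2 q; rewrite powR1 mulr1; apply; lra.
- move=> t t1; have t0 : 0 < t by exact: lt_le_trans t1.
  rewrite ger0_norm ?wt_ge0// /wt powRDx// mulrCA ler_wpM2l ?powR_ge0//.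
  by apply: powR_cmp => //; lra.
Qed.

Lemma em_wt1 m : exists2 C : R, 0 <= C & forall y, 0 < y ->
  `|em m y| <= C * (1 + y) `^ (- (m / 2) - 4^-1).
Proof.
have [C C0 hC] := em_decay m; have [D D0 hD] := em_bounded m.
set q := - (m / 2) - 4^-1; have P0 : 0 <= 2 `^ `|q| :> R by exact: powR_ge0.
exists ((C + D) * 2 `^ `|q|) => [|y y0]; first by rewrite mulr_ge0// addr_ge0.
have [y1|/ltW y1] := leP 1 y.
  apply: le_trans (hC y y1) _; apply: (@le_trans _ _ (C * (2 `^ `|q| * (1 + y) `^ q))).
    by rewrite ler_wpM2l//; apply: powR_cmp; lra.
  by rewrite mulrA ler_wpM2r ?powR_ge0// ler_wpM2r// lerDl.
apply: le_trans (hD y (ltW y0) y1) _; apply: (@le_trans _ _ (D * (2 `^ `|q| * (1 + y) `^ q))).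
  by rewrite ler_peMr//; have := @powR_cmp 1 (1 + y) 2 q; rewrite powR1; apply; lra.
by rewrite mulrA ler_wpM2r ?powR_ge0// ler_wpM2r// lerDr.
Qed.

Lemma em_wt m (a1 a2 : R) : 0 < a1 -> exists2 C : R, 0 <= C & forall a t,
  a1 <= a -> a <= a2 -> 0 < t -> `|em m (a * t)| <= C * (1 + t) `^ (- (m / 2) - 4^-1).
Proof.
move=> a10; have [C C0 hC] := em_wt1 m; set q := - (m / 2) - 4^-1.
pose c : R := 1 + a2 + a1^-1; exists (C * c `^ `|q|) => [|a t aa1 aa2 t0].
  by rewrite mulr_ge0// powR_ge0.
have a0 : 0 < a by exact: lt_le_trans aa1.
have at0 : 0 < a * t by exact: mulr_gt0.
have a20 : 0 < a2 by exact: lt_le_trans aa2.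
have i0 : 0 < a1^-1 by rewrite invr_gt0.
have ia : a^-1 <= a1^-1 by rewrite lef_pV2 ?posrE.
have tat : t <= a1^-1 * (a * t) by rewrite mulrA ler_peMl ?(ltW t0)// mulrC ler_pdivlMr// mul1r.
have ta : a * t <= a2 * t by rewrite ler_wpM2r// ltW.
have h1 : 0 <= a2 * (a * t) by rewrite mulr_ge0 ?(ltW a20) ?(ltW at0).
have h2 : 0 <= a1^-1 * t by rewrite mulr_ge0 ?(ltW i0) ?(ltW t0).
apply: le_trans (hC _ at0) _; rewrite -mulrA ler_wpM2l//.
by apply: powR_cmp; rewrite /c; lra.
Qed.

Lemma wt_mul (t p q r : R) : 0 < t -> t `^ p * ((1 + t) `^ q * (1 + t) `^ r) = wt p (q + r) t.
Proof. by move=> t0; rewrite /wt -powRDx// addr_gt0. Qed.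

(** The constant is uniform for a and b in compact ranges, as needed to differentiate in b and to
    let a tend to b. *)
Lemma em_prod_wt m n p (a1 a2 b1 b2 : R) : 0 < a1 -> 0 < b1 -> exists2 C : R, 0 <= C & forall a b t,
  a1 <= a -> a <= a2 -> b1 <= b -> b <= b2 -> 0 < t ->
  `|t `^ p * (em m (a * t) * em n (b * t))| <= C * wt p (- ((m + n + 1) / 2)) t.
Proof.
move=> a10 b10; have [C C0 hC] := em_wt m a2 a10; have [D D0 hD] := em_wt n b2 b10.
exists (C * D) => [|a b t aa1 aa2 bb1 bb2 t0]; first exact: mulr_ge0.
have -> : - ((m + n + 1) / 2) = (- (m / 2) - 4^-1) + (- (n / 2) - 4^-1) by field.
rewrite -wt_mul// normrM (ger0_norm (powR_ge0 _ _)) mulrCA ler_wpM2l ?powR_ge0//.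
rewrite normrM mulrACA; apply: ler_pM => //; [exact: hC|exact: hD].
Qed.

Lemma cont_em_scale m (a t : R) : 0 < t -> 0 < a -> {for t, continuous (fun t => em m (a * t))}.
Proof. by move=> t0 a0; apply: (cont_scale a0) => // s _; exact: cont_em. Qed.

Lemma cont_wemem m n p (a b t : R) : 0 < t -> 0 < a -> 0 < b ->
  {for t, continuous (fun t => t `^ p * (em m (a * t) * em n (b * t)))}.
Proof.
move=> t0 a0 b0; apply: cvgM; first exact: cont_powR.
by apply: cvgM; exact: cont_em_scale.
Qed.

Lemma int0_wemem m n p (a b : R) : 0 < a -> 0 < b -> -1 < p -> p - (m + n + 1) / 2 < -1 ->
  int0 (fun t => t `^ p * (em m (a * t) * em n (b * t))).
Proof.
move=> a0 b0 p1 pq; have [C C0 hC] := em_prod_wt m n p a b a0 b0.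
apply: (@int0_le _ _ (fun t => C * wt p (- ((m + n + 1) / 2)) t)).
- by apply: mfun0_cont => t t0; exact: cont_wemem.
- by apply/int0Z/int0_wt.
- by move=> t t0; exact: hC.
Qed.

Lemma rd_emM m a t : rderiv (fun t => em m (a * t)) t (- (a * em (m + 1) (a * t))).
Proof.
apply: rd_eq (rd_comp (rd_em m (a * t)) (rd_scale a (rd_id t))) _; ring.
Qed.

Lemma rd_powR_em n b t : 0 < t ->
  rderiv (fun t => t `^ (n + 1) * em (n + 1) (b * t)) t (t `^ n * em n (b * t)).
Proof.
move=> t0; apply: rd_eq (rd_mul (rd_powR (n + 1) t0) (rd_emM (n + 1) b t)) _.
rewrite addrK (@powR_eqD _ t n 1 (n + 1) t0)// powRr1 ?(ltW t0)//.
by have := em_next n (b * t); move: (em _ _) (em _ _) (em _ _) (t `^ _) => e e1 e2 u h;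
  rewrite -[e2](addrNK e2) ; ring: h.
Qed.

Lemma wt_le0 p q t : 0 < t -> t <= 1 -> wt p q t <= 2 `^ `|q| * t `^ p.
Proof.
move=> t0 t1; rewrite /wt mulrC ler_wpM2r ?powR_ge0//.
by have := @powR_cmp (1 + t) 1 2 q; rewrite powR1 mulr1; apply; lra.
Qed.

Lemma wt_ley p q t : 1 <= t -> wt p q t <= 2 `^ `|q| * t `^ (p + q).
Proof.
move=> t1; have t0 : 0 < t by exact: lt_le_trans t1.
by rewrite /wt powRDx// mulrCA ler_wpM2l ?powR_ge0//; apply: powR_cmp; lra.
Qed.

Definition Wi m n (a b : R) := I0 (fun t => t `^ n * (em m (a * t) * em n (b * t))).

(** Integration by parts with t^n e_n(bt) = (t^(n+1) e_{n+1}(bt))'. The condition n + 1 < m says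
    that the exponent (n-m-1)/2 at infinity is below -1, and it survives raising both orders. *)
Lemma Wi_step m n (a b : R) : 0 < a -> 0 < b -> -1 < n -> n + 1 < m ->
  Wi m n a b = a * Wi (m + 1) (n + 1) a b.
Proof.
move=> a0 b0 n1 mn; rewrite /Wi.
have i1 : int0 (fun t => t `^ n * (em m (a * t) * em n (b * t))) by apply: int0_wemem; lra.
have i2 : int0 (fun t => t `^ (n + 1) * (em (m + 1) (a * t) * em (n + 1) (b * t))).
  by apply: int0_wemem; lra.
rewrite -I0Z//; apply/eqP; rewrite -subr_eq0 -I0B//; last exact: int0Z.
have [C C0 hC] := @em_prod_wt m (n + 1) (n + 1) a a b b a0 b0.
set q := - ((m + (n + 1) + 1) / 2) in hC.
apply/eqP; apply: (@ftc0_zero _ _ (fun t => em m (a * t) * (t `^ (n + 1) * em (n + 1) (b * t)))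
  (n + 1) (n + 1 + q) (C * 2 `^ `|q|)).
- lra.
- rewrite /q; lra.
- move=> t t0; apply: cvgB; first exact: cont_wemem.
  by apply: cvgM; [exact: cvg_cst|exact: cont_wemem].
- move=> t t0; apply: rd_eq (rd_mul (rd_emM m a t) (rd_powR_em n b t0)) _; ring.
- by apply: int0B => //; exact: int0Z.
- move=> t t0 t1; rewrite mulrCA -mulrA; apply: le_trans (hC a b t _ _ _ _ t0) _ => //.
  by rewrite ler_wpM2l// wt_le0.
- move=> t t1; have t0 : 0 < t by exact: lt_le_trans t1.
  rewrite mulrCA -mulrA; apply: le_trans (hC a b t _ _ _ _ t0) _ => //.
  by rewrite ler_wpM2l// wt_ley.
Qed.

Lemma Wi_iter m n (a b : R) k : 0 < a -> 0 < b -> -1 < n -> n + 1 < m ->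
  Wi m n a b = a ^+ k * Wi (m + k%:R) (n + k%:R) a b.
Proof.
move=> a0 b0 n1 mn; elim: k => [|k IH]; first by rewrite !addr0 mul1r.
have k0 : 0 <= k%:R :> R by [].
by rewrite IH Wi_step//; [rewrite exprSr mulrA -!addrA !natr1|lra|lra].
Qed.

Lemma em_uniform1 m : 1 <= m -> exists2 L : R, 0 <= L & forall (k : nat) y, 0 < y ->
  `|em (m + k%:R) y| <= L * (m + k%:R + 1) * y `^ (- ((m + k%:R) / 2) - 4^-1).
Proof.
move=> m1; have m0 : 0 <= m - 1 by lra.
have [L L0 hL] := em_uniform m0; exists (Num.sqrt L) => [|k y y0]; first exact: sqrtr_ge0.
have := hL k y y0; have -> : m - 1 + k.+1%:R = m + k%:R by rewrite -natr1; ring.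
have : 0 <= m + k%:R by rewrite addr_ge0//; lra.
move: (m + k%:R) => M M0 h.
have s0 := sqrtr_ge0 L; have p0 : 0 <= y `^ (- (M / 2) - 4^-1) by exact: powR_ge0.
have M1 : 0 <= M + 1 by lra.
rewrite -ler_sqr ?nnegrE//; last by rewrite !mulr_ge0.
rewrite real_normK ?num_real// !exprMn sqr_sqrtr// [y `^ _ ^+ 2]expr2 -powRDx//.
have -> : - (M / 2) - 4^-1 + (- (M / 2) - 4^-1) = - (M + 2^-1) by field.
by rewrite powRN ler_pdivlMr ?powR_gt0// mulrC.
Qed.

(** The first term comes from t <= 1, where e_{m+k} has the factor 1/k!; the second from t >= 1 by
    [em_uniform1]. There the powers of t combine to the exponent r, which does not depend on k. *)
Lemma Wi_dom m n (a b : R) : 0 < a -> 0 < b -> 1 <= n -> n + 1 < m ->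
  exists C D : R, [/\ 0 <= C, 0 <= D & forall k, `|Wi (m + k%:R) (n + k%:R) a b| <=
    C / k`!%:R + D * (m + k%:R + 1) ^+ 2 * (a * b) `^ (- (k%:R / 2))].
Proof.
move=> a0 b0 n1 mn; pose r := (n - m) / 2 - 2^-1.
have r1 : r < -1 by rewrite /r; lra.
have iw : int0 (wt 0 r) by apply: int0_wt; lra.
have J0 : 0 <= I0 (wt 0 r) by apply: I0_ge0 => t _; exact: wt_ge0.
have P0 : 0 <= 2 `^ `|r| :> R by exact: powR_ge0.
have [L L0 hL] := @em_uniform1 m ltac:(lra); have [L' L'0 hL'] := em_uniform1 n1.
pose K := rgamma (m + 1) * rgamma (n + 1).
have g1 : 0 < rgamma (m + 1) by apply: rgamma_gt0; lra.
have g2 : 0 < rgamma (n + 1) by apply: rgamma_gt0; lra.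
pose S := L * L' * (a `^ (- (m / 2) - 4^-1) * b `^ (- (n / 2) - 4^-1)).
have S0 : 0 <= S by exact: mulr_ge0 (mulr_ge0 L0 L'0) (mulr_ge0 (powR_ge0 _ _) (powR_ge0 _ _)).
have K0 : 0 <= K by exact: mulr_ge0 (ltW g1) (ltW g2).
exists (I0 (wt 0 r) * 2 `^ `|r| * K), (I0 (wt 0 r) * 2 `^ `|r| * S); split.
- exact: mulr_ge0 (mulr_ge0 J0 P0) K0.
- exact: mulr_ge0 (mulr_ge0 J0 P0) S0.
move=> k; have k0 : 0 <= k%:R :> R by [].
set M := m + k%:R; set N := n + k%:R; set E := (a * b) `^ _.
have M0 : 0 <= M + 1 by rewrite /M; lra.
have E0 : 0 <= E by exact: powR_ge0.
pose B1 := K / k`!%:R; pose B2 := S * (M + 1) ^+ 2 * E.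
have B10 : 0 <= B1 by exact: divr_ge0 K0 (ler0n _ _).
have B20 : 0 <= B2 by exact: mulr_ge0 (mulr_ge0 S0 (sqr_ge0 _)) E0.
have -> : I0 (wt 0 r) * 2 `^ `|r| * K / k`!%:R + I0 (wt 0 r) * 2 `^ `|r| * S * (M + 1) ^+ 2 * E =
  (2 `^ `|r| * (B1 + B2)) * I0 (wt 0 r) by rewrite /B1 /B2; ring.
rewrite -I0Z//; apply: normr_I0_le; [|exact: int0Z|].
  by apply: int0_wemem => //; rewrite /M /N; lra.
move=> t t0; have [t1|/ltW t1] := leP 1 t.
  apply: (@le_trans _ _ (B2 * t `^ r)); last first.
    have -> : 2 `^ `|r| * (B1 + B2) * wt 0 r t = (B1 + B2) * (2 `^ `|r| * wt 0 r t) by ring.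
    apply: ler_pM => //; [exact: powR_ge0|by rewrite lerDr|].
    by rewrite /wt powRr0 mul1r; apply: powR_cmp; clear -t0 t1; lra.
  rewrite !normrM (ger0_norm (powR_ge0 _ _)).
  have at0 := mulr_gt0 a0 t0; have bt0 := mulr_gt0 b0 t0.
  apply: (@le_trans _ _ (t `^ N * ((L * (M + 1) * (a * t) `^ (- (M / 2) - 4^-1)) * (L' * (M + 1) * (b * t) `^ (- (N / 2) - 4^-1))))).
    rewrite ler_wpM2l ?powR_ge0//; apply: ler_pM => //; first exact: hL.
    apply: le_trans (hL' k _ bt0) _; rewrite ler_wpM2r ?powR_ge0// ler_wpM2l//.
    by rewrite /M; lra.
  rewrite !powRM ?(ltW a0) ?(ltW b0) ?(ltW t0)//.
  have et : t `^ r = t `^ N * (t `^ (- (M / 2) - 4^-1) * t `^ (- (N / 2) - 4^-1)).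
    by rewrite -!powRDx//; congr (_ `^ _); rewrite /r /M /N; field.
  have ea : a `^ (- (M / 2) - 4^-1) = a `^ (- (m / 2) - 4^-1) * a `^ (- (k%:R / 2)).
    by rewrite -powRDx//; congr (_ `^ _); rewrite /M; field.
  have eb : b `^ (- (N / 2) - 4^-1) = b `^ (- (n / 2) - 4^-1) * b `^ (- (k%:R / 2)).
    by rewrite -powRDx//; congr (_ `^ _); rewrite /N; field.
  rewrite et ea eb /B2 /S /E powRM ?(ltW a0) ?(ltW b0)// le_eqVlt; apply/orP; left; apply/eqP.
  move: (a `^ _) (a `^ _) (b `^ _) (b `^ _) (t `^ _) (t `^ _) (t `^ _) => x1 x2 x3 x4 x5 x6 x7; ring.
apply: (@le_trans _ _ B1); last first.
  rewrite -[leLHS]mulr1; apply: (@le_trans _ _ ((B1 + B2) * (2 `^ `|r| * wt 0 r t))).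
    apply: ler_pM => //; first by rewrite lerDl.
    by rewrite /wt powRr0 mul1r; have := @powR_cmp 1 (1 + t) 2 r; rewrite powR1; apply; clear -t0 t1; lra.
  by rewrite mulrCA mulrA.
rewrite !normrM (ger0_norm (powR_ge0 _ _)); have at0 := mulr_gt0 a0 t0; have bt0 := mulr_gt0 b0 t0.
apply: (@le_trans _ _ (1 * (rgamma (m + 1) / k`!%:R * rgamma (n + 1)))); last by rewrite mul1r mulrAC.
have f0 : 0 < k`!%:R :> R by rewrite ltr0n fact_gt0.
have f1 : k`!%:R^-1 <= 1 :> R by rewrite invf_le1// ler1n fact_gt0.
apply: ler_pM; [exact: powR_ge0|exact: mulr_ge0| |].
  have := @powR_le1 _ t 0 N t0 t1; rewrite powRr0; apply; rewrite /N; lra.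
apply: ler_pM => //.
  apply: le_trans (em_le _ (ltW at0)) _; first by rewrite /M; clear -n1 mn k0; lra.
  by rewrite /M addrAC; apply: rgamma_fact; clear -n1 mn; lra.
apply: le_trans (em_le _ (ltW bt0)) _; first by rewrite /N; clear -n1 k0; lra.
apply: (@le_trans _ _ (rgamma (n + 1) / k`!%:R)); last by rewrite ler_piMr// ltW.
by rewrite /N addrAC; apply: rgamma_fact; clear -n1; lra.
Qed.

(** After k steps the prefactor a^k meets (ab)^(-k/2) and leaves (a/b)^(k/2), which beats the
    polynomial in k; the other term a^k/k! tends to 0 as well. *)
Lemma Wi0 m n (a b : R) : 0 < a -> a < b -> -1 < n -> n + 1 < m -> Wi m n a b = 0.
Proof.
move=> a0 ab n1 mn; have b0 : 0 < b by exact: lt_trans ab.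
(* Two steps raise the second order from above -1 to above 1, as [Wi_dom] requires. *)
rewrite (@Wi_iter m n a b 2)//.
suff -> : Wi (m + 2) (n + 2) a b = 0 by rewrite mulr0.
have {n1} : 1 <= n + 2 by lra.
have {mn} : n + 2 + 1 < m + 2 by lra.
move: (n + 2) (m + 2) => {}n {}m mn n1.
have [C [D [C0 D0 hC]]] := Wi_dom a0 b0 n1 mn.
(* Chosen so that (a/b)^(k/2) = exp(-c k); positive because a < b. *)
pose c := ln (b / a) / 2.
have c0 : 0 < c by rewrite divr_gt0// ln_gt0// ltr_pdivlMr// mul1r.
have [S S0 hS] := @powR_expR_decay R 2 c (-1) c0.
pose u (k : nat) : R := C * (a ^+ k.+1 / k.+1`!%:R) + (D * (m + 2) ^+ 2 * S) / k.+1%:R.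
have hu k : `|Wi m n a b| <= u k.
  rewrite (@Wi_iter m n a b k.+1)//; last by lra.
  rewrite normrM (ger0_norm (exprn_ge0 _ (ltW a0))).
  apply: (le_trans (ler_wpM2l (exprn_ge0 _ (ltW a0)) (hC k.+1))).
  rewrite mulrDr /u; apply: lerD; first by rewrite mulrCA.
  set K : R := k.+1%:R; have K1 : 1 <= K by rewrite ler1n.
  have K0 : 0 < K by exact: lt_le_trans K1.
  have e1 : a ^+ k.+1 * (a * b) `^ (- (K / 2)) = expR (- (c * K)).
    rewrite -powR_mulrn ?(ltW a0)// powRM ?(ltW a0) ?(ltW b0)// mulrA -powRDx//.
    rewrite /powR (gt_eqF a0) (gt_eqF b0) -expRD; congr expR; rewrite /c ln_div ?posrE// -/K.
    by field.
  have -> : a ^+ k.+1 * (D * (m + K + 1) ^+ 2 * (a * b) `^ (- (K / 2))) =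
    D * ((m + K + 1) ^+ 2 * expR (- (c * K))) by rewrite -e1; ring.
  have -> : D * (m + 2) ^+ 2 * S / K = D * ((m + 2) ^+ 2 * (S / K)) by rewrite !mulrA.
  rewrite ler_wpM2l//.
  have := hS K K1; rewrite powRN powRr1 ?(ltW K0)// powR_mulrn ?(ltW K0)// => h2.
  apply: (@le_trans _ _ (((m + 2) * K) ^+ 2 * expR (- (c * K)))); last first.
    by rewrite exprMn -(mulrA ((m + 2) ^+ 2)) ler_wpM2l ?sqr_ge0.
  apply: ler_pM; rewrite ?sqr_ge0 ?expR_ge0//.
  rewrite ler_sqr ?nnegrE; [|lra|by rewrite mulr_ge0 ?(ltW K0)//; lra].
  rewrite mulrDl; have : m * 1 <= m * K by rewrite ler_wpM2l//; lra.
  by lra.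
have lim0 : u k @[k --> \oo] --> (0 : R).
  have l0 : C * 0 + (D * (m + 2) ^+ 2 * S) * 0 = 0 by ring.
  apply: (cvgn_ext _ (fun=> erefl) l0); apply: cvgD; (apply: cvgM; first exact: cvg_cst).
    by rewrite (cvg_shiftS (fun k => a ^+ k / k`!%:R)); exact: cvg_exp_coeff.
  exact: cvg_harmonic.
by apply/eqP; rewrite -normr_le0; apply: cvg_ge_cst lim0 hu.
Qed.

End Weights.

(** * Complex-valued integrals *)

Section ComplexIntegral.
Context {R : realType}.
Local Notation mu := (@lebesgue_measure R).
Local Notation Re := (@complex.Re R).
Local Notation Im := (@complex.Im R).
Implicit Types (f g : R -> R[i]) (z w : R[i]) (t x : R).

Definition ccont f t := {for t, continuous (fun s => Re (f s))} /\ {for t, continuous (fun s => Im (f s))}.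
Definition cint0 f := int0 (fun t => Re (f t)) /\ int0 (fun t => Im (f t)).
Definition cI f : R[i] := I0 (fun t => Re (f t)) +i* I0 (fun t => Im (f t)).
Definition cmfun f := mfun0 (fun t => Re (f t)) /\ mfun0 (fun t => Im (f t)).

Lemma cmfun_cont f : (forall t, 0 < t -> ccont f t) -> cmfun f.
Proof. by move=> h; split; apply: mfun0_cont => t /h[]. Qed.

Lemma cint0_le f (G : R -> R) : cmfun f -> int0 G -> (forall t, 0 < t -> cabs (f t) <= G t) -> cint0 f.
Proof.
move=> [mr mi] iG h; split; [apply: int0_le mr iG _|apply: int0_le mi iG _] => t /h.
  exact/le_trans/Re_le_cabs.
exact/le_trans/Im_le_cabs.
Qed.

Lemma cint0_eq f g : (forall t, 0 < t -> f t = g t) -> cint0 f -> cint0 g.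
Proof. by move=> h [a b]; split; [apply: int0_eq a|apply: int0_eq b] => t /h ->. Qed.

Lemma cI_eq f g : (forall t, 0 < t -> f t = g t) -> cI f = cI g.
Proof. by move=> h; apply: complexP => /=; apply: I0_eq => t /h ->. Qed.

Lemma cint0D f g : cint0 f -> cint0 g -> cint0 (fun t => f t + g t).
Proof.
move=> [fa fb] [ga gb]; split.
  by apply: int0_eq (int0D fa ga) => t _; rewrite ReD.
by apply: int0_eq (int0D fb gb) => t _; rewrite ImD.
Qed.

Lemma cint0Z w f : cint0 f -> cint0 (fun t => w * f t).
Proof.
move=> [fa fb]; split.
  by apply: int0_eq (int0B (int0Z (Re w) fa) (int0Z (Im w) fb)) => t _; rewrite ReM.
by apply: int0_eq (int0D (int0Z (Re w) fb) (int0Z (Im w) fa)) => t _; rewrite ImM.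
Qed.

Lemma cint0_real (h : R -> R) : int0 h -> cint0 (fun t => (h t)%:C).
Proof.
move=> ih; split => //=; apply: (int0_eq _ (int0Z 0 ih)) => t _; exact: mul0r.
Qed.

Lemma cI_real (h : R -> R) : cI (fun t => (h t)%:C) = (I0 h)%:C.
Proof. by apply: complexP => //=; rewrite /I0 /Rintegral integral0. Qed.

Lemma cID f g : cint0 f -> cint0 g -> cI (fun t => f t + g t) = cI f + cI g.
Proof.
move=> [fa fb] [ga gb]; apply: complexP; rewrite ?ReD ?ImD /= -I0D//; apply: I0_eq => t _.
  by rewrite ReD.
by rewrite ImD.
Qed.

Lemma cIZ w f : cint0 f -> cI (fun t => w * f t) = w * cI f.
Proof.
move=> [fa fb]; apply: complexP; rewrite ?ReM ?ImM /= -!I0Z// -?I0D -?I0B//; do ?exact: int0Z.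
  by apply: I0_eq => t _; rewrite ReM.
by apply: I0_eq => t _; rewrite ImM.
Qed.

Lemma cint0N f : cint0 f -> cint0 (fun t => - f t).
Proof. by move/(cint0Z (- 1)); apply: cint0_eq => t _; rewrite mulN1r. Qed.

Lemma cIN f : cint0 f -> cI (fun t => - f t) = - cI f.
Proof. by move=> h; rewrite -[RHS]mulN1r -cIZ//; apply: cI_eq => t _; rewrite mulN1r. Qed.

Lemma cIB f g : cint0 f -> cint0 g -> cI (fun t => f t - g t) = cI f - cI g.
Proof. by move=> hf hg; rewrite cID ?cIN//; exact: cint0N. Qed.

Lemma cabs_cI f (G : R -> R) : cint0 f -> int0 G -> (forall t, 0 < t -> cabs (f t) <= G t) ->
  cabs (cI f) <= I0 G.
Proof.
move=> [fa fb] iG h; have ia := int0_norm fa; have ib := int0_norm fb.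
apply: (@le_trans _ _ (I0 (fun t => `|Re (f t)|) + I0 (fun t => `|Im (f t)|))).
  by apply: lerD; apply: normr_I0_le.
by rewrite -I0D//; apply: le_I0 => //; exact: int0D.
Qed.

Definition ccvg (u : nat -> R[i]) (l : R[i]) :=
  Re (u n) @[n --> \oo] --> Re l /\ Im (u n) @[n --> \oo] --> Im l.

Lemma ccvg_uniq (u v : nat -> R[i]) (l l' : R[i]) : ccvg u l -> ccvg v l' ->
  (forall n, u n = v n) -> l = l'.
Proof.
move=> [a b] [c d] uv; apply: complexP.
  by apply: cvgn_uniq a c _ => n; rewrite uv.
by apply: cvgn_uniq b d _ => n; rewrite uv.
Qed.

Lemma ccvg_ext (u v : nat -> R[i]) (l l' : R[i]) : ccvg v l' -> (forall n, u n = v n) ->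
  l' = l -> ccvg u l.
Proof. by move=> h /funext -> <-. Qed.

Lemma ccvg_cst w : ccvg (fun=> w) w.
Proof. by split; exact: cvg_cst. Qed.

Lemma ccvgD u v (l l' : R[i]) : ccvg u l -> ccvg v l' -> ccvg (fun n => u n + v n) (l + l').
Proof.
move=> [a b] [c d]; split; first by apply: cvgn_ext (cvgD a c) _ _ => [n|]; rewrite ReD.
by apply: cvgn_ext (cvgD b d) _ _ => [n|]; rewrite ImD.
Qed.

Lemma ccvgM u v (l l' : R[i]) : ccvg u l -> ccvg v l' -> ccvg (fun n => u n * v n) (l * l').
Proof.
move=> [a b] [c d]; split.
  by apply: cvgn_ext (cvgB (cvgM a c) (cvgM b d)) _ _ => [n|]; rewrite ReM.
by apply: cvgn_ext (cvgD (cvgM a d) (cvgM b c)) _ _ => [n|]; rewrite ImM.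
Qed.

Lemma ccvg_real (u : nat -> R) (l : R) : u n @[n --> \oo] --> l -> ccvg (fun n => (u n)%:C) l%:C.
Proof. by move=> h; split => //; exact: cvg_cst. Qed.

Lemma ccvg_abs (u : nat -> R[i]) l (e : nat -> R) : e n @[n --> \oo] --> (0 : R) ->
  (forall n, cabs (u n - l) <= e n) -> ccvg u l.
Proof.
move=> e0 h; have aux (v : nat -> R) c : (forall n, `|v n - c| <= e n) -> v n @[n --> \oo] --> c.
  move=> hv; apply/cvgrPdist_le => d d0; move/cvgrPdist_le : e0 => /(_ d d0).
  apply: filterS => n; rewrite sub0r normrN distrC => /(le_trans (ler_norm _)).
  exact: le_trans (hv n).
split; apply: aux => n; apply: le_trans (h n).
  by have := Re_le_cabs (u n - l); rewrite ReD ReN.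
by have := Im_le_cabs (u n - l); rewrite ImD ImN.
Qed.

Lemma cI_dct (fn : nat -> R -> R[i]) f (G : R -> R) : (forall n, cmfun (fn n)) -> int0 G ->
  (forall t, 0 < t -> ccvg (fn ^~ t) (f t)) ->
  (forall n t, 0 < t -> cabs (fn n t) <= G t) ->
  cint0 f /\ ccvg (fun n => cI (fn n)) (cI f).
Proof.
move=> mf iG cf h.
have [] := @I0_dct R (fun n t => Re (fn n t)) (fun t => Re (f t)) G.
- by move=> n; have [] := mf n.
- by [].
- by move=> t /cf[].
- by move=> n t /(h n); exact/le_trans/Re_le_cabs.
move=> ir cr; have [] := @I0_dct R (fun n t => Im (fn n t)) (fun t => Im (f t)) G.
- by move=> n; have [] := mf n.
- by [].
- by move=> t /cf[].
- by move=> n t /(h n); exact/le_trans/Im_le_cabs.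
by move=> ii ci; split.
Qed.

Definition rdc f x (d : R[i]) :=
  rderiv (fun t => Re (f t)) x (Re d) /\ rderiv (fun t => Im (f t)) x (Im d).

Lemma rdc_cont f x d : rdc f x d -> ccont f x.
Proof. by case=> a b; split; [exact: rd_cont a|exact: rd_cont b]. Qed.

Lemma rdc_eq f x d d' : rdc f x d -> d = d' -> rdc f x d'.
Proof. by move=> h <-. Qed.

Lemma rdc_ext f g x d : (forall t, f t = g t) -> rdc f x d -> rdc g x d.
Proof. by move=> /funext ->. Qed.

Lemma rdc_cst w x : rdc (fun=> w) x 0.
Proof. by split; exact: rd_cst. Qed.

Lemma rdc_real (h : R -> R) x d : rderiv h x d -> rdc (fun t => (h t)%:C) x d%:C.
Proof. by move=> dh; split => //; exact: rd_cst. Qed.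

Lemma rdc_add f g x a b : rdc f x a -> rdc g x b -> rdc (fun t => f t + g t) x (a + b).
Proof.
move=> [fa fb] [ga gb]; split.
  by apply: rd_ext (rd_eq (rd_add fa ga) _) => [t|]; rewrite ReD.
by apply: rd_ext (rd_eq (rd_add fb gb) _) => [t|]; rewrite ImD.
Qed.

Lemma rdc_mul f g x a b : rdc f x a -> rdc g x b -> rdc (fun t => f t * g t) x (a * g x + f x * b).
Proof.
move=> [fa fb] [ga gb]; split.
  apply: rd_ext (rd_eq (rd_sub (rd_mul fa ga) (rd_mul fb gb)) _) => [t|]; rewrite ?ReD !ReM//; ring.
apply: rd_ext (rd_eq (rd_add (rd_mul fa gb) (rd_mul fb ga)) _) => [t|]; rewrite ?ImD !ImM//; ring.
Qed.

Lemma ReV z : Re z^-1 = Re z / (Re z ^+ 2 + Im z ^+ 2).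
Proof. by case: z. Qed.

Lemma ImV z : Im z^-1 = - (Im z / (Re z ^+ 2 + Im z ^+ 2)).
Proof. by case: z. Qed.

Lemma sqnorm_gt0 z : z != 0 -> 0 < Re z ^+ 2 + Im z ^+ 2.
Proof.
case: z => a b; rewrite eq_complex /= negb_and => /orP[] h.
  by rewrite ltr_pwDl ?sqr_ge0// exprn_even_gt0.
by rewrite ltr_wpDl ?sqr_ge0// exprn_even_gt0.
Qed.

Lemma rd_div (f g : R -> R) x a b : g x != 0 -> rderiv f x a -> rderiv g x b ->
  rderiv (fun t => f t / g t) x ((a * g x - f x * b) / g x ^+ 2).
Proof.
move=> g0 fa gb; have [c d] := gb; have gV : rderiv (fun t => (g t)^-1) x (- (g x) ^- 2 * b).
  by apply: is_deriveV.
by apply: rd_eq (rd_mul fa gV) _; field.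
Qed.

Lemma rdc_inv f x a : f x != 0 -> rdc f x a -> rdc (fun t => (f t)^-1) x (- a / f x ^+ 2).
Proof.
move=> f0 [fa fb]; have s0 := sqnorm_gt0 f0.
have ds := rd_add (rd_exprn 1 fa) (rd_exprn 1 fb).
have hd : Re (f x) ^+ 2 + Im (f x) ^+ 2 != 0 by rewrite gt_eqF.
rewrite expr2; split.
  apply: rd_ext (rd_eq (@rd_div _ (fun t => Re (f t) ^+ 2 + Im (f t) ^+ 2) _ _ _ hd fa ds) _).
    by move=> t; rewrite ReV.
  rewrite ReM ReN ImN ReV ImV ReM ImM.
  move: (Re (f x)) (Im (f x)) hd s0 => u v hd s0; field.
  rewrite hd andbT (_ : _ + _ = (u ^+ 2 + v ^+ 2) ^+ 2); first exact: expf_neq0.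
  by ring.
apply: rd_ext (rd_eq (rd_opp (@rd_div _ (fun t => Re (f t) ^+ 2 + Im (f t) ^+ 2) _ _ _ hd fb ds)) _).
  by move=> t; rewrite ImV.
rewrite ImM ReN ImN ReV ImV ReM ImM.
move: (Re (f x)) (Im (f x)) hd s0 => u v hd s0; field.
rewrite hd andbT (_ : _ + _ = (u ^+ 2 + v ^+ 2) ^+ 2); first exact: expf_neq0.
  by ring.
Qed.

Lemma rd_I0 (F dF : R -> R -> R) (a u v : R) (G : R -> R) : u < a -> a < v ->
  (forall x, u < x -> x < v -> int0 (F x)) ->
  (forall x t, u < x -> x < v -> 0 < t -> rderiv (F^~ t) x (dF x t)) -> int0 G ->
  (forall x t, u < x -> x < v -> 0 < t -> `|dF x t| <= G t) ->
  rderiv (fun x => I0 (F x)) a (I0 (dF a)).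
Proof.
move=> ua av iF dFF iG dG.
pose g x t := F x t.
have d1E x t : u < x -> x < v -> 0 < t -> partial1of2 F x t = dF x t.
  by move=> h1 h2 h3; rewrite partial1of2E; have [_ ->] := dFF x t h1 h2 h3.
have II x : (`]u, v[%classic : set R) x -> u < x /\ x < v by rewrite /= in_itv/= => /andP.
have Ia : (`]u, v[%classic : set R) a by rewrite /= in_itv/= ua av.
have intF x : (`]u, v[%classic : set R) x -> mu.-integrable pos (EFin \o F x).
  by case/II => *; exact: iF.
have derF x t : (`]u, v[%classic : set R) x -> pos t -> derivable (F ^~ t) x 1.
  by case/II => h1 h2; rewrite posE => h3; have [] := dFF x t h1 h2 h3.
have iGn := int0_norm iG.
have Gub x t : (`]u, v[%classic : set R) x -> pos t -> `|partial1of2 F x t| <= `|G t|.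
  case/II => h1 h2; rewrite posE => h3; rewrite d1E//; exact: le_trans (dG x t h1 h2 h3) (ler_norm _).
have cv := @cvg_differentiation_under_integral R _ _ mu F pos measurable_pos a u v Ia intF derF (fun t => `|G t|) (fun t => normr_ge0 _) iGn Gub.
have e : \int[mu]_(y in pos) partial1of2 F a y = I0 (dF a).
  by apply: I0_eq => t t0; exact: d1E.
rewrite e in cv.
have cv' : h^-1 *: (I0 (F (h *: 1 + a)) - I0 (F a)) @[h --> 0^'] --> I0 (dF a).
  apply: cvg_trans cv; apply: near_eq_cvg; near=> h; by rewrite /GRing.scale/= mulr1.
by split; [exact: cvgP cv'|exact: cvg_lim cv'].
Unshelve. all: by end_near. Qed.

Lemma rdc_cI (F dF : R -> R -> R[i]) (a u v : R) (G : R -> R) : u < a -> a < v ->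
  (forall x, u < x -> x < v -> cint0 (F x)) ->
  (forall x t, u < x -> x < v -> 0 < t -> rdc (F^~ t) x (dF x t)) -> int0 G ->
  (forall x t, u < x -> x < v -> 0 < t -> cabs (dF x t) <= G t) ->
  rdc (fun x => cI (F x)) a (cI (dF a)).
Proof.
move=> ua av iF dFF iG dG; split.
  apply: (@rd_I0 (fun x t => Re (F x t)) (fun x t => Re (dF x t)) a u v G) => //.
  - by move=> x h1 h2; have [] := iF x h1 h2.
  - by move=> x t h1 h2 h3; have [] := dFF x t h1 h2 h3.
  - by move=> x t h1 h2 h3; apply: le_trans (dG x t h1 h2 h3); exact: Re_le_cabs.
apply: (@rd_I0 (fun x t => Im (F x t)) (fun x t => Im (dF x t)) a u v G) => //.
- by move=> x h1 h2; have [] := iF x h1 h2.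
- by move=> x t h1 h2 h3; have [] := dFF x t h1 h2 h3.
- by move=> x t h1 h2 h3; apply: le_trans (dG x t h1 h2 h3); exact: Im_le_cabs.
Qed.

Lemma rd_uniq (f : R -> R) x a b : rderiv f x a -> rderiv f x b -> a = b.
Proof. by move=> [_ <-] [_ <-]. Qed.

Lemma rdc_uniq f x a b : rdc f x a -> rdc f x b -> a = b.
Proof. by move=> [a1 a2] [b1 b2]; apply: complexP; [exact: rd_uniq a1 b1|exact: rd_uniq a2 b2]. Qed.

Lemma rdc_const f a b : (forall t, a <= t -> t <= b -> rdc f t 0) -> a <= b -> f a = f b.
Proof.
move=> df ab; have aux (h : R -> R) : (forall t, a <= t -> t <= b -> rderiv h t 0) -> h a = h b.
  move=> dh; apply/eqP; rewrite eq_le; apply/andP; split; last first.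
    by apply: (mvt_noninc dh) => // t _ _.
  rewrite -lerN2; apply: (@mvt_noninc _ (fun t => - h t) (fun=> - 0) a b) => [t ta tb|t _ _|//]; last by rewrite oppr0.
  exact: rd_opp (dh t ta tb).
apply: complexP; [apply: (aux (fun t => Re (f t)))|apply: (aux (fun t => Im (f t)))];
  by move=> t ta tb; have [] := df t ta tb.
Qed.

Lemma cftc0_zero (f G : R -> R[i]) p q C : 0 < p -> q < 0 ->
  (forall t, 0 < t -> ccont f t) -> (forall t, 0 < t -> rdc G t (f t)) -> cint0 f ->
  (forall t, 0 < t -> t <= 1 -> cabs (G t) <= C * t `^ p) ->
  (forall t, 1 <= t -> cabs (G t) <= C * t `^ q) -> cI f = 0.
Proof.
move=> p0 q0 cf dG [ia ib] h0 h1; apply: complexP => /=.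
  apply: (@ftc0_zero _ (fun t => Re (f t)) (fun t => Re (G t)) p q C) => //.
  - by move=> t /cf[].
  - by move=> t /dG[].
  - by move=> t t0 t1; apply: le_trans (h0 t t0 t1); exact: Re_le_cabs.
  - by move=> t t1; apply: le_trans (h1 t t1); exact: Re_le_cabs.
apply: (@ftc0_zero _ (fun t => Im (f t)) (fun t => Im (G t)) p q C) => //.
- by move=> t /cf[].
- by move=> t /dG[].
- by move=> t t0 t1; apply: le_trans (h0 t t0 t1); exact: Im_le_cabs.
- by move=> t t1; apply: le_trans (h1 t t1); exact: Im_le_cabs.
Qed.

Lemma ccontM f g t : ccont f t -> ccont g t -> ccont (fun s => f s * g s) t.
Proof.
move=> [fa fb] [ga gb]; split.
  rewrite (_ : (fun s => Re (f s * g s)) = fun s => Re (f s) * Re (g s) - Im (f s) * Im (g s)).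
    by apply: cvgB; apply: cvgM.
  by apply/funext => s; rewrite ReM.
rewrite (_ : (fun s => Im (f s * g s)) = fun s => Re (f s) * Im (g s) + Im (f s) * Re (g s)).
  by apply: cvgD; apply: cvgM.
by apply/funext => s; rewrite ImM.
Qed.

Lemma ccont_real (h : R -> R) t : {for t, continuous h} -> ccont (fun s => (h s)%:C) t.
Proof. by move=> ch; split => //; exact: cvg_cst. Qed.

Lemma cexpD w z : cexp (w + z) = cexp w * cexp z.
Proof.
apply: complexP; rewrite ?ReM ?ImM /cexp /= ReD ImD expRD cosD sinD; ring.
Qed.

Lemma cexp0 : cexp (0 : R[i]) = 1.
Proof. by apply: complexP; rewrite /cexp /= ?expR0 ?cos0 ?sin0; ring. Qed.

Lemma cexp_neq0 w : cexp w != 0.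
Proof.
have := cexpD w (- w); rewrite subrr cexp0 => e.
by apply/eqP => h; move: e; rewrite h mul0r => /eqP; rewrite oner_eq0.
Qed.

Lemma rdc_cexp w x : rdc (fun t => cexp (t%:C * w)) x (w * cexp (x%:C * w)).
Proof.
have de : rderiv (fun t => expR (t * Re w)) x (Re w * expR (x * Re w)).
  apply: rd_eq (rd_comp (rd_expR _) (rd_mul (rd_id x) (rd_cst (Re w) x))) _; ring.
have dc : rderiv (fun t => cos (t * Im w)) x (- Im w * sin (x * Im w)).
  apply: rd_eq (rd_comp (rd_cos _) (rd_mul (rd_id x) (rd_cst (Im w) x))) _; ring.
have ds : rderiv (fun t => sin (t * Im w)) x (Im w * cos (x * Im w)).
  apply: rd_eq (rd_comp (rd_sin _) (rd_mul (rd_id x) (rd_cst (Im w) x))) _; ring.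
have hr t : Re (cexp (t%:C * w)) = expR (t * Re w) * cos (t * Im w) by rewrite /cexp ReZ ReZ ImZ.
have hi t : Im (cexp (t%:C * w)) = expR (t * Re w) * sin (t * Im w) by rewrite /cexp ImZ ReZ ImZ.
split.
  apply: (rd_ext _ (rd_eq (rd_mul de dc) _)) => [t|]; first by rewrite hr.
  by rewrite ReM hr hi; ring.
apply: (rd_ext _ (rd_eq (rd_mul de ds) _)) => [t|]; first by rewrite hi.
by rewrite ImM hr hi; ring.
Qed.

End ComplexIntegral.

(** * Recurrence in the first order *)

Section Kernel.
Context {R : realType}.
Local Notation Re := (@complex.Re R).
Local Notation Im := (@complex.Im R).
Implicit Types (f g : R -> R[i]) (z w : R[i]) (t x m n : R).

Lemma normc_sqr z : Normc.normc z ^+ 2 = Re z ^+ 2 + Im z ^+ 2.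
Proof. by case: z => a b; rewrite /= sqr_sqrtr// addr_ge0// sqr_ge0. Qed.

Lemma normc_ge0 z : 0 <= Normc.normc z.
Proof. by case: z => a b; exact: sqrtr_ge0. Qed.

Lemma normc_gt0 z : z != 0 -> 0 < Normc.normc z.
Proof.
move=> /sqnorm_gt0; rewrite -normc_sqr => h; rewrite lt_def normc_ge0 andbT.
by apply: contraTneq h => ->; rewrite expr0n ltxx.
Qed.

Lemma Re_normc z : `|Re z| <= Normc.normc z.
Proof.
rewrite -ler_sqr ?nnegrE ?normc_ge0// real_normK ?num_real// normc_sqr.
by rewrite lerDl sqr_ge0.
Qed.

(** With r = |z| and c = Re z, the difference of the sides is (r - c)(r - t)^2. The factor r + c = r
    (1 + cos arg z) is positive off the negative axis, so this quantifies the distance from z to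
    -t. *)
Lemma slit_lb z t : 0 <= t ->
  (Normc.normc z + Re z) * (Normc.normc z + t) ^+ 2 <=
  2 * Normc.normc z * (Re (z + t%:C) ^+ 2 + Im (z + t%:C) ^+ 2).
Proof.
move=> t0; have h := normc_sqr z; have := normc_ge0 z; have := Re_normc z.
rewrite ReD ImD /= addr0; move: (Normc.normc z) (Re z) (Im z) h => r c s h rc r0.
have cr : c <= r by exact: le_trans (ler_norm _) rc.
rewrite -subr_ge0 (_ : _ - _ = (r - c) * (r - t) ^+ 2); last first.
  by have -> : s ^+ 2 = r ^+ 2 - c ^+ 2 by [rewrite h; ring]; ring.
by rewrite mulr_ge0 ?sqr_ge0// subr_ge0.
Qed.

Lemma cabsV_le w (k : R) : 0 < k -> k ^+ 2 <= Re w ^+ 2 + Im w ^+ 2 -> cabs w^-1 <= 2 / k.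
Proof.
move=> k0 h; rewrite /cabs ReV ImV normrN.
set N := _ + _ in h *; have N0 : 0 < N by apply: lt_le_trans h; rewrite exprn_gt0.
have aux (u : R) : u ^+ 2 <= N -> `|u / N| <= k^-1.
  move=> uN; rewrite normrM normfV (gtr0_norm N0) ler_pdivrMr// mulrC ler_pdivlMr//.
  rewrite -ler_sqr ?nnegrE ?mulr_ge0 ?(ltW k0) ?(ltW N0)// exprMn real_normK ?num_real//.
  by rewrite [leRHS]expr2; apply: ler_pM; rewrite ?sqr_ge0.
rewrite (_ : 2 / k = k^-1 + k^-1); last by field; rewrite gt_eqF.
by apply: lerD; apply: aux; rewrite /N ?lerDl ?lerDr sqr_ge0.
Qed.

Definition kz z t : R[i] := (z + t%:C)^-1.

(** The bound is uniform over a sector 1 + cos arg z >= c away from 0, since it has to hold along a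
    whole path of values of z. *)
Lemma kz_unif (r1 c : R) : 0 < r1 -> 0 < c -> exists2 C : R, 0 <= C & forall z t,
  r1 <= Normc.normc z -> c * Normc.normc z <= Normc.normc z + Re z -> 0 < t ->
  z + t%:C != 0 /\ cabs (kz z t) <= C * (1 + t) `^ (-1).
Proof.
move=> r10 c0; pose d := Num.min 1 r1; have d0 : 0 < d by rewrite lt_min ltr01.
pose k := Num.sqrt (c / 2) * d; have k0 : 0 < k by rewrite mulr_gt0// sqrtr_gt0 divr_gt0.
exists (2 / k) => [|z t rz cz t0]; first by rewrite divr_ge0// ltW.
have n0 : 0 < Normc.normc z by exact: lt_le_trans rz.
have kt : 0 < k * (1 + t) by rewrite mulr_gt0//; lra.
have h : (k * (1 + t)) ^+ 2 <= Re (z + t%:C) ^+ 2 + Im (z + t%:C) ^+ 2.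
  rewrite !exprMn sqr_sqrtr ?divr_ge0 ?(ltW c0)//.
  have := slit_lb z (ltW t0); move: (_ + Im _ ^+ 2) => N hN.
  have h1 : d * (1 + t) <= Normc.normc z + t.
    have d1 : d <= 1 by rewrite ge_min lexx.
    have d2 : d <= Normc.normc z by rewrite (le_trans _ rz)// ge_min lexx orbT.
    rewrite mulrDr mulr1; apply: lerD => //; by rewrite ler_piMl// ltW.
  have h2 : (d * (1 + t)) ^+ 2 <= (Normc.normc z + t) ^+ 2.
    by rewrite ler_sqr ?nnegrE// ?mulr_ge0 ?(ltW d0)//; lra.
  rewrite -mulrA -exprMn mulrAC ler_pdivrMr// -(ler_pM2r n0).
  apply: (@le_trans _ _ (c * Normc.normc z * (Normc.normc z + t) ^+ 2)).
    by rewrite mulrAC ler_wpM2l// mulr_ge0// ltW.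
  rewrite (_ : N * 2 * _ = 2 * Normc.normc z * N); last by ring.
  by apply: le_trans hN; rewrite ler_wpM2r ?sqr_ge0.
split; last first.
  apply: le_trans (cabsV_le kt h) _; rewrite powRN powRr1; last by lra.
  by rewrite invfM mulrA.
apply/eqP => e; move: h; rewrite e expr0n addr0 leNgt exprn_gt0//.
Qed.

Variable L : R[i].
Hypothesis L_pi : `|Im L| < pi.
(** Working with z = exp L and |Im L| < pi makes every principal power of z an exponential exp(x L),
    with no branch to choose. *)
Let z := cexp L.

Lemma normc_cexp w : Normc.normc (cexp w) = expR (Re w).
Proof.
apply/eqP; rewrite -(@eqrXn2 _ 2) ?normc_ge0 ?expR_ge0//.
by apply/eqP; rewrite normc_sqr /cexp ReZ ImZ /= !exprMn -mulrDr cos2Dsin2 mulr1.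
Qed.

Lemma Re_cexp w : Re (cexp w) = expR (Re w) * cos (Im w).
Proof. by rewrite /cexp ReZ. Qed.

Lemma cos_gtN1 x : `|x| < pi -> 0 < 1 + cos x.
Proof.
move=> xp; have : cos pi < cos `|x|.
  by rewrite ltr_cos// in_itv/= ?normr_ge0 ?pi_ge0 ?lexx ?(ltW xp).
by rewrite cospi cos_norm; lra.
Qed.

Lemma kz_bound : exists2 C : R, 0 <= C & forall t, 0 < t ->
  z + t%:C != 0 /\ cabs (kz z t) <= C * (1 + t) `^ (-1).
Proof.
have [C C0 hC] := kz_unif (expR_gt0 (Re L)) (cos_gtN1 L_pi).
exists C => // t t0; apply: hC => //; rewrite normc_cexp// Re_cexp; lra.
Qed.

Lemma kz_neq0 t : 0 < t -> z + t%:C != 0.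
Proof. by have [C _ h] := kz_bound => /h[]. Qed.

Lemma rdc_kz t : 0 < t -> rdc (kz z) t (- kz z t ^+ 2).
Proof.
move=> t0; apply: rdc_eq (rdc_inv (kz_neq0 t0) (rdc_add (rdc_cst z t) (rdc_real (rd_id t)))) _.
by rewrite add0r mulN1r /kz exprVn.
Qed.

Lemma ccont_kz t : 0 < t -> ccont (kz z) t.
Proof. by move=> t0; exact: rdc_cont (rdc_kz t0). Qed.

Lemma mul_kz t : 0 < t -> t%:C * kz z t = 1 - z * kz z t.
Proof.
move=> t0; have h := kz_neq0 t0.
by apply/eqP; rewrite eq_sym subr_eq -mulrDl addrC /kz mulfV.
Qed.

Lemma cint0_kz (h : R -> R) p q C : -1 < p -> p + q < 0 ->
  (forall t, 0 < t -> {for t, continuous h}) ->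
  (forall t, 0 < t -> `|h t| <= C * wt p q t) -> cint0 (fun t => (h t)%:C * kz z t).
Proof.
move=> p1 pq ch hC; have [K K0 hK] := kz_bound.
apply: (@cint0_le _ _ (fun t => C * K * wt p (q - 1) t)).
- by apply: cmfun_cont => t t0; apply: ccontM; [apply/ccont_real/ch|exact: ccont_kz].
- by apply/int0Z/int0_wt => //; lra.
- move=> t t0; rewrite cabsZ; have [_ h2] := hK t t0.
  rewrite (_ : _ * wt _ _ _ = (C * wt p q t) * (K * (1 + t) `^ (-1))).
    by apply: ler_pM => //; [exact: cabs_ge0|exact: hC].
  by rewrite /wt powRDx; [ring|lra].
Qed.

Definition Fi m n (a b : R) := cI (fun t => (t `^ n * (em m (a * t) * em n (b * t)))%:C * kz z t).

Lemma cint0_Fi m n p (a b : R) : 0 < a -> 0 < b -> -1 < p -> p - (m + n + 1) / 2 < 0 ->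
  cint0 (fun t => (t `^ p * (em m (a * t) * em n (b * t)))%:C * kz z t).
Proof.
move=> a0 b0 p1 pq; have [C C0 hC] := @em_prod_wt _ m n p a a b b a0 b0.
apply: (@cint0_kz _ p (- ((m + n + 1) / 2)) C) => // t t0; first exact: cont_wemem.
exact: hC.
Qed.

(** Combines [emS] with t/(z+t) = 1 - z/(z+t). The 1 leaves [Wi] of orders m + 1 and n, zero by
    [Wi0] because a < b and n < m. *)
Lemma Fi_rec m n (a b : R) : 0 < a -> a < b -> -1 < n -> n < m ->
  Fi (m - 1) n a b = m%:C * Fi m n a b + a%:C * z * Fi (m + 1) n a b.
Proof.
move=> a0 ab n1 nm; have b0 : 0 < b by exact: lt_trans ab.
have i1 : cint0 (fun t => (t `^ n * (em m (a * t) * em n (b * t)))%:C * kz z t).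
  by apply: cint0_Fi => //; lra.
have i2 : cint0 (fun t => (t `^ n * (em (m + 1) (a * t) * em n (b * t)))%:C * kz z t).
  by apply: cint0_Fi => //; lra.
have i3 : cint0 (fun t => (t `^ n * (em (m + 1) (a * t) * em n (b * t)))%:C).
  by apply/cint0_real/int0_wemem => //; lra.
have w0 : cI (fun t => (t `^ n * (em (m + 1) (a * t) * em n (b * t)))%:C) = 0.
  by rewrite cI_real -/(Wi (m + 1) n a b) Wi0//; lra.
transitivity (m%:C * Fi m n a b + a%:C * z * Fi (m + 1) n a b -
  a%:C * cI (fun t => (t `^ n * (em (m + 1) (a * t) * em n (b * t)))%:C)); last first.
  by rewrite w0 mulr0 subr0.
rewrite /Fi -!cIZ// -cID; [|exact: cint0Z|exact: cint0Z].
rewrite -cIB; [|by apply: cint0D; exact: cint0Z|exact: cint0Z].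
apply: cI_eq => t t0; rewrite emS; have := mul_kz t0.
rewrite mulrBl mulrBr !rmorphM !rmorphB !rmorphM /=.
set T := t%:C; set A := (em m _)%:C; set B := (em (m + 1) _)%:C; set E := (em n _)%:C.
move: (kz z t) => K hK.
rewrite mulrBl.
have -> : (t `^ n)%:C * (a%:C * T * B * E) * K = (t `^ n)%:C * a%:C * B * E * (T * K) by ring.
by rewrite hK; ring.
Qed.

End Kernel.

(** Transitivity of equality of fractions in cross-multiplied form; only the middle denominator has
    to be nonzero. *)
Lemma cross_step (F : fieldType) (p q p' q' P Q : F) : q != 0 -> p * Q = P * q ->
  p * q' = p' * q -> p' * Q = P * q'.
Proof. by move=> q0 h e; apply: (mulIf q0); rewrite mulrAC -e mulrAC h mulrAC. Qed.

(** * Large first order: proportionality of F_{m,n} and E_m *)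

Section LargeOrder.
Context {R : realType}.
Local Notation Re := (@complex.Re R).
Local Notation Im := (@complex.Im R).
Implicit Types (z w c : R[i]) (t x m n y : R).

(** Downwards the recurrence expresses each term by the next two, so agreement for large indices
    propagates to all without any division. *)
Lemma rec_descend (x : nat -> R[i]) w c (A B : nat -> R[i]) K :
  (forall k, A k = x k * A k.+1 + w * A k.+2) ->
  (forall k, B k = x k * B k.+1 + w * B k.+2) ->
  (forall k, (K <= k)%N -> A k = c * B k) -> forall k, A k = c * B k.
Proof.
move=> rA rB; elim: K => [h k|K IH h]; first exact: h.
apply: IH => k; rewrite leq_eqVlt => /predU1P[<-|]; last exact: h.
by rewrite rA rB !h ?leqnSn//; ring.
Qed.

Lemma Ec_ratio (m0 : R) w : 0 <= m0 ->
  ccvg (fun k => ((rgamma (m0 + k%:R + 1))^-1)%:C * Ec (m0 + k%:R) w) 1.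
Proof.
move=> m00; apply: (@ccvg_abs _ _ _ (fun k => 2 * expR (cabs w) * k.+1%:R^-1)).
  have l0 : 2 * expR (cabs w) * 0 = 0 by rewrite mulr0.
  by apply: (cvgn_ext _ (fun=> erefl) l0); apply: cvgM; [exact: cvg_cst|exact: cvg_harmonic].
move=> k; have k0 : 0 <= k%:R :> R by [].
have g0 : 0 < rgamma (m0 + k%:R + 1) by apply: rgamma_gt0; lra.
have h := @Ec_large R (m0 + k%:R) w ltac:(lra).
set g := rgamma _ in g0 h *; set E := Ec _ _ in h *.
have -> : (g^-1)%:C * E - 1 = (g^-1)%:C * (E - g%:C).
  by rewrite mulrBr -rmorphM mulVf ?gt_eqF.
rewrite cabsZ gtr0_norm ?invr_gt0// mulrC ler_pdivrMr//.
apply: le_trans h _; rewrite mulrAC -[leRHS]mulrA [leRHS]mulrC [leRHS]mulrC.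
have -> : 2 * expR (cabs w) * (k.+1%:R^-1 * g) = 2 * expR (cabs w) * (g / k.+1%:R) by rewrite [_ * g]mulrC.
rewrite ler_wpM2l//.
by rewrite ler_wpM2l ?(ltW g0)// lef_pV2 ?posrE -?natr1; lra.
Qed.

Lemma em_ratio (m0 : R) y : 0 <= m0 ->
  (rgamma (m0 + k%:R + 1))^-1 * em (m0 + k%:R) y @[k --> \oo] --> (1 : R).
Proof.
move=> m00; have [h _] := Ec_ratio (- y)%:C m00.
by apply: cvgn_ext h _ erefl => k; rewrite emC -rmorphM.
Qed.

Variable L : R[i].
Hypothesis L_pi : `|Im L| < pi.
Let z := cexp L.

Definition Cn n (b : R) := cI (fun t => (t `^ n * em n (b * t))%:C * kz z t).

Section negative_order.
Variables (n a b : R).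
Hypotheses (n1 : -1 < n) (n0 : n < 0) (a0 : 0 < a) (b0 : 0 < b) (ab : a < b).

(** One majorant for every first order: n < 0 makes t^n e_n(bt)/(z+t) integrable by itself, and
    [em1] bounds the normalised e_m by 1. *)
Let dom : exists G : R -> R, int0 G /\ forall t, 0 < t ->
  cabs ((t `^ n * em n (b * t))%:C * kz z t) <= G t.
Proof.
have [K K0 hK] := kz_bound L_pi; have [C C0 hC] := em_wt n b b0.
exists (fun t => C * K * wt n (- (n / 2) - 4^-1 - 1) t); split.
  by apply/int0Z/int0_wt => //; move: (n1) (n0); lra.
move=> t t0 /=; have [_ h] := hK t t0; have h2 := hC b t (lexx _) (lexx _) t0.
rewrite cabsZ normrM (ger0_norm (powR_ge0 _ _)) -[leLHS]mulrA.
have t1 : 0 < 1 + t by lra.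
have -> : C * K * wt n (- (n / 2) - 4^-1 - 1) t = t `^ n * ((C * (1 + t) `^ (- (n / 2) - 4^-1)) * (K * (1 + t) `^ (-1))).
  by rewrite /wt (powRDx _ (-1) t1); ring.
rewrite ler_wpM2l ?powR_ge0//; apply: ler_pM => //; exact: cabs_ge0.
Qed.

Let em1 m y : 0 <= m -> 0 < y -> `|(rgamma (m + 1))^-1 * em m y| <= 1.
Proof.
move=> m0 y0; have g0 : 0 < rgamma (m + 1) by apply: rgamma_gt0; lra.
rewrite normrM gtr0_norm ?invr_gt0// mulrC ler_pdivrMr// mul1r.
by apply: em_le; rewrite ?(ltW y0)//; lra.
Qed.

Let ratioE m : 0 <= m ->
  ((rgamma (m + 1))^-1)%:C * Fi L m n a b =
  cI (fun t => ((rgamma (m + 1))^-1 * em m (a * t))%:C * ((t `^ n * em n (b * t))%:C * kz z t)).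
Proof.
move=> m0; rewrite /Fi -cIZ; last by apply: cint0_Fi => //; move: (n0) m0; lra.
by apply: cI_eq => t t0; rewrite !rmorphM /=; ring.
Qed.

Let cmf m : cmfun (fun t => ((rgamma (m + 1))^-1 * em m (a * t))%:C * ((t `^ n * em n (b * t))%:C * kz z t)).
Proof.
apply: cmfun_cont => t t0; apply: ccontM.
  by apply: ccont_real; apply: cvgM; [exact: cvg_cst|exact: cont_em_scale].
apply: ccontM; last exact: ccont_kz.
by apply: ccont_real; apply: cvgM; [exact: cont_powR|exact: cont_em_scale].
Qed.

Lemma Fi_lim (m0 : R) : 0 <= m0 ->
  ccvg (fun k => ((rgamma (m0 + k%:R + 1))^-1)%:C * Fi L (m0 + k%:R) n a b) (Cn n b).
Proof.
move=> m00; have [G [iG hG]] := dom.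
have mk k : 0 <= m0 + k%:R :> R by rewrite addr_ge0.
have [| | |_ h] := @cI_dct R (fun k t => ((rgamma (m0 + k%:R + 1))^-1 * em (m0 + k%:R) (a * t))%:C *
   ((t `^ n * em n (b * t))%:C * kz z t)) (fun t => (t `^ n * em n (b * t))%:C * kz z t) G _ iG.
- by move=> k; exact: cmf.
- move=> t t0; apply: ccvg_ext (ccvgM (ccvg_real (em_ratio (a * t) m00)) (ccvg_cst _)) (fun=> erefl) _.
  by rewrite mul1r.
- move=> k t t0; apply: le_trans _ (hG t t0); rewrite [leLHS]cabsZ ler_piMl ?cabs_ge0//.
  by apply: em1 => //; exact: mulr_gt0.
by apply: ccvg_ext h _ erefl => k; rewrite ratioE.
Qed.

Lemma Fi_bound : exists2 J : R, 0 <= J & forall m, 0 <= m ->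
  cabs (Fi L m n a b) <= rgamma (m + 1) * J.
Proof.
have [G [iG hG]] := dom; exists (I0 G).
  by apply: I0_ge0 => t t0; exact: le_trans (cabs_ge0 _) (hG t t0).
move=> m m0; have g0 : 0 < rgamma (m + 1) by apply: rgamma_gt0; lra.
have h t : 0 < t -> cabs (((rgamma (m + 1))^-1 * em m (a * t))%:C *
   ((t `^ n * em n (b * t))%:C * kz z t)) <= G t.
  move=> t0; apply: le_trans _ (hG t t0); rewrite [leLHS]cabsZ ler_piMl ?cabs_ge0//.
  by apply: em1 => //; exact: mulr_gt0.
have := cabs_cI (cint0_le (cmf m) iG h) iG h; rewrite -ratioE// cabsZ.
by rewrite gtr0_norm ?invr_gt0// mulrC ler_pdivrMr// mulrC.
Qed.

Lemma Fi_negative (m : R) : n - 1 < m -> Fi L m n a b = Cn n b * Ec m (a%:C * z).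
Proof.
move=> nm; set w := a%:C * z.
have w0 : w != 0 by rewrite mulf_neq0 ?cexp_neq0// eq_complex /= eqxx andbT gt_eqF.
(* From index j + 1 on the order is nonnegative, where [Fi_bound], [Fi_lim] and [Ec_ratio] apply. *)
pose j := Num.truncn `|m|; pose m0 := m + j.+1%:R.
have m00 : 0 <= m0.
  have := truncnS_gt `|m|; have := ler_norm (- m); rewrite normrN /m0 -/j; lra.
pose A k := Fi L (m + k%:R) n a b; pose B k := Ec (m + k%:R) w.
have rA k : A k = (m + k.+1%:R)%:C * A k.+1 + w * A k.+2.
  have k0 : 0 <= k%:R :> R by [].
  rewrite /A -[k.+2%:R]natr1 addrA -Fi_rec//; last by rewrite -natr1; lra.
  by rewrite -natr1 addrA addrK.
have rB k : B k = (m + k.+1%:R)%:C * B k.+1 + w * B k.+2.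
  by rewrite /B -[k.+2%:R]natr1 addrA -EcS -natr1 addrA addrK.
(* Casoratian of the two solutions; one step upwards divides it by -w. *)
pose D k := A k * B k.+1 - A k.+1 * B k.
have rD k : D k = - w * D k.+1 by rewrite /D (rA k) (rB k); ring.
pose g k := rgamma (m0 + k%:R + 1).
have gp k : 0 < g k by apply: rgamma_gt0; have : 0 <= k%:R :> R by []; lra.
have mj k : m + (j.+1 + k)%:R = m0 + k%:R by rewrite natrD addrA.
have gfact k : g k <= g 0 / k`!%:R.
  by rewrite /g addr0 addrAC; apply: rgamma_fact; lra.
have gS k : g k.+1 <= g 0 / k`!%:R.
  apply: le_trans (gfact _) _; rewrite ler_wpM2l ?(ltW (gp _))// lef_pV2 ?posrE ?ltr0n ?fact_gt0//.
  by rewrite ler_nat leq_fact.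
have [J J0 hJ] := Fi_bound.
have [C C0 hC] := rgamma_bound m0.
have bB k : cabs (B (j.+1 + k)%N) <= 2 * C * expR (cabs w).
  by apply: cabs_Ec => i; rewrite mj -(addrA m0) -natrD.
have bA k : cabs (A (j.+1 + k)%N) <= g k * J.
  by rewrite /A mj; apply: hJ; rewrite addr_ge0.
(* Going up k steps costs a factor |w|^k, whereas [Fi_bound] makes the Casoratian O(1/k!). *)
have D0 i : D (j.+1 + i)%N = 0.
  pose M := 2 * (g 0 * J) * (2 * C * expR (cabs w)).
  have bD k : cabs (D (j.+1 + k)%N) <= M / k`!%:R.
    have -> : M / k`!%:R = (g 0 / k`!%:R * J) * (2 * C * expR (cabs w)) + (g 0 / k`!%:R * J) * (2 * C * expR (cabs w)) by rewrite /M; ring.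
    apply: le_trans (cabsB _ _) _; apply: lerD.
      apply: le_trans (cabsM _ _) _; apply: ler_pM; rewrite ?cabs_ge0 -?addnS//.
      by apply: le_trans (bA _) _; rewrite ler_wpM2r.
    apply: le_trans (cabsM _ _) _; apply: ler_pM; rewrite ?cabs_ge0 -?addnS//.
    by apply: le_trans (bA _) _; rewrite ler_wpM2r.
  have Dk k : D (j.+1 + i)%N = (- w) ^+ k * D (j.+1 + i + k)%N.
    elim: k => [|k IH]; first by rewrite addn0 mul1r.
    by rewrite IH rD exprSr addnS mulrA.
  have M0 : 0 <= M by rewrite !mulr_ge0 ?expR_ge0// ltW.
  apply: cabs_eq0; apply/eqP; rewrite eq_le cabs_ge0 andbT.
  have lim : M * (cabs w ^+ k / k`!%:R) @[k --> \oo] --> (0 : R).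
    have l0 : M * 0 = 0 by rewrite mulr0.
    by apply: (cvgn_ext _ (fun=> erefl) l0); apply: cvgM; [exact: cvg_cst|exact: cvg_exp_coeff].
  apply: cvg_ge_cst lim _ => k; rewrite (Dk k).
  apply: le_trans (cabsM _ _) _; rewrite mulrCA; apply: ler_pM; rewrite ?cabs_ge0//.
    by rewrite -(cabsN w) cabsX.
  rewrite -addnA; apply: le_trans (bD _) _; rewrite ler_wpM2l// lef_pV2 ?posrE ?ltr0n ?fact_gt0//.
  by rewrite ler_nat leq_fact ?leq_addl.
have limB : ccvg (fun k => ((g k)^-1)%:C * B (j.+1 + k)%N) 1.
  by apply: ccvg_ext (Ec_ratio w m00) _ erefl => k; rewrite /B mj.
have limA : ccvg (fun k => ((g k)^-1)%:C * A (j.+1 + k)%N) (Cn n b).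
  by apply: ccvg_ext (Fi_lim m00) _ erefl => k; rewrite /A mj.
(* The normalised B tends to 1, so it is eventually nonzero and [cross_step] can be iterated. *)
have [K hK] : exists K, forall k, (K <= k)%N -> B (j.+1 + k)%N != 0.
  have [/cvgrPdist_lt /(_ 1 ltr01)[K _ hK] _] := limB.
  exists K => k /hK /=; apply: contraTneq => ->; by rewrite mulr0 subr0 normr1 ltxx.
(* Vanishing Casoratians give A_{k+i} B_k = A_k B_{k+i}; dividing by g at k + i and letting i tend
   to infinity identifies the ratio as C_n. *)
have key k : (K <= k)%N -> A (j.+1 + k)%N = Cn n b * B (j.+1 + k)%N.
  move=> Kk.
  have cross i : A (j.+1 + (k + i))%N * B (j.+1 + k)%N = A (j.+1 + k)%N * B (j.+1 + (k + i))%N.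
    elim: i => [|i IH]; first by rewrite addn0.
    have Bi : B (j.+1 + (k + i))%N != 0 by apply: hK; rewrite (leq_trans Kk)// leq_addr.
    have := D0 (k + i); rewrite /D -!addnS => /eqP; rewrite subr_eq0 => /eqP e.
    exact: cross_step Bi IH e.
  have sh (u : nat -> R[i]) l : ccvg u l -> ccvg (fun i => u (k + i)%N) l.
    move=> [u1 u2]; split.
      have := u1; rewrite -(cvg_shiftn k) => h; apply: cvgn_ext h _ erefl => i; by rewrite addnC.
    have := u2; rewrite -(cvg_shiftn k) => h; apply: cvgn_ext h _ erefl => i; by rewrite addnC.
  have c1 := ccvgM (sh _ _ limA) (ccvg_cst (B (j.+1 + k)%N)).
  have c2 := ccvgM (ccvg_cst (A (j.+1 + k)%N)) (sh _ _ limB).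
  have := ccvg_uniq c2 c1; rewrite mulr1; apply => i /=.
  by rewrite -[RHS]mulrA cross mulrCA.
have := @rec_descend (fun k => (m + k.+1%:R)%:C) w (Cn n b) A B (j.+1 + K)%N rA rB.
have hk k : (j.+1 + K <= k)%N -> A k = Cn n b * B k.
  move=> h; have -> : k = (j.+1 + (k - j.+1))%N by rewrite subnKC// (leq_trans _ h)// leq_addr.
  by apply: key; rewrite leq_subRL// (leq_trans _ h)// leq_addr.
by move=> /(_ hk 0%N); rewrite /A /B addr0.
Qed.

End negative_order.

End LargeOrder.

(** * Mellin moments of the Taylor remainders *)

Section LaplaceBessel.
Context {R : realType}.
Local Notation mu := (@lebesgue_measure R).
Implicit Types (t s x m n y : R).

Definition Phi m t := I0 (fun s => s `^ m * em m (t * s) * expR (- s)).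

Lemma int0_powR_exp p : -1 < p -> int0 (fun s : R => s `^ p * expR (- s)).
Proof.
move=> p1; apply: int0_eq (int0_powR_expR p1 ltr01) => s _; by rewrite mul1r.
Qed.

Lemma I0_powR_exp p : -1 < p -> I0 (fun s : R => s `^ p * expR (- s)) = Gam (p + 1).
Proof. by move=> p1; rewrite /Gam addrK. Qed.

Lemma em_le0 m y : 0 <= m -> 0 <= y -> `|em m y| <= rgamma (m + 1).
Proof. by move=> m0 y0; apply: em_le => //; lra. Qed.

Lemma Phi_dom m t s : 0 <= m -> 0 < t -> 0 < s ->
  `|s `^ m * em m (t * s) * expR (- s)| <= rgamma (m + 1) * (s `^ m * expR (- s)).
Proof.
move=> m0 t0 s0; rewrite 2!normrM (ger0_norm (powR_ge0 _ _)) (ger0_norm (expR_ge0 _)) mulrA.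
rewrite ler_wpM2r ?expR_ge0// mulrC ler_wpM2r ?powR_ge0//.
by apply: em_le0 => //; rewrite mulr_ge0 ?ltW.
Qed.

Lemma Phi_cont m t s : 0 < t -> 0 < s ->
  {for s, continuous (fun s => s `^ m * em m (t * s) * expR (- s))}.
Proof.
move=> t0 s0; apply: cvgM; last exact: cont_exprN.
by apply: cvgM; [exact: cont_powR|exact: cont_em_scale].
Qed.

Lemma int0_Phi m t : 0 <= m -> 0 < t -> int0 (fun s => s `^ m * em m (t * s) * expR (- s)).
Proof.
move=> m0 t0; apply: (int0_le _ (int0Z (rgamma (m + 1)) (@int0_powR_exp m ltac:(lra)))).
  by apply: mfun0_cont => s s0; exact: Phi_cont.
by move=> s s0; exact: Phi_dom.
Qed.

(** The difference of the two integrands is the derivative in s of s^(m+1) e_{m+1}(ts) exp(-s). *)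
Lemma PhiS m t : 0 <= m -> 0 < t -> Phi (m + 1) t = Phi m t.
Proof.
move=> m0 t0; have m1 : 0 <= m + 1 by lra.
have g0 : 0 < rgamma (m + 1 + 1) by apply: rgamma_gt0; lra.
have [C C0 hC] := @powR_expR_decay R (m + 1) 1 (-1) ltr01.
apply/eqP; rewrite eq_sym -subr_eq0 /Phi -I0B; [|exact: int0_Phi|exact: int0_Phi].
apply/eqP; apply: (@ftc0_zero _ _ (fun s => s `^ (m + 1) * em (m + 1) (t * s) * expR (- s))
  (m + 1) (-1) (rgamma (m + 1 + 1) * (1 + C))); [lra|lra| | | | |].
- by move=> s s0; apply: cvgB; exact: Phi_cont.
- move=> s s0; apply: rd_eq (rd_mul (rd_powR_em m t s0) (rd_comp (rd_expR _) (rd_opp (rd_id s)))) _.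
  by rewrite mulrN1 mulrN.
- by apply: int0B; exact: int0_Phi.
- move=> s s0 s1; apply: le_trans (Phi_dom m1 t0 s0) _.
  rewrite -(mulrA (rgamma _)) ler_wpM2l ?(ltW g0)// mulrC ler_wpM2r ?powR_ge0//.
  have : expR (- s) <= 1 by rewrite -expR0 ler_expR oppr_le0 ltW.
  by move: (expR _) => u; lra.
- move=> s s1; have s0 : 0 < s by exact: lt_le_trans s1.
  apply: le_trans (Phi_dom m1 t0 s0) _.
  rewrite -(mulrA (rgamma _)) ler_wpM2l ?(ltW g0)//.
  have := hC s s1; rewrite mul1r => /le_trans; apply.
  by rewrite ler_wpM2r ?powR_ge0// lerDr.
Qed.

Lemma rd_Phi m t : 0 <= m -> 0 < t -> rderiv (Phi m) t (- Phi m t).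
Proof.
move=> m0 t0; rewrite -(PhiS m0 t0) /Phi.
have m1 : 0 <= m + 1 by lra.
apply: rd_eq (@rd_I0 _ (fun t s => s `^ m * em m (t * s) * expR (- s))
  (fun t s => - (s `^ (m + 1) * em (m + 1) (t * s) * expR (- s))) t 0 (t + 1)
  (fun s => rgamma (m + 1 + 1) * (s `^ (m + 1) * expR (- s))) t0 _ _ _ _ _) _.
- lra.
- by move=> x x0 _; exact: int0_Phi.
- move=> x s x0 _ s0.
  have d := @rd_comp _ (em m) (fun x => x * s) x _ _ (rd_em m (x * s)) (rd_mul (rd_id x) (rd_cst s x)).
  apply: rd_eq (rd_mul (rd_mul (rd_cst (s `^ m) x) d) (rd_cst (expR (- s)) x)) _.
  rewrite (@powR_eqD _ s m 1 (m + 1) s0)// powRr1 ?(ltW s0)//; ring.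
- by apply/int0Z/int0_powR_exp; lra.
- by move=> x s x0 _ s0; rewrite normrN; exact: Phi_dom.
- rewrite -mulN1r -I0Z; last exact: int0_Phi.
  by apply: I0_eq => s _; rewrite mulN1r.
Qed.

(** By [PhiS], differentiation in t gives Phi' = -Phi, so Phi(t) exp(t) is constant. Its value is
    read off along t/(k+1), where the integral tends to Gamma(m+1)/Gamma(m+1) = 1. *)
Lemma PhiE m t : 0 <= m -> 0 < t -> Phi m t = expR (- t).
Proof.
move=> m0 t0; have g0 : 0 < rgamma (m + 1) by apply: rgamma_gt0; lra.
pose h x := Phi m x * expR x.
have dh x : 0 < x -> rderiv h x 0.
  move=> x0; apply: rd_eq (rd_mul (rd_Phi m0 x0) (rd_expR x)) _; ring.
have hc x y : 0 < x -> x <= y -> h x = h y.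
  move=> x0 xy; suff: (h x)%:C = (h y)%:C :> R[i] by move/complexI.
  apply: (@rdc_const _ (fun x => (h x)%:C) x y) => // s xs _.
  by apply: rdc_eq (rdc_real (dh s _)) _; first exact: lt_le_trans xs.
have tn k : 0 < t / k.+1%:R by rewrite divr_gt0.
have hk k : h t = Phi m (t / k.+1%:R) * expR (t / k.+1%:R).
  rewrite -/(h _); apply/esym/hc => //; rewrite ler_pdivrMr// ler_peMr ?(ltW t0)//.
  by rewrite ler1n.
have t0cv : t / k.+1%:R @[k --> \oo] --> (0 : R).
  have l0 : t * 0 = 0 by rewrite mulr0.
  by apply: (cvgn_ext _ (fun=> erefl) l0); apply: cvgM; [exact: cvg_cst|exact: cvg_harmonic].
have [| | |_ c1] := @I0_dct R (fun k s => s `^ m * em m (t / k.+1%:R * s) * expR (- s))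
   (fun s => s `^ m * rgamma (m + 1) * expR (- s)) _ _ (int0Z (rgamma (m + 1)) (@int0_powR_exp m ltac:(lra))).
- by move=> k; apply: mfun0_cont => s s0; exact: Phi_cont.
- move=> s s0; apply: cvgM; last exact: cvg_cst.
  apply: cvgM; first exact: cvg_cst.
  rewrite -em0; apply: (cvg_comp (fun k => t / k.+1%:R * s) (em m)); last exact: cont_em.
  have l0 : 0 * s = 0 by rewrite mul0r.
  by apply: (cvgn_ext _ (fun=> erefl) l0); apply: cvgM => //; exact: cvg_cst.
- by move=> k s s0; exact: Phi_dom.
have c2 : expR (t / k.+1%:R) @[k --> \oo] --> (1 : R).
  by have := cvg_comp (fun k : nat => t / k.+1%:R) (@expR R) t0cv (@continuous_expR R 0); rewrite expR0.
have e1 : I0 (fun s => s `^ m * rgamma (m + 1) * expR (- s)) = 1.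
  have -> : I0 (fun s => s `^ m * rgamma (m + 1) * expR (- s)) =
     I0 (fun s => rgamma (m + 1) * (s `^ m * expR (- s))) by apply: I0_eq => s _; ring.
  have m1 : -1 < m by lra.
  rewrite I0Z; last exact: int0_powR_exp.
  by rewrite I0_powR_exp// rgammaE ?mulVf ?gt_eqF ?Gam_gt0//; lra.
have ht : h t = 1.
  have := cvgn_uniq (cvgM c1 c2) (cvg_cst (h t)); rewrite e1 mulr1 => <- // k.
  by rewrite (hk k).
by rewrite expRN; apply/(mulIf (lt0r_neq0 (expR_gt0 t))); rewrite mulVf ?gt_eqF ?expR_gt0.
Qed.

Lemma I0_powR_scale p (g : R -> R) s : 0 < s -> (forall t, 0 < t -> {for t, continuous g}) ->
  int0 (fun t => t `^ p * g t) -> int0 (fun t => t `^ p * g (s * t)) /\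
  I0 (fun t => t `^ p * g (s * t)) = s `^ (- p - 1) * I0 (fun t => t `^ p * g t).
Proof.
move=> s0 cg ig; have sn : s `^ p != 0 by rewrite gt_eqF// powR_gt0.
have c1 t : 0 < t -> {for t, continuous (fun t => t `^ p * g t)}.
  by move=> t0; apply: cvgM; [exact: cont_powR|exact: cg].
have i1 : int0 (fun t => t `^ p * g (s * t)).
  apply: int0_eq (int0Z (s `^ p)^-1 (int0_scale s0 c1 ig)) => t t0.
  by rewrite powRM ?(ltW s0) ?(ltW t0)// -!mulrA mulKf.
split => //; rewrite (I0_scale s0 c1 ig).
have -> : I0 (fun t => (s * t) `^ p * g (s * t)) = s `^ p * I0 (fun t => t `^ p * g (s * t)).
  by rewrite -I0Z//; apply: I0_eq => t t0; rewrite powRM ?(ltW s0) ?(ltW t0)// mulrA.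
rewrite (_ : - p - 1 = - (p + 1)); last by ring.
rewrite powRN (powRDx p 1 s0) powRr1 ?(ltW s0)//; field.
by rewrite sn gt_eqF.
Qed.

(** The function s^m e_m(ts) exp(-s) t^n is integrated in both orders: over t first, scaling gives
    the moment times Gamma(m-n); over s first, [PhiE] gives Gamma(n+1). *)
Lemma Mellin_em n m : -1 < n -> n - m / 2 - 4^-1 < -1 -> 0 <= m ->
  I0 (fun t => t `^ n * em m t) = Gam (n + 1) / Gam (m - n).
Proof.
move=> n1 nm m0; have mn : 0 < m - n by lra.
have igam : int0 (fun s => s `^ (m - n - 1) * expR (- s)) by apply: int0_powR_exp; lra.
have ie a : 0 < a -> int0 (fun t => t `^ n * em m (a * t)).
  move=> a0; have [C C0 hC] := em_wt m a a0.
  apply: (@int0_le _ _ (fun t => C * wt n (- (m / 2) - 4^-1) t)).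
  - by apply: mfun0_cont => t t0; apply: cvgM; [exact: cont_powR|exact: cont_em_scale].
  - by apply/int0Z/int0_wt => //; lra.
  - move=> t t0; rewrite normrM (ger0_norm (powR_ge0 _ _)) /wt mulrCA ler_wpM2l ?powR_ge0//.
    exact: hC.
have ie1 : int0 (fun t => t `^ n * em m t) by apply: int0_eq (ie 1 ltr01) => t _; rewrite mul1r.
pose F s t := s `^ m * em m (t * s) * expR (- s) * t `^ n.
have mF : measurable_fun setT (fun x : R * R => F x.1 x.2).
  have m1 (f : R -> R) : measurable_fun setT f -> measurable_fun setT (fun x : R * R => f x.1).
    by move=> mf; exact: (measurableT_comp mf measurable_fst).
  have m2 (f : R -> R) : measurable_fun setT f -> measurable_fun setT (fun x : R * R => f x.2).
    by move=> mf; exact: (measurableT_comp mf measurable_snd).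
  have me : measurable_fun setT (em m).
    apply: continuous_measurable_fun => y; exact: cont_em.
  apply: measurable_funM; last by apply: (m2 (fun t => t `^ n)); exact: measurable_powR.
  apply: measurable_funM; last first.
    by apply: (m1 (fun s => expR (- s))); apply: measurableT_comp => //.
  apply: measurable_funM; first by apply: (m1 (fun s => s `^ m)); exact: measurable_powR.
  apply: (measurableT_comp me); apply: measurable_funM; [exact: (m2 id)|exact: (m1 id)].
have F1 s : 0 < s -> int0 (F s).
  move=> s0; apply: int0_eq (int0Z (s `^ m * expR (- s)) (ie s s0)) => t _.
  by rewrite /F (mulrC t s); ring.
have F2 t : 0 < t -> int0 (fun s => F s t).
  move=> t0; apply: int0_eq (int0Z (t `^ n) (int0_Phi m0 t0)) => s _; rewrite /F; ring.
have cem t : {for t, continuous (em m)} by exact: cont_em.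
have cabsem t : {for t, continuous (fun t => `|em m t|)}.
  by apply: cvg_norm; exact: cont_em.
have inorm : int0 (fun t => t `^ n * `|em m t|).
  by apply: int0_eq (int0_norm ie1) => t _; rewrite normrM (ger0_norm (powR_ge0 _ _)).
have H1 s : 0 < s -> I0 (F s) = I0 (fun t => t `^ n * em m t) * (s `^ (m - n - 1) * expR (- s)).
  move=> s0; have -> : I0 (F s) = I0 (fun t => (s `^ m * expR (- s)) * (t `^ n * em m (s * t))).
    by apply: I0_eq => t _; rewrite /F (mulrC t s); ring.
  rewrite I0Z; last exact: ie.
  rewrite (I0_powR_scale s0 (fun t _ => cem t) ie1).2 (_ : m - n - 1 = m + (- n - 1)); last by ring.
  by rewrite (powRDx m _ s0); ring.
have F3 : exists2 H, int0 H & forall s, 0 < s -> I0 (fun t => `|F s t|) <= H s.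
  exists (fun s => I0 (fun t => t `^ n * `|em m t|) * (s `^ (m - n - 1) * expR (- s))).
    exact: int0Z.
  move=> s s0; have -> : I0 (fun t => `|F s t|) = I0 (fun t => (s `^ m * expR (- s)) * (t `^ n * `|em m (s * t)|)).
    apply: I0_eq => t _; rewrite /F (mulrC t s) !normrM !(ger0_norm (powR_ge0 _ _)).
    by rewrite (ger0_norm (expR_ge0 _)); ring.
  rewrite I0Z; last first.
    by apply: int0_eq (int0_norm (ie s s0)) => t _; rewrite normrM (ger0_norm (powR_ge0 _ _)).
  rewrite (I0_powR_scale s0 (fun t _ => cabsem t) inorm).2 (_ : m - n - 1 = m + (- n - 1)); last by ring.
  by rewrite (powRDx m _ s0) le_eqVlt; apply/orP; left; apply/eqP; ring.
have [_ _ e] := fubini0 mF F1 F2 F3.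
have e1 : I0 (fun s => I0 (F s)) = I0 (fun t => t `^ n * em m t) * Gam (m - n).
  by rewrite (I0_eq H1) (I0Z _ igam).
have e2 : I0 (fun t => I0 (fun s => F s t)) = Gam (n + 1).
  rewrite -(I0_powR_exp n1); apply: I0_eq => t t0.
  rewrite -(PhiE m0 t0) /Phi -I0Z; last exact: int0_Phi.
  by apply: I0_eq => s _; rewrite /F; ring.
have g0 := lt0r_neq0 (Gam_gt0 mn).
by apply: (mulIf g0); rewrite -e1 e e2 divfK.
Qed.

End LaplaceBessel.

Section Remainder.
Context {R : realType}.
Local Notation Re := (@complex.Re R).
Local Notation Im := (@complex.Im R).
Implicit Types (t s x m n p y : R).

Definition erem m (j : nat) y := em m y - \sum_(i < j) (rgamma (m + i%:R + 1) / i`!%:R * (- y) ^+ i).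

Lemma erem0 m y : erem m 0 y = em m y.
Proof. by rewrite /erem big_ord0 subr0. Qed.

Lemma eremS m j y : erem m j.+1 y = erem m j y - rgamma (m + j%:R + 1) / j`!%:R * (- y) ^+ j.
Proof. by rewrite /erem big_ord_recr /= opprD addrA. Qed.

Lemma erem_at0 m j : erem m j.+1 0 = 0.
Proof.
elim: j => [|j IH].
  by rewrite eremS erem0 em0 fact0 divr1 expr0 mulr1 addr0 subrr.
by rewrite eremS IH oppr0 expr0n /= mulr0 subrr.
Qed.

Lemma rd_erem m j y : rderiv (erem m j.+1) y (- erem (m + 1) j y).
Proof.
elim: j => [|j IH].
  apply: rd_ext (rd_eq (rd_sub (rd_em m y) (rd_cst (rgamma (m + 1)) y)) _) => [t|].
    by rewrite eremS erem0 fact0 divr1 expr0 mulr1 addr0.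
  by rewrite subr0 erem0.
apply: (rd_ext (fun t => esym (eremS m j.+1 t))).
apply: rd_eq (rd_sub IH (rd_scale (rgamma (m + j.+1%:R + 1) / j.+1`!%:R) (rd_exprn j (rd_opp (rd_id y))))) _.
rewrite (eremS (m + 1)) factS natrM -natr1.
have -> : m + (j%:R + 1) + 1 = m + 1 + j%:R + 1 by ring.
move: (rgamma _) (erem _ _ _) => g e; field.
by rewrite natr1 !pnatr_eq0 -lt0n fact_gt0.
Qed.

Lemma cont_erem m j y : {for y, continuous (erem m j)}.
Proof.
case: j => [|j]; last exact: rd_cont (rd_erem m j y).
by rewrite (_ : erem m 0 = em m); [exact: cont_em|apply/funext => t; exact: erem0].
Qed.

(** The remainder is at most the first omitted term. Differentiation trades a Taylor term for an
    order, so the induction ends at e_{m+j}, where [em_le] needs m + j >= -1/2. *)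
Lemma erem_bound m j y : - 2^-1 <= m + j%:R -> 0 <= y ->
  `|erem m j y| <= rgamma (m + j%:R + 1) / j`!%:R * y ^+ j.
Proof.
elim: j m y => [|j IH] m y mj y0.
  by rewrite erem0 fact0 divr1 expr0 mulr1 addr0; apply: em_le => //; rewrite addr0 in mj.
set c := rgamma (m + j.+1%:R + 1).
have d (e : R) : rderiv (fun t => e * t ^+ j.+1) y (e * (j.+1%:R * y ^+ j)).
  by apply: rd_eq (rd_scale e (rd_exprn j (rd_id y))) _; rewrite mulr1.
have dg t : rderiv (fun t => c / j.+1`!%:R * t ^+ j.+1) t (c / j`!%:R * t ^+ j).
  apply: rd_eq (rd_scale (c / j.+1`!%:R) (rd_exprn j (rd_id t))) _.
  rewrite mulr1 factS natrM; field.
  by rewrite nat1r !pnatr_eq0 -lt0n fact_gt0.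
have hb t : 0 <= t -> `|erem (m + 1) j t| <= c / j`!%:R * t ^+ j.
  move=> t0; have e1 : m + 1 + j%:R = m + j.+1%:R by rewrite -natr1; ring.
  by have := IH (m + 1) t; rewrite e1; apply.
rewrite ler_norml; apply/andP; split.
  have h : - erem m j.+1 y - c / j.+1`!%:R * y ^+ j.+1 <= - erem m j.+1 0 - c / j.+1`!%:R * 0 ^+ j.+1.
    apply: (@mvt_noninc _ (fun t => - erem m j.+1 t - c / j.+1`!%:R * t ^+ j.+1)
      (fun t => - - erem (m + 1) j t - c / j`!%:R * t ^+ j)) => // t.
      by move=> _ _; exact: rd_sub (rd_opp (rd_erem m j t)) (dg t).
    move=> t0 _; rewrite opprK subr_le0.
    exact: le_trans (ler_norm _) (hb t (ltW t0)).
  by move: h; rewrite erem_at0 expr0n /= mulr0; lra.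
have h : erem m j.+1 y - c / j.+1`!%:R * y ^+ j.+1 <= erem m j.+1 0 - c / j.+1`!%:R * 0 ^+ j.+1.
  apply: (@mvt_noninc _ (fun t => erem m j.+1 t - c / j.+1`!%:R * t ^+ j.+1)
    (fun t => - erem (m + 1) j t - c / j`!%:R * t ^+ j)) => // t.
    by move=> _ _; exact: rd_sub (rd_erem m j t) (dg t).
  move=> t0 _; rewrite subr_le0; apply: le_trans (ler_norm _) _.
  by rewrite normrN hb// ltW.
by move: h; rewrite erem_at0 expr0n /= mulr0; lra.
Qed.

(** At infinity the last subtracted monomial t^j dominates. The slack -n/4 > 0 also absorbs e_p for
    every p >= n, and still n - (j+1) + j - n/4 = -1 + 3n/4 is below -1. *)
Lemma erem_bnd n p j : -1 < n -> n < 0 -> n <= p -> exists2 C : R, 0 <= C &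
  (forall t, 0 < t -> t <= 1 -> `|erem p j.+1 t| <= C * t `^ j.+1%:R) /\
  (forall t, 1 <= t -> `|erem p j.+1 t| <= C * t `^ (j%:R - n / 4)).
Proof.
move=> n1 n0 np.
have [B B0 hB] : exists2 C : R, 0 <= C & forall t, 1 <= t -> `|erem p j.+1 t| <= C * t `^ (j%:R - n / 4).
  elim: j => [|j [C C0 IH]].
    have [C C0 hC] := em_decay p; exists (C + `|rgamma (p + 1)|) => [|t t1]; first by rewrite addr_ge0.
    rewrite eremS erem0 fact0 divr1 expr0 mulr1 addr0 mulrDl; apply: le_trans (ler_normB _ _) _.
    apply: lerD.
      by apply: le_trans (hC t t1) _; rewrite ler_wpM2l//; apply: ler_powR => //; lra.
    have : t `^ 0 <= t `^ (0%:R - n / 4) by apply: ler_powR => //; lra.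
    by rewrite powRr0 => h; rewrite ler_peMr.
  set r := rgamma (p + j.+1%:R + 1) / j.+1`!%:R.
  exists (C + `|r|) => [|t t1]; first by rewrite addr_ge0.
  have t0 : 0 < t by exact: lt_le_trans t1.
  rewrite eremS mulrDl; apply: le_trans (ler_normB _ _) _; apply: lerD.
    apply: le_trans (IH t t1) _; rewrite ler_wpM2l//; apply: ler_powR => //.
    by rewrite -natr1; lra.
  rewrite normrM normrX normrN (gtr0_norm t0) ler_wpM2l// -powR_mulrn ?(ltW t0)//.
  by apply: ler_powR => //; lra.
have [hj|hj] := leP (- 2^-1) (p + j.+1%:R); last first.
  by have : 0 <= j%:R :> R by []; rewrite -natr1 in hj; lra.
have g0 : 0 < rgamma (p + j.+1%:R + 1) by apply: rgamma_gt0; lra.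
set A := rgamma (p + j.+1%:R + 1) / j.+1`!%:R.
have A0 : 0 <= A by rewrite divr_ge0// ltW.
exists (A + B) => [|]; first by rewrite addr_ge0.
split=> t t0.
  move=> t1; apply: le_trans (erem_bound hj (ltW t0)) _.
  by rewrite powR_mulrn ?(ltW t0)// ler_wpM2r ?exprn_ge0 ?(ltW t0)// lerDl.
by apply: le_trans (hB t t0) _; rewrite ler_wpM2r ?powR_ge0// lerDr.
Qed.

Lemma erem_wt n p j : -1 < n -> n < 0 -> n <= p -> exists2 C : R, 0 <= C & forall t, 0 < t ->
  `|t `^ (n - j.+1%:R) * erem p j.+1 t| <= C * wt n (- 1 - n / 4) t.
Proof.
move=> n1 n0 np; have [C C0 [h0 h1]] := erem_bnd j n1 n0 np.
have P0 : 0 <= 2 `^ `|- 1 - n / 4| :> R by exact: powR_ge0.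
exists (C * 2 `^ `|- 1 - n / 4|) => [|t t0]; first by rewrite mulr_ge0.
rewrite normrM (ger0_norm (powR_ge0 _ _)) -mulrA.
have [t1|/ltW t1] := leP 1 t.
  apply: (@le_trans _ _ (t `^ (n - j.+1%:R) * (C * t `^ (j%:R - n / 4)))).
    by rewrite ler_wpM2l ?powR_ge0// h1.
  rewrite mulrCA ler_wpM2l// -powRDx// /wt mulrCA.
  have -> : n - j.+1%:R + (j%:R - n / 4) = n + (- 1 - n / 4) by rewrite -natr1; ring.
  by rewrite powRDx// ler_wpM2l ?powR_ge0//; apply: powR_cmp; lra.
apply: (@le_trans _ _ (t `^ (n - j.+1%:R) * (C * t `^ j.+1%:R))).
  by rewrite ler_wpM2l ?powR_ge0// h0.
rewrite mulrCA ler_wpM2l// -powRDx// subrK /wt mulrCA ler_peMr ?powR_ge0//.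
by have := @powR_cmp R 1 (1 + t) 2 (- 1 - n / 4); rewrite powR1; apply; lra.
Qed.

Lemma cont_werem p q (b : R) j t : 0 < b -> 0 < t -> {for t, continuous (fun t => t `^ q * erem p j (b * t))}.
Proof.
move=> b0 t0; apply: cvgM; first exact: cont_powR.
by apply: (cont_scale b0) => // s _; exact: cont_erem.
Qed.

Lemma int0_erem n p j : -1 < n -> n < 0 -> n <= p -> int0 (fun t => t `^ (n - j.+1%:R) * erem p j.+1 t).
Proof.
move=> n1 n0 np; have [C C0 hC] := erem_wt j n1 n0 np.
apply: (@int0_le _ _ (fun t => C * wt n (- 1 - n / 4) t)) => //.
  apply: mfun0_cont => t t0; apply: cvgM; [exact: cont_powR|exact: cont_erem].
by apply/int0Z/int0_wt => //; lra.
Qed.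

(** Integration by parts against t^(n-j): the derivative of the remainder is minus the one with
    order raised by 1 and one Taylor term fewer. *)
Lemma I0_erem_step n p j : -1 < n -> n < 0 -> n <= p ->
  int0 (fun t => t `^ (n - j%:R) * erem (p + 1) j t) ->
  (n - j%:R) * I0 (fun t => t `^ (n - j.+1%:R) * erem p j.+1 t) =
  I0 (fun t => t `^ (n - j%:R) * erem (p + 1) j t).
Proof.
move=> n1 n0 np ij; have ij1 := int0_erem j n1 n0 np.
have [C C0 [h0 h1]] := erem_bnd j n1 n0 np.
apply/eqP; rewrite -subr_eq0 -I0Z// -I0B//; last exact: int0Z.
apply/eqP; apply: (@ftc0_zero _ _ (fun t => t `^ (n - j%:R) * erem p j.+1 t) (n + 1) (3 * n / 4) C).
- lra.
- lra.
- move=> t t0; apply: cvgB.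
    by apply: cvgM; [exact: cvg_cst|apply: cvgM; [exact: cont_powR|exact: cont_erem]].
  by apply: cvgM; [exact: cont_powR|exact: cont_erem].
- move=> t t0; apply: rd_eq (rd_mul (rd_powR _ t0) (rd_erem p j t)) _.
  have -> : n - j%:R - 1 = n - j.+1%:R by rewrite -natr1; ring.
  by rewrite mulrN mulrA.
- by apply: int0B => //; exact: int0Z.
- move=> t t0 t1; rewrite normrM (ger0_norm (powR_ge0 _ _)).
  apply: (@le_trans _ _ (t `^ (n - j%:R) * (C * t `^ j.+1%:R))).
    by rewrite ler_wpM2l ?powR_ge0// h0.
  rewrite mulrCA -powRDx// (_ : n - j%:R + j.+1%:R = n + 1)//.
  by rewrite -natr1; ring.
- move=> t t1; have t0 : 0 < t by exact: lt_le_trans t1.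
  rewrite normrM (ger0_norm (powR_ge0 _ _)).
  apply: (@le_trans _ _ (t `^ (n - j%:R) * (C * t `^ (j%:R - n / 4)))).
    by rewrite ler_wpM2l ?powR_ge0// h1.
  rewrite mulrCA -powRDx// (_ : n - j%:R + (j%:R - n / 4) = 3 * n / 4)//.
  by field.
Qed.

Lemma int0_powR_em n m : -1 < n -> n - m / 2 - 4^-1 < -1 -> int0 (fun t => t `^ n * em m t).
Proof.
move=> n1 nm; have [C C0 hC] := em_wt1 m.
apply: (@int0_le _ _ (fun t => C * wt n (- (m / 2) - 4^-1) t)).
- by apply: mfun0_cont => t t0; apply: cvgM; [exact: cont_powR|exact: cont_em].
- by apply/int0Z/int0_wt => //; lra.
- move=> t t0; rewrite normrM (ger0_norm (powR_ge0 _ _)) /wt mulrCA ler_wpM2l ?powR_ge0//.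
  exact: hC.
Qed.

(** Iterates the previous reduction down to the Mellin transform of e_{n+k}, which converges
    absolutely for all n in (-1, 0) once k >= 2. *)
Lemma I0_erem_prod n k j : -1 < n -> n < 0 -> (2 <= k)%N -> (j <= k)%N ->
  int0 (fun t => t `^ (n - j%:R) * erem (n + (k - j)%:R) j t) /\
  (\prod_(i < j) (n - i%:R)) * I0 (fun t => t `^ (n - j%:R) * erem (n + (k - j)%:R) j t) =
  Gam (n + 1) / Gam k%:R.
Proof.
move=> n1 n0 k2; have k2' : 2 <= k%:R :> R by rewrite ler_nat.
elim: j => [_|j IH jk].
  have e t : t `^ (n - 0%:R) * erem (n + (k - 0)%:R) 0 t = t `^ n * em (n + k%:R) t.
    by rewrite subr0 erem0 subn0.
  have i0 : int0 (fun t => t `^ n * em (n + k%:R) t) by apply: int0_powR_em => //; lra.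
  split; first by apply: int0_eq i0 => t _; rewrite e.
  have nk : n - (n + k%:R) / 2 - 4^-1 < -1 by lra.
  have nn : 0 <= n + k%:R by lra.
  rewrite big_ord0 mul1r.
  have -> := I0_eq (fun t _ => e t).
  rewrite (Mellin_em n1 nk nn).
  by rewrite (_ : n + k%:R - n = k%:R)//; ring.
have [ij ej] := IH (ltnW jk).
have e1 : n + (k - j)%:R = n + (k - j.+1)%:R + 1 by rewrite -addrA natr1 -subSn.
rewrite e1 in ij ej.
have np : n <= n + (k - j.+1)%:R by rewrite lerDl.
split; first exact: int0_erem.
by rewrite big_ord_recr /= -mulrA I0_erem_step.
Qed.

Lemma I0_erem n k : -1 < n -> n < 0 ->
  (\prod_(i < k.+1) (n - i%:R)) * I0 (fun t => t `^ (n - k.+1%:R) * erem n k.+1 t) =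
  Gam (n + 1) / k`!%:R.
Proof.
move=> n1 n0; case: k => [|k]; last first.
  have [_ ] := @I0_erem_prod n k.+2 k.+2 n1 n0 isT (leqnn _).
  by rewrite subnn addr0 Gam_nat.
(* A single Taylor term would start from e_{n+1}, which need not decay fast enough. The relation e_n
   = (n+1) e_{n+1} - t e_{n+2} expresses it by two moments that both start from e_{n+2}. *)
have [i1 e1] := @I0_erem_prod n 2 1 n1 n0 isT isT.
have [i2 e2] := @I0_erem_prod n 2 0 n1 n0 isT isT.
rewrite fact0 divr1 big_ord_recl big_ord0 mulr1 subr0.
move: e1 e2; rewrite big_ord_recl !big_ord0 mulr1 mul1r subr0 (Gam_nat 1) (_ : 1`!%:R = 1) // divr1 => e1 e2.
have -> : I0 (fun t => t `^ (n - 1) * erem n 1 t) =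
  (n + 1) * I0 (fun t => t `^ (n - 1) * erem (n + 1) 1 t) - I0 (fun t => t `^ n * erem (n + (2 - 0)%N%:R) 0 t).
  rewrite subr0 in i2; rewrite -I0Z// -I0B//; last exact: int0Z.
  apply: I0_eq => t t0; rewrite !eremS !erem0 fact0 !divr1 !expr0 !mulr1 !addr0 subn0.
  have := emS (n + 1) t; rewrite addrK => ->; rewrite (rgammaS (n + 1)).
  have -> : n + 1 + 1 = n + 2%:R by ring.
  rewrite (@powR_eqD _ t (n - 1) 1 n t0); last by rewrite subrK.
  by rewrite powRr1 ?(ltW t0)//; move: (rgamma _) (em _ _) (em _ _) (t `^ _) => g x y z; ring.
by rewrite e2 mulrBr mulrCA e1; ring.
Qed.

End Remainder.

(** * Stieltjes transforms of powers and of a single Bessel function *)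

Section StieltjesPower.
Context {R : realType}.
Local Notation Re := (@complex.Re R).
Local Notation Im := (@complex.Im R).
Implicit Types (t s x m n p y : R) (z w : R[i]).

Lemma I0_powR_expM p c : -1 < p -> 0 < c -> int0 (fun t => t `^ p * expR (- (c * t))) /\
  I0 (fun t => t `^ p * expR (- (c * t))) = c `^ (- p - 1) * Gam (p + 1).
Proof.
move=> p1 c0; rewrite -I0_powR_exp//.
by apply: (@I0_powR_scale _ p (fun t => expR (- t))) => //; [move=> t _; exact: cont_exprN|exact: int0_powR_exp].
Qed.

Lemma int0_powR_div n : -1 < n -> n < 0 -> int0 (fun t => t `^ n * (1 + t)^-1).
Proof.
move=> n1 n0; apply: (@int0_eq _ (wt n (-1))).
  by move=> t t0; rewrite /wt powRN powRr1//; lra.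
by apply: int0_wt => //; lra.
Qed.

(** Write 1/(1+t) as the integral of exp(-(1+t)s) over s and exchange the order of integration. *)
Lemma I0_powR_div n : -1 < n -> n < 0 -> I0 (fun t => t `^ n * (1 + t)^-1) = Gam (n + 1) * Gam (- n).
Proof.
move=> n1 n0.
have i3 : int0 (fun s => s `^ (- n - 1) * expR (- s)) by apply: int0_powR_exp; lra.
pose F t s := t `^ n * expR (- ((1 + t) * s)).
have iE c : 0 < c -> int0 (fun s => expR (- (c * s))) /\ I0 (fun s => expR (- (c * s))) = c^-1.
  move=> c0; have [|i e] := @I0_powR_expM 0 c _ c0; first by lra.
  split; first by apply: int0_eq i => s _; rewrite powRr0 mul1r.
  rewrite -[LHS](_ : I0 (fun s => s `^ 0 * expR (- (c * s))) = _); last first.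
    by apply: I0_eq => s _; rewrite powRr0 mul1r.
  by rewrite e add0r Gam1 mulr1 oppr0 sub0r powRN powRr1// ltW.
have mF : measurable_fun setT (fun x : R * R => F x.1 x.2).
  apply: measurable_funM.
    by apply: (measurableT_comp (measurable_powR n) measurable_fst).
  apply: (measurableT_comp (@measurable_expR R)); apply: measurableT_comp => //.
  apply: measurable_funM; last exact: measurable_snd.
  by apply: measurable_funD => //; exact: measurable_cst.
have F1 t : 0 < t -> int0 (F t).
  by move=> t0; apply: int0Z; apply: (iE (1 + t) _).1; lra.
have eF t s : F t s = expR (- s) * (t `^ n * expR (- (s * t))).
  by rewrite /F (_ : - ((1 + t) * s) = - s + - (s * t)) ?expRD; ring.
have F2 s : 0 < s -> int0 (fun t => F t s).
  move=> s0; apply: int0_eq (int0Z (expR (- s)) (I0_powR_expM n1 s0).1) => t _.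
  by rewrite eF.
have H1 t : 0 < t -> I0 (F t) = t `^ n * (1 + t)^-1.
  move=> t0; have [|i e] := iE (1 + t); first by lra.
  by rewrite -e -I0Z.
have F3 : exists2 H, int0 H & forall t, 0 < t -> I0 (fun s => `|F t s|) <= H t.
  exists (fun t => t `^ n * (1 + t)^-1); first exact: int0_powR_div.
  move=> t t0; rewrite -H1// le_eqVlt; apply/orP; left; apply/eqP.
  by apply: I0_eq => s _; rewrite ger0_norm// mulr_ge0 ?powR_ge0 ?expR_ge0.
have [_ _ e] := fubini0 mF F1 F2 F3.
rewrite -(I0_eq H1) e.
rewrite /(Gam (- n)) -(I0Z _ i3); apply: I0_eq => s s0.
rewrite (I0_eq (fun t _ => eF t s)) (I0Z _ (I0_powR_expM n1 s0).1) (I0_powR_expM n1 s0).2.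
by ring.
Qed.

Variable L : R[i].
Hypothesis L_pi : `|Im L| < pi.
Let z := cexp L.

Lemma cabs_cexp w : cabs (cexp w) <= 2 * expR (Re w).
Proof.
rewrite /cabs /cexp ReZ ImZ /= !normrM !(ger0_norm (expR_ge0 _)) -mulrDr mulrC.
by rewrite ler_wpM2r ?expR_ge0// (_ : 2 = 1 + 1)// lerD// ler_norml ?cos_geN1 ?cos_le1 ?sin_geN1 ?sin_le1.
Qed.

(** The margin d makes the parameter interval an open neighbourhood of [0, 1], as differentiation
    requires; d is small enough that (1 + d)|Im L| stays below psi, the midpoint of |Im L| and
    pi. *)
Lemma kz_path : exists2 d : R, 0 < d & exists2 C : R, 0 <= C & forall x t, - d < x -> x < 1 + d ->
  0 < t -> cexp (x%:C * L) + t%:C != 0 /\ cabs (kz (cexp (x%:C * L)) t) <= C * (1 + t) `^ (-1).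
Proof.
have pp : 0 < pi :> R by exact: pi_gt0.
pose d : R := (pi - `|Im L|) / (2 * pi); pose psi := (pi + `|Im L|) / 2.
have d0 : 0 < d by rewrite divr_gt0 ?mulr_gt0// subr_gt0.
have th0 : 0 <= `|Im L| by [].
have d1 : d <= 1.
  by rewrite ler_pdivrMr ?mulr_gt0//; lra.
have [p1 p2] : 0 <= psi /\ psi < pi by rewrite /psi; move: (pi : R) pp L_pi => P pp LP; lra.
have [C C0 hC] := @kz_unif R (expR (- (2 * `|Re L|))) (1 + cos psi) (expR_gt0 _)
  (@cos_gtN1 _ psi ltac:(by rewrite ger0_norm)).
exists d => //; exists C => // x t x1 x2 t0.
have xa : `|x| <= 1 + d by rewrite ler_norml; apply/andP; split; lra.
apply: hC => //; rewrite normc_cexp ReZ.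
  rewrite ler_expR lerNl; apply: le_trans (ler_norm _) _; rewrite normrN normrM.
  by rewrite ler_wpM2r//; lra.
rewrite Re_cexp ReZ ImZ mulrDl mul1r lerD2l mulrC ler_wpM2l ?expR_ge0//.
have xi : `|x * Im L| <= psi.
  rewrite normrM; apply: (@le_trans _ _ ((1 + d) * `|Im L|)); first by rewrite ler_wpM2r.
  have h : d * `|Im L| <= (pi - `|Im L|) / 2.
    rewrite /d mulrAC ler_pdivrMr ?mulr_gt0// (_ : _ / 2 * _ = (pi - `|Im L|) * pi).
      by rewrite ler_wpM2l ?subr_ge0 ?(ltW L_pi).
    by move: (pi : R) => P; field.
  by rewrite /psi; move: (pi : R) h => P h; lra.
rewrite -(cos_norm (x * _)) leNgt ltr_cos -?leNgt// ?in_itv/= ?p1 ?(ltW p2) ?normr_ge0 ?(le_trans xi (ltW p2))//.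
Qed.

Lemma ccontD (f g : R -> R[i]) t : ccont f t -> ccont g t -> ccont (fun s => f s + g s) t.
Proof.
move=> [fa fb] [ga gb]; split.
  rewrite (_ : (fun s => Re (f s + g s)) = fun s => Re (f s) + Re (g s)); first exact: cvgD.
  by apply/funext => s; rewrite ReD.
rewrite (_ : (fun s => Im (f s + g s)) = fun s => Im (f s) + Im (g s)); first exact: cvgD.
by apply/funext => s; rewrite ImD.
Qed.

Lemma ccont_cst w t : ccont (fun=> w) t.
Proof. by split; exact: cvg_cst. Qed.

(* Along z(x) = exp(x L) both Z^-n int t^n/(Z+t) dt and its x-derivative have integrands that are
   exact t-derivatives up to the factor -L, so the value at x = 1 equals the one at x = 0. *)
Lemma cI_powR_kz n : -1 < n -> n < 0 ->
  cI (fun t => (t `^ n)%:C * kz z t) = (Gam (n + 1) * Gam (- n))%:C * cexp (n%:C * L).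
Proof.
move=> n1 n0; have [d d0 [C C0 hC]] := kz_path.
have ic : int0 (wt n (-1)) by apply: int0_wt; lra.
pose Z x := cexp (x%:C * L); pose E x := cexp (x%:C * (- n%:C * L)).
pose G x t := (t `^ n)%:C * (E x * kz (Z x) t).
(* The form t^n Z^(-n) dt/(Z+t) is homogeneous of degree 0 in (t, Z), so varying Z amounts to
   rescaling t; [P] is t times the integrand. *)
pose P x t := (t `^ (n + 1))%:C * (E x * kz (Z x) t).
pose dP x t := (t `^ n)%:C * (E x * (n%:C * kz (Z x) t + Z x * kz (Z x) t ^+ 2)).
pose K := 2 * expR ((1 + d) * `|n * Re L|).
have K0 : 0 <= K by rewrite mulr_ge0 ?expR_ge0.
have EK x : - d < x -> x < 1 + d -> cabs (E x) <= K.
  move=> x1 x2; apply: le_trans (cabs_cexp _) _; rewrite ler_wpM2l// ler_expR ReZ ReM ReN ImN /= oppr0 mul0r subr0.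
  apply: le_trans (ler_norm _) _; rewrite normrM mulNr normrN ler_wpM2r// ler_norml.
  by apply/andP; split; lra.
have kb x t : - d < x -> x < 1 + d -> 0 < t -> cabs (kz (Z x) t) <= C * (1 + t) `^ (-1).
  by move=> x1 x2 t0; have [] := hC x t x1 x2 t0.
have kE x t : - d < x -> x < 1 + d -> 0 < t -> cabs (E x * kz (Z x) t) <= K * C * (1 + t) `^ (-1).
  move=> x1 x2 t0; apply: le_trans (cabsM _ _) _; rewrite -mulrA.
  by apply: ler_pM; rewrite ?cabs_ge0 ?EK// kb.
pose M : R := `|n| + 2 * expR ((1 + d) * `|Re L|) * C.
have M0 : 0 <= M by rewrite addr_ge0// mulr_ge0// mulr_ge0// expR_ge0.
have bdP x t : - d < x -> x < 1 + d -> 0 < t -> cabs (dP x t) <= (K * C * M) * wt n (-1) t.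
  move=> x1 x2 t0; have k1 := kE x t x1 x2 t0; have k2 := kb x t x1 x2 t0.
  have p1 : (1 + t) `^ (-1) <= 1 by rewrite powRN powRr1 ?invf_le1; lra.
  have ZK : cabs (Z x) <= 2 * expR ((1 + d) * `|Re L|).
    apply: le_trans (cabs_cexp _) _; rewrite ler_wpM2l// ler_expR ReZ.
    apply: le_trans (ler_norm _) _; rewrite normrM ler_wpM2r// ler_norml.
    by apply/andP; split; lra.
  rewrite /dP cabsZ ger0_norm ?powR_ge0// /wt [leRHS]mulrCA ler_wpM2l ?powR_ge0//.
  have -> : E x * (n%:C * kz (Z x) t + Z x * kz (Z x) t ^+ 2) = (E x * kz (Z x) t) * (n%:C + Z x * kz (Z x) t).
    by rewrite expr2; ring.
  apply: le_trans (cabsM _ _) _.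
  rewrite (mulrAC (K * C)); apply: ler_pM; rewrite ?cabs_ge0//.
  apply: le_trans (cabsD _ _) _; rewrite cabsC lerD2l.
  apply: le_trans (cabsM _ _) _; apply: ler_pM; rewrite ?cabs_ge0//.
  by apply: le_trans k2 _; rewrite ler_piMr.
have dkz x t : - d < x -> x < 1 + d -> 0 < t -> rdc (kz (Z x)) t (- kz (Z x) t ^+ 2).
  move=> x1 x2 t0; have [h _] := hC x t x1 x2 t0.
  apply: rdc_eq (rdc_inv h (rdc_add (rdc_cst (Z x) t) (rdc_real (rd_id t)))) _.
  by rewrite add0r mulN1r /kz exprVn.
have ck x t : - d < x -> x < 1 + d -> 0 < t -> ccont (kz (Z x)) t.
  by move=> x1 x2 t0; exact: rdc_cont (dkz x t x1 x2 t0).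
have cG x t : - d < x -> x < 1 + d -> 0 < t -> ccont (G x) t.
  move=> x1 x2 t0; apply: ccontM; first by apply: ccont_real; exact: cont_powR.
  by apply: ccontM; [exact: ccont_cst|exact: ck].
have iG x : - d < x -> x < 1 + d -> cint0 (G x).
  move=> x1 x2; apply: (cint0_le _ (int0Z (K * C) ic)).
    by apply: cmfun_cont => t t0; exact: cG.
  move=> t t0; rewrite /G cabsZ ger0_norm ?powR_ge0// /wt mulrCA ler_wpM2l ?powR_ge0//.
  exact: kE.
have cdP x t : - d < x -> x < 1 + d -> 0 < t -> ccont (dP x) t.
  move=> x1 x2 t0; have h := ck x t x1 x2 t0.
  apply: ccontM; first by apply: ccont_real; exact: cont_powR.
  apply: ccontM; first exact: ccont_cst.
  apply: ccontD; first by apply: ccontM => //; exact: ccont_cst.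
  by apply: ccontM; [exact: ccont_cst|exact: ccontM].
have idP x : - d < x -> x < 1 + d -> cint0 (dP x).
  move=> x1 x2; apply: (cint0_le _ (int0Z (K * C * M) ic)).
    by apply: cmfun_cont => t t0; exact: cdP.
  by move=> t t0; exact: bdP.
have rP x t : - d < x -> x < 1 + d -> 0 < t -> rdc (P x) t (dP x t).
  move=> x1 x2 t0; have [h _] := hC x t x1 x2 t0.
  apply: rdc_eq (rdc_mul (rdc_real (rd_powR (n + 1) t0)) (rdc_mul (rdc_cst (E x) t) (dkz x t x1 x2 t0))) _.
  rewrite addrK /dP (powRDx n 1 t0) powRr1 ?(ltW t0)// !rmorphM rmorphD rmorph1 /=.
  have e : (Z x + t%:C) * kz (Z x) t ^+ 2 = kz (Z x) t by rewrite expr2 mulrA mulfV// mul1r.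
  move: (Z x) (E x) (t `^ n)%:C (kz (Z x) t) e => Zx Ex T k e.
  transitivity (T * (Ex * (n%:C * k + (k - t%:C * k ^+ 2)))); first by ring.
  by rewrite -{2}e; ring.
have c0 x : - d < x -> x < 1 + d -> cI (dP x) = 0.
  move=> x1 x2; apply: (@cftc0_zero _ (dP x) (P x) (n + 1) n (K * C)); [lra|lra| | | | |].
  - by move=> t t0; exact: cdP.
  - by move=> t t0; exact: rP.
  - exact: idP.
  - move=> t t0 t1; rewrite /P cabsZ ger0_norm ?powR_ge0// mulrC ler_wpM2r ?powR_ge0//.
    apply: le_trans (kE x t x1 x2 t0) _; rewrite ler_piMr ?mulr_ge0//.
    by rewrite powRN powRr1 ?invf_le1; lra.
  - move=> t t1; have t0 : 0 < t by exact: lt_le_trans t1.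
    rewrite /P cabsZ ger0_norm ?powR_ge0// (powRDx n 1 t0) powRr1 ?(ltW t0)// -[leLHS]mulrA [leLHS]mulrC ler_wpM2r ?powR_ge0//.
    apply: (@le_trans _ _ (t * (K * C * (1 + t) `^ (-1)))).
      by rewrite ler_wpM2l ?(ltW t0)// kE.
    rewrite mulrCA ler_piMr ?mulr_ge0// powRN powRr1; last lra.
    by rewrite ler_pdivrMr; lra.
have dG x t : - d < x -> x < 1 + d -> 0 < t -> rdc (G^~ t) x (- L * dP x t).
  move=> x1 x2 t0; have [h _] := hC x t x1 x2 t0.
  have dz : rdc (fun x => kz (Z x) t) x (- (L * Z x) / (Z x + t%:C) ^+ 2).
    apply: rdc_eq (rdc_inv h (rdc_add (rdc_cexp L x) (rdc_cst t%:C x))) _.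
    by rewrite addr0.
  apply: rdc_eq (rdc_mul (rdc_cst (t `^ n)%:C x) (rdc_mul (rdc_cexp (- n%:C * L) x) dz)) _.
  rewrite /dP -/(E x) mul0r add0r -exprVn -/(kz (Z x) t).
  by move: (Z x) (E x) (t `^ n)%:C (kz (Z x) t) => Zx Ex T k; ring.
have du x : - d < x -> x < 1 + d -> rdc (fun x => cI (G x)) x 0.
  move=> x1 x2; apply: rdc_eq (@rdc_cI _ G (fun x t => - L * dP x t) x (- d) (1 + d)
    (fun t => cabs L * (K * C * M * wt n (-1) t)) x1 x2 iG dG _ _) _.
  - exact/int0Z/int0Z.
  - move=> y t y1 y2 t0; rewrite mulNr cabsN; apply: le_trans (cabsM _ _) _.
    by rewrite ler_wpM2l ?cabs_ge0// bdP.
  - by rewrite cIZ ?c0 ?mulr0//; exact: idP.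
have u01 : cI (G 0) = cI (G 1).
  apply: (@rdc_const _ (fun x => cI (G x)) 0 1) => // x x0 x1.
  by apply: du; lra.
have Z0 : Z 0 = 1 by rewrite /Z mul0r cexp0.
have E0 : E 0 = 1 by rewrite /E mul0r cexp0.
have e0 : cI (G 0) = (Gam (n + 1) * Gam (- n))%:C.
  rewrite -I0_powR_div// -cI_real; apply: cI_eq => t t0.
  rewrite /G E0 Z0 mul1r rmorphM fmorphV rmorphD /=//.
have e1 : cI (G 1) = cexp (- (n%:C * L)) * cI (fun t => (t `^ n)%:C * kz z t).
  rewrite -cIZ; last first.
    have i1 := iG 1 ltac:(lra) ltac:(lra).
    apply: cint0_eq (cint0Z (E 1)^-1 i1) => t t0.
    by rewrite /G mulrCA mulKf ?cexp_neq0// /Z mul1r.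
  by apply: cI_eq => t t0; rewrite /G /E /Z !mul1r mulrCA mulNr.
by rewrite -e0 u01 e1 mulrAC -cexpD addNr cexp0 mul1r.
Qed.

End StieltjesPower.

(** * Evaluation of C_n for orders between -1 and 0 *)

Section NegativeOrder.
Context {R : realType}.
Local Notation Re := (@complex.Re R).
Local Notation Im := (@complex.Im R).
Implicit Types (t s x m n p y b : R) (z w v : R[i]).

(** Unrolling the recursion k times leaves the remainder v^k f_k, assumed to vanish in the limit. *)
Lemma csum_iter (u f : nat -> R[i]) v : (forall k, f k = u k + v * f k.+1) ->
  cabs v ^+ k * cabs (f k) @[k --> \oo] --> (0 : R) -> csum (fun k => v ^+ k * u k) (f 0%N).
Proof.
move=> fu lim; have part k : \sum_(0 <= i < k) v ^+ i * u i = f 0%N - v ^+ k * f k.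
  elim: k => [|k IH]; first by rewrite big_geq// mul1r subrr.
  by rewrite big_nat_recr //= IH (fu k) exprSr; ring.
have [c1 c2] : ccvg (fun k => \sum_(0 <= i < k) v ^+ i * u i) (f 0%N).
  apply: ccvg_abs lim _ => k; rewrite part addrAC subrr add0r cabsN.
  by apply: le_trans (cabsM _ _) _; rewrite ler_wpM2r ?cabs_ge0// cabsX.
split.
  apply: cvgn_ext c1 _ erefl => k; rewrite /series/=.
  by elim/big_rec2: _ => // i a b _ ->; rewrite ReD.
apply: cvgn_ext c2 _ erefl => k; rewrite /series/=.
by elim/big_rec2: _ => // i a b _ ->; rewrite ImD.
Qed.

Lemma Gam_reflect n : -1 < n -> n < 0 -> Gam (n + 1) * Gam (- n) = - (pi / sin (pi * n)).
Proof.
move=> n1 n0; have g1 : 0 < Gam (n + 1) by apply: Gam_gt0; lra.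
have g2 : 0 < Gam (- n) by apply: Gam_gt0; lra.
have := @rgamma_reflect R (n + 1); rewrite (_ : 1 - (n + 1) = - n); last by ring.
have h1 : 0 < n + 1 by rewrite -ltrBlDr sub0r.
have h2 : 0 < - n by rewrite oppr_gt0.
rewrite (rgammaE h1) (rgammaE h2).
rewrite mulrDr mulr1 sinDpi -invfM => e.
by rewrite -[LHS]invrK e mulNr invrN invf_div.
Qed.

Lemma prod_rgamma n k : (\prod_(i < k) (n - i%:R)) * rgamma (k%:R - n) = (-1) ^+ k * rgamma (- n).
Proof.
elim: k => [|k IH]; first by rewrite big_ord0 !mul1r sub0r.
rewrite big_ord_recr /= exprS mulN1r mulNr -IH (rgammaS (k%:R - n)).
by rewrite (_ : k.+1%:R - n = k%:R - n + 1); [ring|rewrite -natr1; ring].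
Qed.

Variable L : R[i].
Hypothesis L_pi : `|Im L| < pi.
Let z := cexp L.

(** This is 2 b^(-n/2) z^(n/2) K_n(2 sqrt(bz)) for noninteger n. At integers the division by sin(pi
    n) = 0 makes it 0, and a limit in n takes its place. *)
Definition kap n b : R[i] := (pi / sin (pi * n))%:C *
  ((b `^ (- n))%:C * Ec (- n) (b%:C * z) - cexp (n%:C * L) * Ec n (b%:C * z)).

(** [prod_rgamma] converts the product of the n - i in [I0_erem] into reciprocal gamma values; the
    moments thereby carry the coefficients of E_{-n}. *)
Lemma I0_erem_scale n b k : -1 < n -> n < 0 -> 0 < b ->
  int0 (fun t => t `^ (n - k.+1%:R) * erem n k.+1 (b * t)) /\
  I0 (fun t => t `^ (n - k.+1%:R) * erem n k.+1 (b * t)) =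
  (-1) ^+ k.+1 * (Gam (n + 1) * Gam (- n)) * b `^ (- n) * b ^+ k * (rgamma (- n + k%:R + 1) / k`!%:R).
Proof.
move=> n1 n0 b0; have [i e] := @I0_powR_scale R (n - k.+1%:R) (erem n k.+1) b b0
  (fun t _ => @cont_erem R n k.+1 t) (int0_erem k n1 n0 (lexx n)).
split => //; rewrite e; have h := I0_erem k n1 n0.
have g2 : 0 < Gam (- n) by apply: Gam_gt0; lra.
have pr := prod_rgamma n k.+1; rewrite (rgammaE (x := - n)) in pr; last by lra.
have rk0 : 0 < rgamma (k.+1%:R - n) by apply: rgamma_gt0; have : 0 <= k.+1%:R :> R by []; lra.
have P0 : \prod_(i < k.+1) (n - i%:R) != 0.
  apply/prodf_neq0 => j _; have : 0 <= j%:R :> R by [].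
  by move=> j0; rewrite lt_eqF//; lra.
have -> : - (n - k.+1%:R) - 1 = - n + k%:R by rewrite -natr1; ring.
have -> : - n + k%:R + 1 = k.+1%:R - n by rewrite -natr1; ring.
rewrite powRDx// powR_mulrn ?(ltW b0)//.
have f0 : k`!%:R != 0 :> R by rewrite pnatr_eq0 -lt0n fact_gt0.
apply: (mulfI P0); rewrite mulrCA h.
move: (\prod_(i < _) _) (rgamma (k.+1%:R - n)) (b `^ _) (b ^+ k) (Gam (n + 1)) (Gam (- n)) pr g2 f0
  => P r B Bk g1 g2 pr g20 f0.
have {pr} e1 : (-1) ^+ k.+1 * P * r * g2 = 1.
  have s2 : (-1) ^+ k.+1 * (-1) ^+ k.+1 = 1 :> R by rewrite -exprD addnn -mul2n exprM sqrrN !expr1n.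
  by rewrite -(mulrA _ P) pr mulrA s2 mul1r mulVf ?gt_eqF.
transitivity (B * Bk * g1 / k`!%:R * ((-1) ^+ k.+1 * P * r * g2)); first by rewrite e1 mulr1 mulrA.
by ring.
Qed.

Lemma erem_wt0 n b k : -1 < n -> n < 0 -> 0 < b -> exists2 C : R, 0 <= C & forall t, 0 < t ->
  `|t `^ (n - k%:R) * erem n k (b * t)| <= C * wt n (- (n / 2) - 4^-1) t.
Proof.
move=> n1 n0 b0; case: k => [|k].
  have [C C0 hC] := em_wt n b b0; exists C => // t t0.
  rewrite erem0 subr0 normrM (ger0_norm (powR_ge0 _ _)) /wt [leRHS]mulrCA ler_wpM2l ?powR_ge0//.
  exact: hC.
have [C C0 hC] := erem_wt k n1 n0 (lexx n); set q := - 1 - n / 4 in hC.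
pose c := 1 + b + b^-1; have iv : 0 < b^-1 by rewrite invr_gt0.
exists (b `^ (k.+1%:R) * C * c `^ `|q|) => [|t t0]; first by rewrite !mulr_ge0 ?powR_ge0.
have bt0 : 0 < b * t by exact: mulr_gt0.
have := hC _ bt0; rewrite /wt !powRM ?(ltW b0) ?(ltW t0)// => h.
have bn0 : 0 < b `^ (n - k.+1%:R) by rewrite powR_gt0.
have tb : t = b^-1 * (b * t) by rewrite mulKf// gt_eqF.
have cm : (1 + b * t) `^ q <= c `^ `|q| * (1 + t) `^ q.
  have h1 : 0 <= b * (b * t) by rewrite mulr_ge0 ?ltW.
  have h2 : 0 <= b^-1 * t by rewrite mulr_ge0 ?ltW.
  by apply: powR_cmp; rewrite /c ?[X in X <= _ * (1 + b * t)](_ : _ = 1 + b^-1 * (b * t)) -?tb; lra.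
have cm2 : (1 + t) `^ q <= (1 + t) `^ (- (n / 2) - 4^-1).
  by apply: ler_powR; rewrite /q; lra.
have e : b `^ n = b `^ (n - k.+1%:R) * b `^ k.+1%:R by rewrite -powRDx// subrK.
rewrite -(ler_pM2l bn0); move: h; rewrite -!mulrA normrM (ger0_norm (ltW bn0)) => h.
apply: le_trans h _; rewrite e [X in C * X]mulrC.
have tn0 : 0 <= t `^ n by exact: powR_ge0.
apply: (@le_trans _ _ (C * (b `^ (n - k.+1%:R) * b `^ k.+1%:R * (t `^ n * (c `^ `|q| * (1 + t) `^ (- (n / 2) - 4^-1)))))).
  rewrite ler_wpM2l// mulrC -!mulrA ler_wpM2l ?(ltW bn0)// ler_wpM2l ?powR_ge0// ler_wpM2l//.
  by apply: le_trans cm _; rewrite ler_wpM2l ?powR_ge0.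
by rewrite le_eqVlt; apply/orP; left; apply/eqP; ring.
Qed.

Let fk n b (k : nat) : R[i] := cI (fun t => (t `^ (n - k%:R) * erem n k (b * t))%:C * kz z t).

Lemma cint0_fk n b k : -1 < n -> n < 0 -> 0 < b ->
  cint0 (fun t => (t `^ (n - k%:R) * erem n k (b * t))%:C * kz z t).
Proof.
move=> n1 n0 b0; have [C C0 hC] := erem_wt0 k n1 n0 b0.
apply: (cint0_kz L_pi (p := n) (q := - (n / 2) - 4^-1) (C := C)) => //; first by lra.
by move=> t t0; exact: cont_werem.
Qed.

Lemma cint0_powR_kz n : -1 < n -> n < 0 -> cint0 (fun t => (t `^ n)%:C * kz z t).
Proof.
move=> n1 n0; apply: (cint0_kz L_pi (p := n) (q := 0) (C := 1)) => //; first by lra.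
  by move=> t t0; exact: cont_powR.
by move=> t t0; rewrite ger0_norm ?powR_ge0// /wt powRr0 mulr1 mul1r.
Qed.

(** Splitting off the k-th Taylor term yields the transform of t^n. In the rest one factor t is
    spent on t/(z+t) = 1 - z/(z+t): the 1 gives a moment and -z/(z+t) the next integral. *)
Lemma fk_rec n b k : -1 < n -> n < 0 -> 0 < b ->
  fk n b k = ((rgamma (n + k%:R + 1) / k`!%:R * (- b) ^+ k)%:C * cI (fun t => (t `^ n)%:C * kz z t) +
    (I0 (fun t => t `^ (n - k.+1%:R) * erem n k.+1 (b * t)))%:C) + - z * fk n b k.+1.
Proof.
move=> n1 n0 b0; have [i e] := I0_erem_scale k n1 n0 b0.
have i1 := cint0_fk k.+1 n1 n0 b0; have i2 := cint0_powR_kz n1 n0.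
rewrite /fk -cI_real -!cIZ// -cID; [|exact: cint0Z|exact: cint0_real].
rewrite -cID; [|by apply: cint0D; [exact: cint0Z|exact: cint0_real]|exact: cint0Z].
apply: cI_eq => t t0; have hk := mul_kz L_pi t0; rewrite -/z in hk.
have e1 : erem n k (b * t) = erem n k.+1 (b * t) + rgamma (n + k%:R + 1) / k`!%:R * (- b) ^+ k * t ^+ k.
  by rewrite eremS -(mulrA _ ((- b) ^+ k)) -exprMn mulNr subrK.
have e2 : t `^ n = t `^ (n - k%:R) * t ^+ k.
  by rewrite -powR_mulrn ?(ltW t0)// -powRDx// subrK.
have e3 : t `^ (n - k%:R) = t `^ (n - k.+1%:R) * t.
  by rewrite -{3}(powRr1 (ltW t0)) -powRDx// -natr1; congr (_ `^ _); ring.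
rewrite e1 e2 e3 !rmorphM rmorphD !rmorphM /=.
move: (kz z t) hk => K hK.
set T := t%:C in hK *; set A := (t `^ _)%:C; set B := (erem _ _ _)%:C.
transitivity (A * B * (T * K) + A * T * ((rgamma (n + k%:R + 1))%:C * (k`!%:R^-1)%:C * ((- b) ^+ k)%:C * (t ^+ k)%:C) * K); first by ring.
by rewrite hK; ring.
Qed.

(** The first omitted term in [erem_bound] turns t^(n-k-1) back into t^n, so a single integral
    serves all k. *)
Lemma cabs_fk n b : -1 < n -> n < 0 -> 0 < b -> exists2 J : R, 0 <= J & forall k,
  cabs (fk n b k.+1) <= J * (rgamma (n + k.+1%:R + 1) / k.+1`!%:R * b ^+ k.+1).
Proof.
move=> n1 n0 b0; have [K K0 hK] := kz_bound L_pi.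
have iw : int0 (wt n (-1)) by apply: int0_wt; lra.
exists (K * I0 (wt n (-1))) => [|k].
  by apply: mulr_ge0 => //; apply: I0_ge0 => t _; exact: wt_ge0.
set r := rgamma (n + k.+1%:R + 1) / k.+1`!%:R * b ^+ k.+1; rewrite mulrAC -I0Z//.
apply: cabs_cI; [exact: cint0_fk|exact: int0Z|] => t t0.
have [_ h] := hK t t0; rewrite cabsZ /wt.
rewrite (_ : K * r * (t `^ n * (1 + t) `^ (-1)) = (r * t `^ n) * (K * (1 + t) `^ (-1))); last by ring.
apply: ler_pM; rewrite ?cabs_ge0//.
have k0 : 0 <= k%:R :> R by [].
have bt0 : 0 <= b * t by rewrite mulr_ge0 ?ltW.
rewrite normrM (ger0_norm (powR_ge0 _ _)).
apply: (@le_trans _ _ (t `^ (n - k.+1%:R) * (rgamma (n + k.+1%:R + 1) / k.+1`!%:R * (b * t) ^+ k.+1))).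
  by rewrite ler_wpM2l ?powR_ge0//; apply: erem_bound => //; rewrite -[k.+1%:R]natr1; lra.
rewrite (_ : t `^ n = t `^ (n - k.+1%:R) * t ^+ k.+1); last first.
  by rewrite -powR_mulrn ?(ltW t0)// -powRDx// subrK.
by rewrite /r exprMn le_eqVlt; apply/orP; left; apply/eqP; ring.
Qed.

Lemma CnE n b : -1 < n -> n < 0 -> 0 < b -> Cn L n b = kap n b.
Proof.
(* The Gamma product stays under an opaque name until the reflection formula replaces it by
   -pi/sin(pi n). *)
move=> n1 n0 b0; have [GG GGE] : exists GG, GG = Gam (n + 1) * Gam (- n) by eexists.
have -> : Cn L n b = fk n b 0.
  by apply: cI_eq => t _; rewrite erem0 subr0.
have [J J0 hJ] := cabs_fk n1 n0 b0.
pose u k := (rgamma (n + k%:R + 1) / k`!%:R * (- b) ^+ k)%:C * cI (fun t => (t `^ n)%:C * kz z t) +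
    (I0 (fun t => t `^ (n - k.+1%:R) * erem n k.+1 (b * t)))%:C.
have h1 : csum (fun k => (- z) ^+ k * u k) (fk n b 0).
  apply: (csum_iter (u := u) (f := fk n b) (v := - z)).
    by move=> k; exact: fk_rec.
  have [C C0 hC] := rgamma_bound n.
  rewrite -(cvg_shiftS (fun k => cabs (- z) ^+ k * cabs (fk n b k))).
  have lim0 : (J * C) * ((cabs (- z) * b) ^+ k.+1 / k.+1`!%:R) @[k --> \oo] --> (0 : R).
    have l0 : J * C * 0 = 0 by rewrite mulr0.
    apply: (cvgn_ext _ (fun=> erefl) l0); apply: cvgM; first exact: cvg_cst.
    by rewrite (cvg_shiftS (fun k => (cabs (- z) * b) ^+ k / k`!%:R)); exact: cvg_exp_coeff.
  apply: (squeeze_cvgr _ (cvg_cst 0) lim0); near=> k.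
  rewrite mulr_ge0 ?exprn_ge0 ?cabs_ge0//=.
  have -> : J * C * ((cabs (- z) * b) ^+ k.+1 / k.+1`!%:R) =
     cabs (- z) ^+ k.+1 * (J * (C / k.+1`!%:R * b ^+ k.+1)) by rewrite exprMn; ring.
  rewrite ler_wpM2l ?exprn_ge0 ?cabs_ge0//; apply: le_trans (hJ k) _.
  rewrite ler_wpM2l// ler_wpM2r ?exprn_ge0 ?(ltW b0)// ler_wpM2r//.
  exact: le_trans (ler_norm _) (hC k.+1).
(* The power transforms sum to z^n E_n(bz) and the moments to b^(-n) E_{-n}(bz); in both, the signs
   of (-z)^k cancel. *)
have h2 : csum (fun k => (- z) ^+ k * u k)
   ((GG%:C * cexp (n%:C * L)) * Ec n (b%:C * z) + (- (GG * b `^ (- n)))%:C * Ec (- n) (b%:C * z)).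
  apply: csum_ext (csumD (csumM _ (csum_Ec n (b%:C * z))) (csumM _ (csum_Ec (- n) (b%:C * z)))) => k.
  rewrite /u (I0_erem_scale k n1 n0 b0).2 (cI_powR_kz L_pi)// -GGE.
  rewrite (exprNn z) (exprNn b) exprMn exprS mulN1r !(rmorphM, rmorphN, rmorphXn, rmorphN1) /=.
  have s1 : (-1) ^+ k * (-1) ^+ k = 1 :> R[i] by rewrite -exprD addnn -mul2n exprM sqrrN !expr1n.
  move: ((-1) ^+ k) s1 => s1 hs1; move: (rgamma _)%:C (rgamma _)%:C (k`!%:R^-1)%:C => r1 r2 f.
  move: (z ^+ k) (b%:C ^+ k) (cexp _) GG%:C (b `^ _)%:C => Z B E g Bn.
  transitivity ((s1 * s1) * (g * E * (r2 * f * (B * Z)) + - (g * Bn) * (r1 * f * (B * Z)))).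
    by rewrite hs1; ring.
  by ring.
rewrite (csum_uniq h1 h2) /kap -/z GGE Gam_reflect//.
by rewrite mulNr opprK !rmorphN !rmorphM /=; ring.
Unshelve. all: by end_near. Qed.

End NegativeOrder.

(** * Extension of the second order *)

Section OrderShift.
Context {R : realType}.
Local Notation Re := (@complex.Re R).
Local Notation Im := (@complex.Im R).
Implicit Types (t s x m n p y a b : R) (z w v : R[i]).

Lemma rdc_taylor (f : R -> R[i]) x (d : R[i]) (C e : R) : 0 < e ->
  (forall h, `|h| < e -> cabs (f (x + h) - f x - h%:C * d) <= C * h ^+ 2) -> rdc f x d.
Proof.
move=> e0 hC; split; apply: (@rd_taylor _ _ _ _ C e e0) => h he.
  by have := le_trans (Re_le_cabs _) (hC h he); rewrite !ReD !ReN ReZ.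
by have := le_trans (Im_le_cabs _) (hC h he); rewrite !ImD !ImN ImZ.
Qed.

Lemma rdc_Ec m z b : rdc (fun b => Ec m (b%:C * z)) b (z * Ec (m + 1) (b%:C * z)).
Proof.
have [C C0 hC] := rgamma_bound m.
apply: (@rdc_taylor _ _ _ (C * cabs z ^+ 2 * expR (cabs (b%:C * z) + cabs z)) 1 ltr01) => h h1.
rewrite mulrA rmorphD mulrDl /=; apply: le_trans (Ec_taylor _ _ hC) _.
rewrite cabsZ exprMn real_normK ?num_real//.
have -> : C * cabs z ^+ 2 * expR (cabs (b%:C * z) + cabs z) * h ^+ 2 =
  C * (h ^+ 2 * cabs z ^+ 2) * expR (cabs (b%:C * z) + cabs z) by ring.
rewrite ler_wpM2l//; first by apply: mulr_ge0; [exact: ltW|apply: mulr_ge0; exact: sqr_ge0].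
by rewrite ler_expR lerD2l ler_piMl ?cabs_ge0// ltW.
Qed.

Lemma rdc_near (f g : R -> R[i]) x d (e : R) : 0 < e ->
  (forall y, `|y - x| < e -> f y = g y) -> rdc f x d -> rdc g x d.
Proof.
move=> e0 fg [fa fb]; have nb : \forall y \near x, f y = g y.
  exists e => //= y; rewrite /ball_/= distrC; exact: fg.
split.
  apply: near_eq_is_derive fa; rewrite ?oner_neq0//.
  by apply: filterS nb => y ->.
apply: near_eq_is_derive fb; rewrite ?oner_neq0//.
by apply: filterS nb => y ->.
Qed.

Variable L : R[i].
Hypothesis L_pi : `|Im L| < pi.
Let z := cexp L.

(** Mirrors the derivative -t e_{n+1}(bt) of e_n(bt) in b. The sign comes from sin(pi(n+1)) =
    -sin(pi n), and [EcS] merges the two terms from b^(-n) E_{-n}(bz). *)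
Lemma rdc_kap n b : 0 < b -> rdc (kap L n) b (- kap L (n + 1) b).
Proof.
move=> b0; apply: (@rdc_ext _ (fun b => (pi / sin (pi * n))%:C * ((b `^ (- n))%:C * Ec (- n) (b%:C * z) +
    -1 * (cexp (n%:C * L) * Ec n (b%:C * z))))) => [t|]; first by rewrite /kap mulN1r.
apply: rdc_eq (rdc_mul (rdc_cst (pi / sin (pi * n))%:C b)
  (rdc_add (rdc_mul (rdc_real (rd_powR (- n) b0)) (rdc_Ec (- n) z b))
    (rdc_mul (rdc_cst (-1) b) (rdc_mul (rdc_cst (cexp (n%:C * L)) b) (rdc_Ec n z b))))) _.
have s1 : sin (pi * (n + 1)) = - sin (pi * n) by rewrite mulrDr mulr1 sinDpi.
have s2 : (pi / sin (pi * (n + 1)))%:C = - (pi / sin (pi * n))%:C :> R[i] by rewrite s1 invrN mulrN rmorphN.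
rewrite /kap s2 mul0r add0r [in RHS]mulNr opprK; congr (_ * _).
have bm : b `^ (- 1) = b^-1 by rewrite powRN powRr1// ltW.
rewrite rmorphD /= mulrDl mul1r cexpD -/z opprD.
have := EcS (- n) (b%:C * z); rewrite (powRDx (- n) (- 1) b0) bm => ->.
have h : b%:C * (b^-1)%:C = 1 :> R[i] by rewrite -rmorphM mulfV ?gt_eqF.
rewrite !rmorphM rmorphN /=; move: (b^-1)%:C h => ib hb.
move: (Ec (- n) _) (Ec (- n + 1) _) (Ec (n + 1) _) (Ec n _) (b `^ _)%:C (cexp _) => e1 e2 e3 e4 B E.
transitivity (B * (- n%:C * ib) * e1 + (b%:C * ib) * B * z * e2 - E * z * e3); last by ring.
by rewrite hb; ring.
Qed.

(** The majorant is uniform for second parameters between b/2 and b+1. Differentiation brings a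
    factor t, so integrability now needs n < m. *)
Lemma rdc_Fi m n a b : 0 < a -> 0 < b -> -1 < n -> n < m -> rdc (Fi L m n a) b (- Fi L m (n + 1) a b).
Proof.
move=> a0 b0 n1 nm.
have i1 : cint0 (fun t => (t `^ (n + 1) * (em m (a * t) * em (n + 1) (b * t)))%:C * kz z t).
  by apply: cint0_Fi => //; lra.
have [K K0 hK] := kz_bound L_pi.
have [C C0 hC] := @em_prod_wt _ m (n + 1) (n + 1) a a (b / 2) (b + 1) a0 ltac:(lra).
set q := - ((m + (n + 1) + 1) / 2) in hC.
have iw : int0 (fun t => C * K * wt (n + 1) (q - 1) t) by apply/int0Z/int0_wt; rewrite /q; lra.
rewrite /Fi -cIN//; apply: (@rdc_cI _ (fun b t => (t `^ n * (em m (a * t) * em n (b * t)))%:C * kz z t)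
  (fun b t => - ((t `^ (n + 1) * (em m (a * t) * em (n + 1) (b * t)))%:C * kz z t)) b (b / 2) (b + 1)
  (fun t => C * K * wt (n + 1) (q - 1) t) _ _ _ _ iw); [lra|lra| | |].
- by move=> x x1 x2; apply: cint0_Fi => //; lra.
- move=> x t x1 x2 t0.
  have d := @rd_comp _ (em n) (fun x => x * t) x _ _ (rd_em n (x * t)) (rd_mul (rd_id x) (rd_cst t x)).
  apply: rdc_eq (rdc_mul (rdc_real (rd_mul (rd_cst (t `^ n) x) (rd_mul (rd_cst (em m (a * t)) x) d))) (rdc_cst (kz z t) x)) _.
  rewrite !(mulr0, addr0, mul0r, add0r, mul1r) -mulNr -rmorphN /=; congr (_%:C * _).
  by rewrite (powRDx n 1 t0) powRr1 ?(ltW t0)//; ring.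
- move=> x t x1 x2 t0; rewrite cabsN cabsZ; have [_ h2] := hK t t0.
  have t1 : 0 < 1 + t by lra.
  have -> : C * K * wt (n + 1) (q - 1) t = (C * wt (n + 1) q t) * (K * (1 + t) `^ (-1)).
    by rewrite /wt (powRDx _ (-1) t1); ring.
  by apply: ler_pM => //; [exact: cabs_ge0|apply: hC => //; exact: ltW].
Qed.

(** With a < b strict, the identity holds for all second parameters near b and can be differentiated
    there. *)
Definition stieltjes_holds n := forall m a b, n - 1 < m -> 0 < a -> a < b ->
  Fi L m n a b = kap L n b * Ec m (a%:C * z).

Lemma stieltjes_shift n : -1 < n -> stieltjes_holds n -> stieltjes_holds (n + 1).
Proof.
move=> n1 hn m a b; rewrite addrK => nm a0 ab; have b0 : 0 < b by exact: lt_trans ab.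
have d1 := rdc_Fi a0 b0 n1 nm.
have d2 : rdc (fun x => kap L n x * Ec m (a%:C * z)) b (- kap L (n + 1) b * Ec m (a%:C * z)).
  by apply: rdc_eq (rdc_mul (rdc_kap n b0) (rdc_cst _ b)) _; rewrite mulr0 addr0.
have := rdc_uniq d1 (rdc_near (e := b - a) (f := fun x => kap L n x * Ec m (a%:C * z)) _ _ d2).
rewrite mulNr => /(_ _ _)/oppr_inj; apply; first by rewrite subr_gt0.
move=> y; rewrite ltr_norml => /andP[h _]; rewrite hn//; first by lra.
by lra.
Qed.

Lemma stieltjes_nonint (k : nat) n : k%:R - 1 < n -> n < k%:R -> stieltjes_holds n.
Proof.
elim: k n => [|k IH] n h1 h2.
  move=> m a b nm a0 ab; have b0 : 0 < b by exact: lt_trans ab.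
  by rewrite (@Fi_negative _ _ L_pi n a b)// ?CnE//; lra.
have k0 : 0 <= k%:R :> R by [].
rewrite -natr1 in h1 h2; rewrite -(subrK 1 n); apply: stieltjes_shift; first by lra.
by apply: IH; lra.
Qed.

(** * Continuity in the order, integer orders and the case a = b *)

Lemma rgamma_le2 x : 0 < x -> rgamma x <= 2.
Proof.
have b12 y : 1 <= y -> y <= 2 -> rgamma y <= 2.
  move=> y1 y2; have y0 : 0 < y by lra.
  (* With N = y the interpolation collapses to 1 = Gamma(2) <= y^(2-y) Gamma(y), and y^(2-y) <= 2 on
     [1, 2]. *)
  have := @Gam_interp R y (2 - y) y y0 ltac:(lra) ltac:(lra) y0.
  rewrite (_ : y + (2 - y) = 2%:R); last by ring.
  rewrite (Gam_nat 1) GamS// (_ : 1`!%:R = 1 :> R)//.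
  have -> : (1 - (2 - y)) * Gam y + (2 - y) * (y * Gam y) / y = Gam y.
    by field; rewrite gt_eqF.
  have h : y `^ (2 - y) <= 2.
    rewrite -[leRHS](powRr1 (ler0n _ 2)); apply: (@le_trans _ _ (2 `^ (2 - y))).
      by apply: ge0_ler_powR; rewrite ?nnegrE; lra.
    by apply: ler_powR; lra.
  have g0 := Gam_gt0 y0; rewrite rgammaE// => h2.
  by rewrite -div1r ler_pdivrMr//; apply: le_trans h2 _; rewrite ler_wpM2r// ltW.
move=> x0; suff [] : rgamma x <= 2 /\ rgamma (x + 1) <= 2 by [].
move: x x0; apply: pos_ind.
  move=> x x0 x1; have h := b12 (x + 1) ltac:(lra) ltac:(lra); split => //.
  rewrite rgammaS; apply: le_trans h; rewrite ler_piMl//.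
  by apply/ltW/rgamma_gt0; lra.
move=> x x0 [_ h]; split => //; move: h; rewrite (rgammaS (x + 1)) => h.
have g0 : 0 < rgamma (x + 1 + 1) by apply: rgamma_gt0; lra.
by apply: le_trans h; rewrite ler_peMl ?(ltW g0)//; lra.
Qed.

Lemma cvg_powR_exp (u : nat -> R) x t : 0 < t -> u k @[k --> \oo] --> x -> t `^ u k @[k --> \oo] --> t `^ x.
Proof.
move=> t0 ux; rewrite /powR gt_eqF//.
have h : u k * ln t @[k --> \oo] --> x * ln t by apply: cvgM => //; exact: cvg_cst.
exact: (cvg_comp (fun k => u k * ln t) (@expR R) h (@continuous_expR R _)).
Qed.

Lemma powR_between t p q r : 0 < t -> p <= q -> q <= r -> t `^ q <= t `^ p + t `^ r.
Proof.
move=> t0 pq qr; have [t1|/ltW t1] := leP 1 t.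
  by apply: (@le_trans _ _ (t `^ r)); [exact: ler_powR|rewrite lerDr powR_ge0].
by apply: (@le_trans _ _ (t `^ p)); [exact: powR_le1|rewrite lerDl powR_ge0].
Qed.

Lemma rgamma_cont (u : nat -> R) x : 1 <= x -> (forall k, `|u k - x| <= 2^-1) ->
  u k @[k --> \oo] --> x -> rgamma (u k) @[k --> \oo] --> rgamma x.
Proof.
move=> x1 ux cu; have u0 k : x - 2^-1 <= u k /\ u k <= x + 2^-1.
  by have := ux k; rewrite ler_norml => /andP[]; lra.
have i1 : int0 (fun t => t `^ (x - 2^-1 - 1) * expR (- t)) by apply: int0_powR_exp; lra.
have i2 : int0 (fun t => t `^ (x + 2^-1 - 1) * expR (- t)) by apply: int0_powR_exp; lra.
have [| | |_ cG] := @I0_dct R (fun k t => t `^ (u k - 1) * expR (- t)) (fun t => t `^ (x - 1) * expR (- t)) _ _ (int0D i1 i2).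
- by move=> k; apply: mfun0_cont => t t0; apply: cvgM; [exact: cont_powR|exact: cont_exprN].
- move=> t t0; apply: cvgM; last exact: cvg_cst.
  by apply: cvg_powR_exp => //; apply: cvgB => //; exact: cvg_cst.
- move=> k t t0; rewrite ger0_norm ?mulr_ge0 ?powR_ge0 ?expR_ge0// -mulrDl ler_wpM2r ?expR_ge0//.
  by have [h1 h2] := u0 k; apply: powR_between => //; lra.
rewrite rgammaE; last by lra.
have g0 : Gam x != 0 by rewrite gt_eqF// Gam_gt0//; lra.
apply: (cvgn_ext (cvgV g0 cG) _ erefl) => k.
by rewrite rgammaE//; have [] := u0 k; lra.
Qed.

(** Taylor sums converge term by term by [rgamma_cont], while [erem_bound] with [rgamma_le2] makes
    the tails small uniformly in the order. *)
Lemma em_cont_order (u : nat -> R) x y : 0 <= x -> 0 <= y -> (forall k, `|u k - x| <= 2^-1) ->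
  u k @[k --> \oo] --> x -> em (u k) y @[k --> \oo] --> em x y.
Proof.
move=> x0 y0 ux cu; have u0 k : - 2^-1 <= u k by have := ux k; rewrite ler_norml => /andP[]; lra.
pose S n (N : nat) := \sum_(i < N) (rgamma (n + i%:R + 1) / i`!%:R * (- y) ^+ i).
have cS N : S (u k) N @[k --> \oo] --> S x N.
  elim: N => [|N IH].
    by apply: (cvgn_ext (cvg_cst 0)) => [k|]; rewrite /S big_ord0.
  have -> : S x N.+1 = S x N + rgamma (x + N%:R + 1) / N`!%:R * (- y) ^+ N by rewrite /S big_ord_recr.
  have e k : S (u k) N.+1 = S (u k) N + rgamma (u k + N%:R + 1) / N`!%:R * (- y) ^+ N by rewrite /S big_ord_recr.
  apply: (cvgn_ext _ e erefl); apply: cvgD => //.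
  apply: cvgM; last exact: cvg_cst.
  apply: cvgM; last exact: cvg_cst.
  have N0 : 0 <= N%:R :> R by [].
  apply: rgamma_cont; first by lra.
    by move=> k; rewrite (_ : u k + N%:R + 1 - (x + N%:R + 1) = u k - x)//; ring.
  by apply: cvgD; [apply: cvgD => //; exact: cvg_cst|exact: cvg_cst].
have tail n N : - 2^-1 <= n -> `|em n y - S n N| <= 2 * (y ^+ N / N`!%:R).
  move=> n0; have N0 : 0 <= N%:R :> R by [].
  have nN : - 2^-1 <= n + N%:R by lra.
  apply: le_trans (erem_bound nN y0) _.
  rewrite mulrAC -mulrA ler_wpM2r ?divr_ge0 ?exprn_ge0//; apply: rgamma_le2; lra.
(* Each of the two tails costs twice e/6 and the finite sums cost e/3. *)
apply/cvgrPdist_le => e e0; have e40 : 0 < e / 6 by lra.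
have [N _ hN] : \forall N \near \oo, `|0 - y ^+ N / N`!%:R| <= e / 6.
  by move/cvgrPdist_le : (@cvg_exp_coeff R y); apply.
have hy : y ^+ N / N`!%:R <= e / 6.
  by have := hN N (leqnn N); rewrite /= sub0r normrN; exact: le_trans (ler_norm _).
have e30 : 0 < e / 3 by lra.
move/cvgrPdist_le : (cS N) => /(_ _ e30); apply: filterS => k hk.
have a1 := tail x N ltac:(lra); have a2 := tail (u k) N (u0 k).
have tri (p q r s : R) : p - q = (p - r) + (r - s) - (q - s) by ring.
rewrite (tri _ _ (S x N) (S (u k) N)).
apply: le_trans (ler_normB _ _) _; apply: le_trans (lerD (ler_normD _ _) (lexx _)) _.
apply: le_trans (lerD (lerD a1 hk) a2) _.
by move: (y ^+ N / _) hy; clear; move=> v hv; lra.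
Qed.

(** For m this large the decay of e_m alone gives integrability. The factor of varying order then
    only needs the uniform bound 2, so no decay estimate uniform in that order is required. *)
Lemma Fi_cont_order (u : nat -> R) m x a b : 0 < a -> 0 < b -> 0 <= x -> 2 * x + 1 < m ->
  (forall k, `|u k - x| <= 2^-1) -> u k @[k --> \oo] --> x ->
  ccvg (fun k => Fi L m (u k) a b) (Fi L m x a b).
Proof.
move=> a0 b0 x0 xm ux cu.
have u0 k : x - 2^-1 <= u k /\ u k <= x + 2^-1.
  by have := ux k; rewrite ler_norml => /andP[]; lra.
have [K K0 hK] := kz_bound L_pi; have [C C0 hC] := em_wt m a a0.
set q := - (m / 2) - 4^-1 in hC.
have i1 : int0 (wt (x - 2^-1) (q - 1)) by apply: int0_wt; rewrite /q; lra.
have i2 : int0 (wt (x + 2^-1) (q - 1)) by apply: int0_wt; rewrite /q; lra.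
have iG := int0Z (2 * C * K) (int0D i1 i2).
have [| | |_ //] := @cI_dct R (fun k t => (t `^ (u k) * (em m (a * t) * em (u k) (b * t)))%:C * kz z t)
   (fun t => (t `^ x * (em m (a * t) * em x (b * t)))%:C * kz z t) _ _ iG.
- move=> k; apply: cmfun_cont => t t0; apply: ccontM; last exact: ccont_kz.
  by apply: ccont_real; exact: cont_wemem.
- move=> t t0; apply: ccvgM; last exact: ccvg_cst.
  apply: ccvg_real; apply: cvgM; first exact: cvg_powR_exp.
  apply: cvgM; first exact: cvg_cst.
  by apply: em_cont_order => //; rewrite mulr_ge0 ?ltW.
- move=> k t t0; have [h1 h2] := u0 k; have [_ hk] := hK t t0.
  have t1 : 0 < 1 + t by lra.
  have bt : 0 <= b * t by rewrite mulr_ge0 ?ltW.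
  rewrite cabsZ !normrM (ger0_norm (powR_ge0 _ _)).
  have -> : 2 * C * K * (wt (x - 2^-1) (q - 1) t + wt (x + 2^-1) (q - 1) t) =
    ((t `^ (x - 2^-1) + t `^ (x + 2^-1)) * ((C * (1 + t) `^ q) * 2)) * (K * (1 + t) `^ (-1)).
    by rewrite /wt (powRDx q (-1) t1); ring.
  apply: ler_pM; rewrite ?cabs_ge0//; first by rewrite mulr_ge0 ?powR_ge0// mulr_ge0.
  apply: ler_pM; rewrite ?powR_ge0//; [exact: powR_between|].
  apply: ler_pM => //; first exact: hC.
  apply: le_trans (em_le _ bt) _; first by lra.
  by apply: rgamma_le2; lra.
Qed.

(** The limit of [kap] at an integer is not computed: it is obtained from the convergence of
    F_{m,n}, and the same constant then serves every m and a. *)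
Lemma stieltjes_int (k : nat) b : 0 < b -> exists l : R[i],
  (forall u : nat -> R, (forall i, `|u i - k%:R| <= 2^-1) -> (forall i, u i != k%:R) ->
    u i @[i --> \oo] --> (k%:R : R) -> ccvg (fun i => kap L (u i) b) l) /\
  forall m a, k%:R - 1 < m -> 0 < a -> a < b -> Fi L m k%:R a b = l * Ec m (a%:C * z).
Proof.
move=> b0; have k0 : 0 <= k%:R :> R by [].
have holds (u : nat -> R) i : (forall i, `|u i - k%:R| <= 2^-1) -> (forall i, u i != k%:R) -> stieltjes_holds (u i).
  move=> h1 h2; have := h1 i; rewrite ler_norml => /andP[a1 a2].
  have := h2 i; rewrite neq_lt => /orP[h|h].
    by apply: (stieltjes_nonint (k := k)) => //; lra.
  by apply: (stieltjes_nonint (k := k.+1)); rewrite -natr1; lra.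
pose a1 := b / 2; have a10 : 0 < a1 by rewrite divr_gt0.
have a1b : a1 < b by rewrite /a1; lra.
pose w1 := a1%:C * z.
(* Large enough for [Fi_cont_order], and with m1 + 1 > 2 exp(cabs w1), so that [Ec_large] forces
   E_{m1}(w1) to be nonzero. *)
pose m1 := 2 * k%:R + 2 + 2 * expR (cabs w1).
have E0 : 0 < expR (cabs w1) by exact: expR_gt0.
have m1k : 2 * k%:R + 1 < m1 by rewrite /m1; lra.
have Ec1 : Ec m1 w1 != 0.
  apply/eqP => e; have := @Ec_large R m1 w1 ltac:(lra).
  have g0 : 0 < rgamma (m1 + 1) by apply: rgamma_gt0; lra.
  rewrite e sub0r cabsN cabsC gtr0_norm// => h.
  have : rgamma (m1 + 1) * (m1 + 1) <= 2 * rgamma (m1 + 1) * expR (cabs w1).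
    have m10 : 0 < m1 + 1 by lra.
    rewrite -ler_pdivlMr//; apply: le_trans h _.
    by rewrite le_eqVlt; apply/orP; left; apply/eqP; ring.
  rewrite mulrC (mulrC 2) -mulrA mulrC ler_pM2l// leNgt => /negP; apply.
  by rewrite /m1; lra.
(* At nearby noninteger orders [kap] is this quotient with k replaced by the order, and the
   numerator is continuous in the order. *)
pose l := Fi L m1 k%:R a1 b / Ec m1 w1.
have kl (u : nat -> R) : (forall i, `|u i - k%:R| <= 2^-1) -> (forall i, u i != k%:R) ->
    u i @[i --> \oo] --> (k%:R : R) -> ccvg (fun i => kap L (u i) b) l.
  move=> h1 h2 cu; have c := Fi_cont_order a10 b0 k0 m1k h1 cu.
  apply: ccvg_ext (ccvgM c (ccvg_cst (Ec m1 w1)^-1)) _ erefl => i.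
  rewrite (holds u i h1 h2)//; last by have := h1 i; rewrite ler_norml => /andP[]; lra.
  by rewrite mulfK.
exists l; split => // m a km a0 ab.
pose u i : R := k%:R + 2^-1 * i.+1%:R^-1.
have i1 (i : nat) : 0 < i.+1%:R^-1 :> R by rewrite invr_gt0.
have i2 (i : nat) : i.+1%:R^-1 <= 1 :> R by rewrite invf_le1 ?ler1n.
have u1 i : `|u i - k%:R| <= 2^-1.
  rewrite /u addrAC subrr add0r gtr0_norm ?mulr_gt0// ler_piMr//.
have u2 i : u i != k%:R by rewrite gt_eqF// /u ltrDl mulr_gt0.
have cu : u i @[i --> \oo] --> (k%:R : R).
  have l0 : k%:R + 2^-1 * 0 = k%:R :> R by rewrite mulr0 addr0.
  apply: (cvgn_ext _ (fun=> erefl) l0); apply: cvgD; first exact: cvg_cst.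
  by apply: cvgM; [exact: cvg_cst|exact: cvg_harmonic].
have large m' : 2 * k%:R + 1 < m' -> Fi L m' k%:R a b = l * Ec m' (a%:C * z).
  move=> h; have c := Fi_cont_order a0 b0 k0 h u1 cu.
  apply: ccvg_uniq c (ccvgM (kl u u1 u2 cu) (ccvg_cst _)) _ => i.
  rewrite (holds u i u1 u2)//; have := u1 i; rewrite ler_norml => /andP[]; lra.
(* From index j + 1 on the first order exceeds 2k + 1; the recurrence in m then descends to m
   itself. *)
pose j := Num.truncn (2 * k%:R + 2 - m).
pose A i := Fi L (m + i%:R) k%:R a b; pose B i := Ec (m + i%:R) (a%:C * z).
have rA i : A i = (m + i.+1%:R)%:C * A i.+1 + a%:C * z * A i.+2.
  have i0 : 0 <= i%:R :> R by [].
  rewrite /A -[i.+2%:R]natr1 addrA -Fi_rec//; last by rewrite -natr1; lra.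
    by rewrite -natr1 addrA addrK.
  by lra.
have rB i : B i = (m + i.+1%:R)%:C * B i.+1 + a%:C * z * B i.+2.
  by rewrite /B -[i.+2%:R]natr1 addrA -EcS -natr1 addrA addrK.
have hk i : (j.+1 <= i)%N -> A i = l * B i.
  move=> ji; apply: large; have := truncnS_gt (2 * k%:R + 2 - m); rewrite -/j.
  have : j.+1%:R <= i%:R :> R by rewrite ler_nat.
  lra.
by have := @rec_descend _ _ _ _ A B j.+1 rA rB hk 0%N; rewrite /A /B addr0.
Qed.

(** The integral at a = b still converges absolutely, and parameters increasing to b within [b/2, b)
    share one majorant. *)
Lemma Fi_diag m n b c : -1 < n -> n - 1 < m -> 0 < b ->
  (forall a, 0 < a -> a < b -> Fi L m n a b = c * Ec m (a%:C * z)) ->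
  Fi L m n b b = c * Ec m (b%:C * z).
Proof.
move=> n1 nm b0 h; pose u i : R := b * (1 - 2^-1 * i.+1%:R^-1).
have i1 (i : nat) : 0 < i.+1%:R^-1 :> R by rewrite invr_gt0.
have i2 (i : nat) : i.+1%:R^-1 <= 1 :> R by rewrite invf_le1 ?ler1n.
have ub i : [/\ b / 2 <= u i, u i <= b & u i < b].
  rewrite /u; have := i1 i; have := i2 i; move: (i.+1%:R^-1) => v v1 v0; split.
  - by rewrite ler_wpM2l ?(ltW b0)//; lra.
  - by rewrite ler_piMr ?(ltW b0)//; lra.
  - by rewrite -[ltRHS]mulr1 ltr_pM2l//; lra.
have cu : u i @[i --> \oo] --> b.
  have l0 : b * (1 - 2^-1 * 0) = b by rewrite mulr0 subr0 mulr1.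
  apply: (cvgn_ext _ (fun=> erefl) l0); apply: cvgM; first exact: cvg_cst.
  apply: cvgB; first exact: cvg_cst.
  by apply: cvgM; [exact: cvg_cst|exact: cvg_harmonic].
have [C C0 hC] := @em_prod_wt _ m n n (b / 2) b b b ltac:(lra) b0.
have [K K0 hK] := kz_bound L_pi; set q := - ((m + n + 1) / 2) in hC.
have iw : int0 (wt n (q - 1)) by apply: int0_wt; rewrite /q; lra.
have [| | |_ c1] := @cI_dct R (fun k t => (t `^ n * (em m (u k * t) * em n (b * t)))%:C * kz z t)
   (fun t => (t `^ n * (em m (b * t) * em n (b * t)))%:C * kz z t) _ _ (int0Z (C * K) iw).
- move=> k; have [h1 h2 h3] := ub k; apply: cmfun_cont => t t0; apply: ccontM; last exact: ccont_kz.
  by apply: ccont_real; apply: cont_wemem => //; lra.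
- move=> t t0; apply: ccvgM; last exact: ccvg_cst.
  apply: ccvg_real; apply: cvgM; first exact: cvg_cst.
  apply: cvgM; last exact: cvg_cst.
  have cut : u i * t @[i --> \oo] --> b * t by apply: cvgM => //; exact: cvg_cst.
  exact: (cvg_comp (fun i => u i * t) (em m) cut (@cont_em _ m (b * t))).
- move=> k t t0; have [h1 h2 h3] := ub k; have [_ hk] := hK t t0.
  rewrite cabsZ; have t1 : 0 < 1 + t by lra.
  have -> : C * K * wt n (q - 1) t = (C * wt n q t) * (K * (1 + t) `^ (-1)).
    by rewrite /wt (powRDx _ (-1) t1); ring.
  by apply: ler_pM => //; [exact: cabs_ge0|exact: hC].
have [e1 e2] := rdc_cont (rdc_Ec m z b).
have c2 : ccvg (fun k => c * Ec m ((u k)%:C * z)) (c * Ec m (b%:C * z)).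
  apply: ccvgM; first exact: ccvg_cst.
  split; first exact: (cvg_comp u (fun b => Re (Ec m (b%:C * z))) cu e1).
  exact: (cvg_comp u (fun b => Im (Ec m (b%:C * z))) cu e2).
apply: ccvg_uniq c1 c2 _ => k; have [h1 h2 h3] := ub k.
by rewrite -h//; lra.
Qed.

End OrderShift.

(** * Translation to the Bessel functions *)

Section BesselTranslation.
Context {R : realType}.
Local Notation Re := (@complex.Re R).
Local Notation Im := (@complex.Im R).
Implicit Types (t s x m n p y a b mu nu : R) (z w v L : R[i]).

Lemma cexp_clog z : z != 0 -> cexp (clog z) = z.
Proof.
move=> z0; have r0 := normc_gt0 z0; have rE := normc_sqr z; have Rr := Re_normc z.
rewrite /clog /carg; set r := Normc.normc z in r0 rE Rr *.
have xb : -1 <= Re z / r <= 1.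
  by rewrite -ler_norml normrM normfV (gtr0_norm r0) ler_pdivrMr// mul1r.
(* The sine of the arccosine only recovers |Im z|; the two branches of [carg] restore the sign. *)
have s2 : Num.sqrt (1 - (Re z / r) ^+ 2) = `|Im z| / r.
  have -> : 1 - (Re z / r) ^+ 2 = (`|Im z| / r) ^+ 2.
    rewrite !exprMn real_normK ?num_real// (_ : Im z ^+ 2 = r ^+ 2 - Re z ^+ 2); last by rewrite rE; ring.
    by field; rewrite gt_eqF.
  by rewrite sqrtr_sqr ger0_norm// divr_ge0// ltW.
have acK : cos (acos (Re z / r)) = Re z / r by rewrite acosK// in_itv.
apply: complexP; rewrite /cexp ?ReZ ?ImZ /= lnK ?posrE//.
  by case: ifP => _; rewrite ?cosN acK mulrC divfK// gt_eqF.
case: ifP => h; rewrite ?sinN sin_acos// s2 ?mulrN mulrC divfK ?gt_eqF//.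
  by rewrite ger0_norm.
by rewrite ltr0_norm ?opprK// ltNge h.
Qed.

Lemma clog_cexp w : `|Im w| < pi -> clog (cexp w) = w.
Proof.
rewrite ltr_norml => /andP[w1 w2]; apply: complexP.
  by rewrite -[LHS]/(ln (Normc.normc (cexp w))) normc_cexp expRK.
rewrite -[LHS]/(carg (cexp w)).
have e0 := expR_gt0 (Re w).
rewrite /carg normc_cexp Re_cexp /cexp ImZ /= pmulr_rge0// mulrC mulKf ?gt_eqF//.
have [i0|i0] := leP 0 (Im w).
  have -> : 0 <= sin (Im w) by apply: sin_ge0_pi; rewrite i0 ltW.
  by rewrite cosK// in_itv/= i0 ltW.
have : 0 < sin (- Im w) by apply: sin_gt0_pi; rewrite oppr_gt0 i0 ltrNl.
rewrite sinN oppr_gt0 ltNge => /negbTE ->.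
by rewrite cosKN ?opprK// (ltW i0) andbT ltW.
Qed.

Lemma cpow_cexp w x : `|Im w| < pi -> cpow (cexp w) x = cexp (x%:C * w).
Proof. by move=> h; rewrite /cpow clog_cexp. Qed.

Lemma cexp_real x : cexp x%:C = (expR x)%:C :> R[i].
Proof. by rewrite /cexp /= cos0 sin0; apply: complexP => /=; ring. Qed.

Lemma cexp_ln a : 0 < a -> cexp (ln a)%:C = a%:C :> R[i].
Proof. by move=> a0; rewrite cexp_real lnK. Qed.

Lemma cexp_powR a x : 0 < a -> cexp (x%:C * (ln a)%:C) = (a `^ x)%:C :> R[i].
Proof. by move=> a0; rewrite -rmorphM cexp_real /powR gt_eqF. Qed.

(** Both sides have the same square; |Im L|/2 < pi/2 makes the real part of the right side positive,
    which excludes the opposite sign. *)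
Lemma sqrtc_cexp L : `|Im L| < pi -> sqrtc (cexp L) = cexp (L / 2).
Proof.
move=> Lp; have R2 w : w / 2 = (2^-1)%:C * w by rewrite mulrC fmorphV rmorph_nat.
have s2 : sqrtc (cexp L) ^+ 2 = cexp (L / 2) ^+ 2.
  by rewrite sqr_sqrtc expr2 -cexpD -splitr.
have c0 : 0 < Re (cexp (L / 2)).
  rewrite Re_cexp R2 ImZ pmulr_rgt0 ?expR_gt0//.
  apply: cos_gt0_pihalf; move: Lp; rewrite ltr_norml => /andP[l1 l2].
  by apply/andP; split; move: (pi : R) (Im L) l1 l2 => P I; lra.
have s0 : 0 <= Re (sqrtc (cexp L)) by rewrite /sqrtc; case: (cexp L) => x y /=; exact: sqrtr_ge0.
move/eqP: s2; rewrite eqf_sqr => /orP[/eqP//|/eqP e].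
by move: s0; rewrite e ReN oppr_ge0 leNgt c0.
Qed.

Section order.
Variables (L : R[i]).
Hypothesis L_pi : `|Im L| < pi.
Let z := cexp L.

Lemma half_sqrtc a : 0 < a -> exists2 w, `|Im w| < pi & a%:C * sqrtc z / 2 = cexp w /\
  (forall x, cexp (x%:C * w) = ((a / 2) `^ x)%:C * cexp ((x / 2)%:C * L)) /\
  cexp w ^+ 2 = ((a / 2) ^+ 2)%:C * z.
Proof.
move=> a0; have a20 : 0 < a / 2 by rewrite divr_gt0.
have R2 v : v / 2 = (2^-1)%:C * v by rewrite mulrC fmorphV rmorph_nat.
have e1 : cexp ((ln (a / 2))%:C + L / 2) = (a / 2)%:C * cexp (L / 2) by rewrite cexpD cexp_ln.
exists ((ln (a / 2))%:C + L / 2).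
  rewrite ImD /= add0r R2 ImZ normrM (ger0_norm (_ : 0 <= 2^-1)) ?invr_ge0//.
  by move: (pi : R) `|Im L| L_pi (normr_ge0 (Im L)) => P l; lra.
split; last split.
- by rewrite sqrtc_cexp// e1 rmorphM fmorphV rmorph_nat mulrAC.
- by move=> x; rewrite mulrDr cexpD cexp_powR// R2 mulrA -rmorphM.
- by rewrite e1 exprMn rmorphXn; congr (_ * _); rewrite expr2 -cexpD -splitr.
Qed.

Lemma besselI_E mu a : 0 < a -> besselI mu (a%:C * sqrtc z) =
  ((a / 2) `^ mu)%:C * cexp ((mu / 2)%:C * L) * Ec mu (((a / 2) ^+ 2)%:C * z).
Proof.
move=> a0; have [w wp [e1 [e2 e3]]] := half_sqrtc a0.
rewrite /besselI e1 cpow_cexp// e2 EcE; congr (_ * cseries _).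
by apply/funext => k; rewrite exprM e3.
Qed.

Lemma besselJ_E mu a t : 0 < a -> 0 < t -> besselJ mu (a * Num.sqrt t)%:C =
  ((a / 2) `^ mu * t `^ (mu / 2) * em mu ((a / 2) ^+ 2 * t))%:C.
Proof.
move=> a0 t0; have s0 : 0 < Num.sqrt t by rewrite sqrtr_gt0.
have c0 : 0 < a / 2 * Num.sqrt t by rewrite mulr_gt0// divr_gt0.
have h : (a * Num.sqrt t)%:C / 2 = (a / 2 * Num.sqrt t)%:C :> R[i].
  by rewrite !rmorphM fmorphV rmorph_nat mulrAC.
rewrite /besselJ h [RHS]rmorphM /= -emC EcE; congr (_ * cseries _).
  rewrite -{1}(cexp_ln c0) cpow_cexp ?normr0 ?pi_gt0// cexp_powR//; congr (_%:C).
  rewrite powRM ?sqrtr_ge0 ?divr_ge0 ?(ltW a0)//; congr (_ * _).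
  by rewrite -powR12_sqrt ?(ltW t0)// -powRrM; congr (_ `^ _); rewrite mulrC.
apply/funext => k; rewrite exprM -rmorphXn exprMn sqr_sqrtr ?(ltW t0)//.
rewrite -!rmorphXn -!rmorphM; congr (_%:C).
rewrite (exprNn ((a / 2) ^+ 2 * t)); move: ((-1) ^+ k) (((a / 2) ^+ 2 * t) ^+ k) => S P.
by ring.
Qed.

Lemma besselK_nonint_E x b : 0 < b -> besselK_nonint x (b%:C * sqrtc z) =
  (2^-1 * (b / 2) `^ x)%:C * cexp (- (x / 2)%:C * L) * kap L x ((b / 2) ^+ 2).
Proof.
move=> b0; have b20 : 0 < b / 2 by rewrite divr_gt0.
rewrite /besselK_nonint !besselI_E// /kap -/z -powR_mulrn ?(ltW b20)// -powRrM.
have e1 : (b / 2) `^ (- x) = (b / 2) `^ x * (b / 2) `^ (2 * - x).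
  by rewrite -powRDx//; congr (_ `^ _); ring.
have e2 : cexp ((x / 2)%:C * L) = cexp (- (x / 2)%:C * L) * cexp (x%:C * L).
  rewrite -cexpD; congr cexp; rewrite -mulrDl -rmorphN -rmorphD; congr (_%:C * _); by field.
have e3 : (- x / 2)%:C = - (x / 2)%:C :> R[i] by rewrite mulNr rmorphN.
rewrite e1 e2 e3 (mulrC x pi); move: (cexp _) (cexp _) => X Y.
have c1 : (pi / 2)%:C = pi%:C * (2^-1)%:C :> R[i] by rewrite rmorphM.
have c2 : (pi / sin (pi * x))%:C = pi%:C * (sin (pi * x))%:C^-1 :> R[i] by rewrite rmorphM fmorphV.
by rewrite c1 c2 !rmorphM /=; ring.
Qed.

End order.
End BesselTranslation.

(** * The Stieltjes representation for I, K and J *)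

Section StieltjesBessel.
Context {R : realType}.
Local Notation Re := (@complex.Re R).
Local Notation Im := (@complex.Im R).
Implicit Types (t s x m n p y a b mu nu : R).
Variables (L : R[i]).
Hypothesis L_pi : `|Im L| < pi.
Let z := cexp L.

Lemma int_gtN1 nu : -1 < nu -> nu \is a Num.int -> exists k : nat, nu = k%:R.
Proof.
move=> n1 /intrP[i e]; have : (-1 < i)%R by rewrite -(ltr_int R) -e rmorphN1.
by case: i e => [k e _|k _]; [exists k|rewrite NegzE].
Qed.

Lemma nonint_between nu : -1 < nu -> nu \isn't a Num.int -> exists k : nat, k%:R - 1 < nu /\ nu < k%:R.
Proof.
move=> n1 ni; have [n0|n0] := ltP nu 0; first by exists 0%N; split => //; lra.
exists (Num.truncn nu).+1; have := truncn_itv n0 => /andP[h1 h2]; split => //.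
rewrite -natr1 addrK lt_neqAle h1 andbT; apply: contraNneq ni => <-; exact: intr_nat.
Qed.

Let coef b x : R[i] := (2^-1 * (b / 2) `^ x)%:C * cexp (- (x / 2)%:C * L).

Lemma ccvg_coef b nu (u : nat -> R) : 0 < b -> u i @[i --> \oo] --> nu ->
  ccvg (fun i => coef b (u i)) (coef b nu).
Proof.
move=> b0 cu; apply: ccvgM.
  apply: ccvg_real; apply: cvgM; first exact: cvg_cst.
  by apply: cvg_powR_exp => //; rewrite divr_gt0.
have e x : cexp (- (x / 2)%:C * L) = cexp (x%:C * (- (2^-1)%:C * L)).
  by congr cexp; rewrite rmorphM /=; ring.
have [e1 e2] := rdc_cont (rdc_cexp (- (2^-1)%:C * L) nu).
apply: ccvg_ext (_ : ccvg (fun i => cexp ((u i)%:C * (- (2^-1)%:C * L))) (cexp (nu%:C * (- (2^-1)%:C * L)))) _ (esym (e nu)).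
  split; first exact: (cvg_comp u (fun x => Re (cexp (x%:C * (- (2^-1)%:C * L)))) cu e1).
  exact: (cvg_comp u (fun x => Im (cexp (x%:C * (- (2^-1)%:C * L)))) cu e2).
by move=> i; rewrite e.
Qed.

(** Treats both cases of the definition of K alike: c is [kap] at noninteger orders and its limit at
    integers. *)
Lemma besselK_E nu b : -1 < nu -> 0 < b -> exists c : R[i],
  besselK nu (b%:C * sqrtc z) = coef b nu * c /\
  forall m a, nu - 1 < m -> 0 < a -> a < (b / 2) ^+ 2 -> Fi L m nu a ((b / 2) ^+ 2) = c * Ec m (a%:C * z).
Proof.
move=> n1 b0; have be0 : 0 < (b / 2) ^+ 2 by rewrite exprn_gt0// divr_gt0.
rewrite /besselK; case: (boolP (nu \is a Num.int)) => ni; last first.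
  have [k [h1 h2]] := nonint_between n1 ni.
  exists (kap L nu ((b / 2) ^+ 2)); split; first by rewrite besselK_nonint_E.
  by move=> m a nm a0 ab; apply: (stieltjes_nonint L_pi h1 h2).
have [k nk] := int_gtN1 n1 ni.
have [l [cl hl]] := stieltjes_int L_pi k be0.
exists l; split; last by rewrite nk.
have cv (u : nat -> R) : (forall i, u i != nu) -> u i @[i --> \oo] --> nu ->
    ccvg (fun i => besselK_nonint (u i) (b%:C * sqrtc z)) (coef b nu * l).
  move=> un cu.
  (* [stieltjes_int] asks for orders within 1/2 of the integer at every index, so the first N terms
     are dropped. *)
  have [N _ hN] : \forall n \near \oo, `|nu - u n| <= 2^-1.
    by move/cvgrPdist_le : cu; apply; rewrite invr_gt0.
  have cuN : u (i + N)%N @[i --> \oo] --> nu by rewrite (cvg_shiftn N u).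
  have c1 : ccvg (fun i => kap L (u (i + N)%N) ((b / 2) ^+ 2)) l.
    apply: cl; rewrite -?nk// => i; rewrite distrC; apply: hN; exact: leq_addl.
  have [r1 r2] := ccvgM (ccvg_coef b0 cuN) c1.
  split.
    rewrite -(cvg_shiftn N (fun i => Re (besselK_nonint (u i) (b%:C * sqrtc z)))).
    by apply: cvgn_ext r1 _ erefl => i; exact: (congr1 Re) (besselK_nonint_E L_pi (u (i + N)%N) b0).
  rewrite -(cvg_shiftn N (fun i => Im (besselK_nonint (u i) (b%:C * sqrtc z)))).
  by apply: cvgn_ext r2 _ erefl => i; exact: (congr1 Im) (besselK_nonint_E L_pi (u (i + N)%N) b0).
have l1 : Re (besselK_nonint x (b%:C * sqrtc z)) @[x --> nu^'] --> Re (coef b nu * l).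
  by apply/cvgr_dnbhsP => u [un cu]; have [] := cv u un cu.
have l2 : Im (besselK_nonint x (b%:C * sqrtc z)) @[x --> nu^'] --> Im (coef b nu * l).
  by apply/cvgr_dnbhsP => u [un cu]; have [] := cv u un cu.
by apply: complexP => /=; [exact: cvg_lim l1|exact: cvg_lim l2].
Qed.

Variables (a b mu nu : R).
Hypotheses (a0 : 0 < a) (ab : a <= b) (mu1 : -1 < mu) (nu1 : -1 < nu) (numu : nu - mu < 1).
Let b0 : 0 < b. Proof. exact: lt_le_trans ab. Qed.

(** The factors t^(mu/2) and t^(nu/2) of the two J merge with t^((nu-mu)/2) into t^nu; what remains
    is real and measurable on the whole line. *)
Definition bessel_prod t : R := (a / 2) `^ mu * (b / 2) `^ nu *
  (t `^ nu * (em mu ((a / 2) ^+ 2 * t) * em nu ((b / 2) ^+ 2 * t))).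

Lemma bessel_prodE t : 0 < t -> (t `^ ((nu - mu) / 2))%:C * besselJ mu (a * Num.sqrt t)%:C *
  besselJ nu (b * Num.sqrt t)%:C = (bessel_prod t)%:C.
Proof.
move=> t0; rewrite !besselJ_E// -!rmorphM; congr (_%:C); rewrite /bessel_prod.
have -> : t `^ nu = t `^ ((nu - mu) / 2) * t `^ (mu / 2) * t `^ (nu / 2).
  by rewrite -!powRDx//; congr (_ `^ _); field.
by ring.
Qed.

Lemma cint0_bessel_prod : cint0 (fun t => (bessel_prod t)%:C * kz z t) /\
  cI (fun t => (bessel_prod t)%:C * kz z t) =
  ((a / 2) `^ mu * (b / 2) `^ nu)%:C * Fi L mu nu ((a / 2) ^+ 2) ((b / 2) ^+ 2).
Proof.
have al0 : 0 < (a / 2) ^+ 2 by rewrite exprn_gt0// divr_gt0.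
have be0 : 0 < (b / 2) ^+ 2 by rewrite exprn_gt0// divr_gt0.
have i1 := @cint0_Fi _ _ L_pi mu nu nu _ _ al0 be0 nu1 ltac:(move: (numu); lra).
have e t : ((a / 2) `^ mu * (b / 2) `^ nu)%:C * ((t `^ nu * (em mu ((a / 2) ^+ 2 * t) * em nu ((b / 2) ^+ 2 * t)))%:C * kz z t) =
  (bessel_prod t)%:C * kz z t by rewrite mulrA -rmorphM.
split; first by apply: cint0_eq (cint0Z _ i1) => t _; exact: e.
by rewrite /Fi -(cIZ _ i1); apply: cI_eq => t _; rewrite -e.
Qed.

Lemma stieltjes_bessel :
  cpow z ((nu - mu) / 2) * besselI mu (a%:C * sqrtc z) * besselK nu (b%:C * sqrtc z) =
  1 / 2 * cI (fun t => (bessel_prod t)%:C * kz z t).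
Proof.
have [c [-> hc]] := besselK_E nu1 b0; rewrite cint0_bessel_prod.2.
have al0 : 0 < (a / 2) ^+ 2 by rewrite exprn_gt0// divr_gt0.
have be0 : 0 < (b / 2) ^+ 2 by rewrite exprn_gt0// divr_gt0.
have nm : nu - 1 < mu by move: (numu); lra.
have -> : Fi L mu nu ((a / 2) ^+ 2) ((b / 2) ^+ 2) = c * Ec mu (((a / 2) ^+ 2)%:C * z).
  move: (ab); rewrite le_eqVlt => /predU1P[e|lt].
    by rewrite e; apply: Fi_diag => // x x0 xb; exact: hc.
  by apply: hc => //; rewrite ltr_sqr ?nnegrE ?divr_ge0 ?ltW// ltr_pM2r.
rewrite besselI_E// cpow_cexp// /coef.
have e1 : cexp (((nu - mu) / 2)%:C * L) * cexp ((mu / 2)%:C * L) * cexp (- (nu / 2)%:C * L) = 1.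
  rewrite -!cexpD -!mulrDl -rmorphN -!rmorphD (_ : _ + _ + _ = 0) ?mul0r ?cexp0//; by field.
have c1 : ((a / 2) `^ mu * (b / 2) `^ nu)%:C = ((a / 2) `^ mu)%:C * ((b / 2) `^ nu)%:C :> R[i] by rewrite rmorphM.
have c2 : (2^-1 * (b / 2) `^ nu)%:C = 2^-1 * ((b / 2) `^ nu)%:C :> R[i] by rewrite rmorphM fmorphV rmorph_nat.
rewrite c1 c2; move: (cexp _) (cexp (_ * L)) (cexp (_ * L)) e1 => X Y W e1.
move: (Ec _ _) ((_ `^ mu)%:C) ((_ `^ nu)%:C) => E P Q.
transitivity ((W * Y * X) * (P * E * (2^-1 * Q) * c)); first by ring.
by rewrite e1; ring.
Qed.

End StieltjesBessel.

(** * The iterated Laplace transform *)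

Section IteratedLaplace.
Context {R : realType}.
Local Notation mu := (@lebesgue_measure R).
Local Notation Re := (@complex.Re R).
Local Notation Im := (@complex.Im R).
Implicit Types (t s x A : R).

Lemma expRN_le s t : 0 < s -> 0 < t -> expR (- (s * t)) <= (1 + s^-1) * (1 + t)^-1.
Proof.
move=> s0 t0; have st : 0 < s * t by exact: mulr_gt0.
have i0 : 0 < s^-1 by rewrite invr_gt0.
have t1 : 0 < 1 + t by lra.
rewrite expRN ler_pdivlMr// mulrC ler_pdivrMr ?expR_gt0//.
apply: (@le_trans _ _ ((1 + s^-1) * (1 + s * t))).
  by rewrite mulrDl mul1r mulrDr mulr1 mulrA mulVf ?gt_eqF// mul1r; lra.
by rewrite ler_wpM2l ?expR_ge1Dx//; lra.
Qed.

Variable h : R -> R.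
Hypothesis mh : measurable_fun setT h.
Hypothesis ih : int0 (fun t => `|h t| * (1 + t)^-1).

Lemma mh0 : mfun0 h. Proof. exact: measurable_funS mh. Qed.

Lemma int0_laplace s : 0 < s -> int0 (fun t => expR (- (s * t)) * h t).
Proof.
move=> s0; apply: (int0_le _ (int0Z (1 + s^-1) ih)).
  apply: measurable_funM; last exact: mh0.
  by apply: mfun0_cont => t _; exact: cont_expN.
move=> t t0; rewrite normrM (ger0_norm (expR_ge0 _)) mulrCA mulrC ler_wpM2l//.
exact: expRN_le.
Qed.

Definition lap s := I0 (fun t => expR (- (s * t)) * h t).

Lemma int_itv_I0 A (k : R -> R) : \int[mu]_(s in `]0, A[) k s = I0 (fun s => k s * \1_(`]0, A[) s).
Proof.
have sub : (`]0, A[%classic : set R) `<=` pos.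
  by move=> s; rewrite /= posE in_itv/= => /andP[].
have -> : I0 (fun s => k s * \1_(`]0, A[%classic) s) = I0 (k \_ `]0, A[).
  by apply: I0_eq => s _; rewrite patchE indicE; case: ifP => _; rewrite ?mulr1 ?mulr0.
by rewrite /I0 -Rintegral_mkcondr setIidr.
Qed.

(** Here r stands for the real or the imaginary part of exp(-z s), so that Fubini is only needed for
    real functions. *)
Lemma lap_fubini (r : R -> R) A : 0 < A -> measurable_fun setT r -> (forall s, 0 < s -> `|r s| <= 1) ->
  mu.-integrable `]0, A[ (fun s => (r s * lap s)%:E) /\
  \int[mu]_(s in `]0, A[) (r s * lap s) =
  I0 (fun t => h t * \int[mu]_(s in `]0, A[) (r s * expR (- (s * t)))).
Proof.
move=> A0 mr r1; pose F t s := h t * (r s * expR (- (s * t)) * \1_(`]0, A[%classic) s).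
have iE c : 0 < c -> int0 (fun s => expR (- (c * s))) /\ I0 (fun s => expR (- (c * s))) = c^-1.
  move=> c0; have [|i e] := @I0_powR_expM R 0 c _ c0; first by lra.
  split; first by apply: int0_eq i => s _; rewrite powRr0 mul1r.
  rewrite -[LHS](_ : I0 (fun s => s `^ 0 * expR (- (c * s))) = _); last first.
    by apply: I0_eq => s _; rewrite powRr0 mul1r.
  by rewrite e add0r Gam1 mulr1 oppr0 sub0r powRN powRr1// ltW.
have mF : measurable_fun setT (fun x : R * R => F x.1 x.2).
  apply: measurable_funM; first exact: (measurableT_comp mh measurable_fst).
  apply: measurable_funM; last first.
    apply: (measurableT_comp _ measurable_snd); apply: measurable_indic; exact: measurable_itv.
  apply: measurable_funM; first exact: (measurableT_comp mr measurable_snd).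
  apply: (measurableT_comp (@measurable_expR R)); apply: measurableT_comp => //.
  by apply: measurable_funM; [exact: measurable_snd|exact: measurable_fst].
(* On s < A one may insert exp(A - s) >= 1; integration over s then gives e^A/(1+t), exactly the
   weight against which |h| is integrable. *)
have sec t s : 0 < t -> 0 < s -> `|r s * expR (- (s * t)) * \1_(`]0, A[%classic) s| <= expR A * expR (- ((1 + t) * s)).
  move=> t0 s0; rewrite indicE; case: (boolP (s \in _)) => sA; last first.
    by rewrite mulr0 normr0 mulr_ge0 ?expR_ge0.
  have : s < A by move: sA; rewrite inE /= in_itv/= => /andP[].
  move=> sA'; rewrite mulr1 normrM (ger0_norm (expR_ge0 _)) -expRD -[leRHS]mul1r.
  apply: ler_pM; [exact: normr_ge0|exact: expR_ge0|exact: r1|].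
  by rewrite ler_expR mulrDl mul1r (mulrC t); lra.
have mFt t : measurable_fun setT (F t).
  apply: measurable_funM; first exact: measurable_cst.
  apply: measurable_funM; last by apply: measurable_indic; exact: measurable_itv.
  apply: measurable_funM => //; apply: (measurableT_comp (@measurable_expR R)).
  by apply: measurableT_comp => //; apply: measurable_funM => //; exact: measurable_cst.
have F1 t : 0 < t -> int0 (F t).
  move=> t0; have t1 : 0 < 1 + t by lra.
  apply: (int0_le _ (int0Z (`|h t| * expR A) (iE _ t1).1)); first exact: measurable_funS (mFt t).
  by move=> s s0; rewrite /F normrM -[leRHS]mulrA ler_wpM2l// sec.
have eF t s : F t s = r s * \1_(`]0, A[%classic) s * (expR (- (s * t)) * h t).
  by rewrite /F; ring.
have F2 s : 0 < s -> int0 (fun t => F t s).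
  move=> s0; apply: int0_eq (int0Z (r s * \1_(`]0, A[%classic) s) (int0_laplace s0)) => t _.
  by rewrite eF.
have F3 : exists2 H, int0 H & forall t, 0 < t -> I0 (fun s => `|F t s|) <= H t.
  exists (fun t => expR A * (`|h t| * (1 + t)^-1)); first exact: int0Z.
  move=> t t0; have t1 : 0 < 1 + t by lra.
  have [i e] := iE _ t1.
  have -> : expR A * (`|h t| * (1 + t)^-1) = I0 (fun s => (`|h t| * expR A) * expR (- ((1 + t) * s))).
    by rewrite (I0Z _ i) e; ring.
  apply: le_I0; [exact: int0_norm (F1 t t0)|exact: int0Z|].
  by move=> s s0; rewrite /F normrM -[leRHS]mulrA ler_wpM2l// sec.
have e2 s : 0 < s -> I0 (fun t => F t s) = (r s * lap s) * \1_(`]0, A[%classic) s.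
  move=> s0; rewrite (I0_eq (fun t _ => eF t s)) (I0Z _ (int0_laplace s0)) -/(lap s).
  by rewrite mulrAC.
have e1 t : 0 < t -> I0 (F t) = h t * \int[mu]_(s in `]0, A[) (r s * expR (- (s * t))).
  move=> t0; rewrite int_itv_I0 -I0Z//.
  have t1 : 0 < 1 + t by lra.
  apply: (int0_le _ (int0Z (expR A) (iE _ t1).1)).
    apply: measurable_funM; last by apply: measurable_funTS; apply: measurable_indic; exact: measurable_itv.
    apply: measurable_funM; first exact: measurable_funTS.
    apply: (@eq_measurable_fun _ _ _ _ _ (fun s => expR (- (t * s)))).
      by move=> s _; rewrite mulrC.
    by apply: mfun0_cont => s _; exact: cont_expN.
  by move=> s s0; exact: sec.
have sub : (`]0, A[%classic : set R) `<=` pos by move=> s; rewrite /= posE in_itv/= => /andP[].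
have [_ i2 e] := fubini0 mF F1 F2 F3; split; last first.
  by rewrite -(I0_eq e1) e int_itv_I0; apply: I0_eq => s s0; rewrite e2.
clear e F3 F1 F2 mF mFt e1.
have i3 : mu.-integrable `]0, A[ (EFin \o (fun s => I0 (fun t => F t s))).
  by apply: (integrableS _ _ _ i2) => //; exact: measurable_pos.
apply: (@eq_integrable _ _ _ mu _ _ _ _ _ i3) => [|s sA]; first exact: measurable_itv.
have s0 : 0 < s by move: sA => /set_mem/sub; rewrite posE.
by rewrite /= (e2 s s0) indicE sA mulr1.
Qed.

Variable z : R[i].
Hypothesis Rz : 0 <= Re z.
Hypothesis zt : forall t, 0 < t -> z + t%:C != 0.

Lemma int_cexp A t : 0 < A -> 0 < t ->
  \int[mu]_(s in `]0, A[) (Re (cexp (- z * s%:C)) * expR (- (s * t))) = Re ((1 - cexp (A%:C * - (z + t%:C))) * kz z t) /\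
  \int[mu]_(s in `]0, A[) (Im (cexp (- z * s%:C)) * expR (- (s * t))) = Im ((1 - cexp (A%:C * - (z + t%:C))) * kz z t).
Proof.
move=> A0 t0; set w := - (z + t%:C).
have e s : cexp (s%:C * w) = (expR (- (s * t)))%:C * cexp (- z * s%:C).
  rewrite -cexp_real -cexpD; congr cexp; rewrite /w rmorphN rmorphM /=; ring.
have eR s : Re (cexp (- z * s%:C)) * expR (- (s * t)) = Re (cexp (s%:C * w)) by rewrite e ReZ mulrC.
have eI s : Im (cexp (- z * s%:C)) * expR (- (s * t)) = Im (cexp (s%:C * w)) by rewrite e ImZ mulrC.
pose P s := - kz z t * cexp (s%:C * w).
have dP s : rdc P s (cexp (s%:C * w)).
  apply: rdc_eq (rdc_mul (rdc_cst (- kz z t) s) (rdc_cexp w s)) _.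
  by rewrite mul0r add0r mulrA /w mulrNN /kz mulVf ?mul1r// zt.
have cP s : ccont (fun s => cexp (s%:C * w)) s by exact: rdc_cont (rdc_cexp w s).
have PP : P A - P 0 = (1 - cexp (A%:C * w)) * kz z t.
  by rewrite /P mul0r cexp0; ring.
have itvE (k : R -> R) : mu.-integrable `[0, A] (EFin \o k) ->
    \int[mu]_(s in `]0, A[) k s = \int[mu]_(s in `[0, A]) k s.
  move=> ik; have i1 : mu.-integrable `]0, A] (EFin \o k).
    by apply: integrableS ik => //; exact: subset_itv_oc_cc.
  have i2 : mu.-integrable `]0, A[ (EFin \o k).
    by apply: integrableS ik => //; exact: subset_itv_oo_cc.
  by rewrite Rintegral_itv_bndo_bndc// Rintegral_itv_obnd_cbnd.
have [i1 r1] := @ftc_seg R (fun s => Re (cexp (s%:C * w))) (fun s => Re (P s)) 0 A A0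
  (fun s _ => (cP s).1) (fun s _ => (dP s).1).
have [i2 r2] := @ftc_seg R (fun s => Im (cexp (s%:C * w))) (fun s => Im (P s)) 0 A A0
  (fun s _ => (cP s).2) (fun s _ => (dP s).2).
split.
  under eq_Rintegral do rewrite eR.
  by rewrite (itvE _ i1) r1 -PP ReD ReN.
under eq_Rintegral do rewrite eI.
by rewrite (itvE _ i2) r2 -PP ImD ImN.
Qed.

Lemma cexp_bound s : 0 < s -> `|Re (cexp (- z * s%:C))| <= 1 /\ `|Im (cexp (- z * s%:C))| <= 1.
Proof.
move=> s0; rewrite mulrC /cexp !ReZ !ImZ /=.
have e1 : expR (s * Re (- z)) <= 1 by rewrite -expR0 ler_expR ReN mulrN oppr_le0 mulr_ge0// ltW.
split; rewrite normrM (ger0_norm (expR_ge0 _)) -[leRHS]mul1r; apply: ler_pM => //; rewrite ?expR_ge0//.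
  by rewrite ler_norml cos_geN1 cos_le1.
by rewrite ler_norml sin_geN1 sin_le1.
Qed.

Lemma measurable_cexp : measurable_fun setT (fun s => Re (cexp (- z * s%:C))) /\
  measurable_fun setT (fun s => Im (cexp (- z * s%:C))).
Proof.
have c s : ccont (fun s => cexp (- z * s%:C)) s.
  rewrite (_ : (fun s => _) = fun s => cexp (s%:C * - z)); first exact: rdc_cont (rdc_cexp _ s).
  by apply/funext => x; rewrite mulrC.
by split; apply: continuous_measurable_fun => s; have [] := c s.
Qed.

Variables (C : R).
Hypothesis kzC : forall t, 0 < t -> cabs (kz z t) <= C * (1 + t)^-1.
Hypothesis ckz : forall t, 0 < t -> ccont (kz z) t.

Lemma iterated_laplace :
  is_improper_cintegral (fun s => cexp (- z * s%:C) * (lap s)%:C) (cI (fun t => (h t)%:C * kz z t)).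
Proof.
have [mR mI] := measurable_cexp.
have bR s : 0 < s -> `|Re (cexp (- z * s%:C))| <= 1 by move=> /cexp_bound[].
have bI s : 0 < s -> `|Im (cexp (- z * s%:C))| <= 1 by move=> /cexp_bound[].
have RR s : Re (cexp (- z * s%:C) * (lap s)%:C) = Re (cexp (- z * s%:C)) * lap s by rewrite mulrC ReZ mulrC.
have II s : Im (cexp (- z * s%:C) * (lap s)%:C) = Im (cexp (- z * s%:C)) * lap s by rewrite mulrC ImZ mulrC.
(* The maximum with 0 keeps the bounds valid for every term of a sequence tending to +oo, also for
   negative ones. *)
pose G A t := (h t)%:C * ((1 - cexp ((Num.max A 0)%:C * - (z + t%:C))) * kz z t).
have GE A : 0 < A -> cintegral `]0, A[ (fun s => cexp (- z * s%:C) * (lap s)%:C) = cI (G A).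
  move=> A0; have mA : Num.max A 0 = A by apply/max_idPl; exact: ltW.
  apply: complexP.
    transitivity (\int[mu]_(s in `]0, A[) (Re (cexp (- z * s%:C)) * lap s)).
      by apply: eq_Rintegral => s _; exact: RR.
    rewrite (lap_fubini A0 mR bR).2; apply: I0_eq => t t0.
    by rewrite (int_cexp A0 t0).1 /G mA ReZ.
  transitivity (\int[mu]_(s in `]0, A[) (Im (cexp (- z * s%:C)) * lap s)).
    by apply: eq_Rintegral => s _; exact: II.
  rewrite (lap_fubini A0 mI bI).2; apply: I0_eq => t t0.
  by rewrite (int_cexp A0 t0).2 /G mA ImZ.
have cE A t : 0 <= A -> 0 < t -> cabs (cexp (A%:C * - (z + t%:C))) <= 2 * expR (- (A * t)).
  move=> A0 t0; apply: le_trans (cabs_cexp _) _; rewrite ler_wpM2l// ler_expR ReZ ReN ReD /=.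
  by rewrite mulrN mulrDr lerN2 lerDr mulr_ge0.
have lim (u : nat -> R) : u n @[n --> \oo] --> +oo -> ccvg (fun n => cI (G (u n))) (cI (fun t => (h t)%:C * kz z t)).
  move=> uy; have max0 n : 0 <= Num.max (u n) 0 by rewrite le_max lexx orbT.
  (* The 3 is 1 + 2: [cabs] of the exponential is at most 2. *)
  have [| | |_ //] := @cI_dct R (fun n => G (u n)) (fun t => (h t)%:C * kz z t) _ _ (int0Z (3 * C) ih).
  - move=> n; have [k1 k2] : cmfun (fun t => (1 - cexp ((Num.max (u n) 0)%:C * - (z + t%:C))) * kz z t).
      apply: cmfun_cont => t t0; apply: ccontM; last exact: ckz.
      apply: ccontD; first exact: ccont_cst.
      set B := Num.max _ _.
      rewrite (_ : (fun s => - cexp (B%:C * - (z + s%:C))) = fun s => - cexp (- (B%:C * z)) * cexp (s%:C * - B%:C)).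
        by apply: ccontM; [exact: ccont_cst|exact: rdc_cont (rdc_cexp _ t)].
      by apply/funext => s; rewrite mulNr -cexpD; congr (- cexp _); ring.
    split; [rewrite /G|rewrite /G].
      rewrite (_ : (fun t => _) = fun t => h t * Re ((1 - cexp ((Num.max (u n) 0)%:C * - (z + t%:C))) * kz z t)).
        by apply: measurable_funM => //; exact: mh0.
      by apply/funext => t; rewrite ReZ.
    rewrite (_ : (fun t => _) = fun t => h t * Im ((1 - cexp ((Num.max (u n) 0)%:C * - (z + t%:C))) * kz z t)).
      by apply: measurable_funM => //; exact: mh0.
    by apply/funext => t; rewrite ImZ.
  - move=> t t0.
    (* The decay comes from t > 0 alone, so the boundary case Re z = 0 is included. *)
    have e0 : 2 * expR (- (Num.max (u n) 0 * t)) @[n --> \oo] --> (0 : R).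
      apply/cvgrPdist_le => e e0; move/cvgryPge : uy => /(_ (2 / (e * t))).
      apply: filterS => n hn; rewrite sub0r normrN ger0_norm ?mulr_ge0 ?expR_ge0//.
      have et : 0 < e * t by exact: mulr_gt0.
      have hm : 2 / (e * t) <= Num.max (u n) 0 by rewrite le_max hn.
      rewrite expRN ler_pdivrMr ?expR_gt0//.
      apply: (@le_trans _ _ (e * (Num.max (u n) 0 * t))).
        by move: hm; rewrite ler_pdivrMr// mulrA mulrAC mulrC.
      rewrite ler_wpM2l ?(ltW e0)//; apply: le_trans (expR_ge1Dx _); by rewrite lerDr.
    have c1 : ccvg (fun n => cexp ((Num.max (u n) 0)%:C * - (z + t%:C))) 0.
      by apply: ccvg_abs e0 _ => n; rewrite subr0; exact: cE.
    have c2 := ccvgM (ccvg_cst (h t)%:C) (ccvgM (ccvgD (ccvg_cst 1) (ccvgM (ccvg_cst (-1)) c1)) (ccvg_cst (kz z t))).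
    apply: ccvg_ext c2 _ _ => [n|]; first by rewrite /G mulN1r.
    by rewrite mulr0 addr0 mul1r.
  - move=> n t t0; rewrite /G cabsZ [leRHS]mulrCA ler_wpM2l//.
    apply: le_trans (cabsM _ _) _; rewrite -mulrA; apply: ler_pM; rewrite ?cabs_ge0 ?kzC//.
    apply: le_trans (cabsB _ _) _; rewrite cabs1.
    have := cE _ _ (max0 n) t0; have : expR (- (Num.max (u n) 0 * t)) <= 1.
      by rewrite -expR0 ler_expR oppr_le0 mulr_ge0// ltW.
    by move: (expR _) (cabs _) => e c; lra.
have nG : \forall A \near +oo, cintegral `]0, A[ (fun s => cexp (- z * s%:C) * (lap s)%:C) = cI (G A).
  by near=> A; apply: GE; near: A; exact: nbhs_pinfty_gt.
split.
- move=> A A0; split.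
    have i := (lap_fubini A0 mR bR).1; apply: eq_integrable i => // s _; by rewrite RR.
  have i := (lap_fubini A0 mI bI).1; apply: eq_integrable i => // s _; by rewrite II.
- have c : Re (cI (G A)) @[A --> +oo] --> Re (cI (fun t => (h t)%:C * kz z t)).
    by apply/cvg_pinftyP => u /lim[].
  apply: cvg_trans c; apply: near_eq_cvg.
  by apply: filterS nG => A ->.
- have c : Im (cI (G A)) @[A --> +oo] --> Im (cI (fun t => (h t)%:C * kz z t)).
    by apply/cvg_pinftyP => u /lim[].
  apply: cvg_trans c; apply: near_eq_cvg.
  by apply: filterS nG => A ->.
Unshelve. all: by end_near. Qed.

End IteratedLaplace.

Theorem theorem11 (R : realType) (a b mu nu : R) (z : R[i])
    (ha : 0 < a) (hab : a <= b) (hmu : -1 < mu) (hnu : -1 < nu)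
    (hnumu : nu - mu < 1) (hz0 : z != 0) (hz : `|carg z| < pi) :
  let lhs := cpow z ((nu - mu) / 2)
             * besselI mu (a%:C * sqrtc z) * besselK nu (b%:C * sqrtc z) in
  let g := fun t : R => (t `^ ((nu - mu) / 2))%:C
             * besselJ mu (a * Num.sqrt t)%:C
             * besselJ nu (b * Num.sqrt t)%:C in
  [/\ cintegrable `]0, +oo[ (fun t => g t / (z + t%:C)),
      lhs = 1 / 2 * cintegral `]0, +oo[ (fun t => g t / (z + t%:C)),
      forall s : R, 0 < s ->
        cintegrable `]0, +oo[ (fun t => (expR (- (s * t)))%:C * g t)
    & 0 <= complex.Re z ->
      exists2 l : R[i],
        is_improper_cintegral
          (fun s => cexp (- z * s%:C)
             * cintegral `]0, +oo[ (fun t => (expR (- (s * t)))%:C * g t)) l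
        & lhs = 1 / 2 * l].
Proof.
(* The hypothesis on [carg z] is literally the bound on Im L, which brings z into the form exp L
   used throughout. *)
pose L := clog z; have L_pi : `|complex.Im L| < pi by [].
have zL : z = cexp L by rewrite cexp_clog.
move=> lhs g; pose h := bessel_prod a b mu nu.
have hb : 0 < b by exact: lt_le_trans hab.
have gE t : 0 < t -> g t = (h t)%:C by move=> t0; exact: bessel_prodE.
have [i1 _] := cint0_bessel_prod L_pi ha hab hnu hnumu.
have lhsE : lhs = 1 / 2 * cI (fun t => (h t)%:C * kz z t).
  by rewrite /lhs zL stieltjes_bessel.
rewrite -zL -/h in i1.
have e1 t : 0 < t -> (h t)%:C * kz z t = g t / (z + t%:C) by move=> t0; rewrite gE.
have cIE : cintegral `]0, +oo[ (fun t => g t / (z + t%:C)) = cI (fun t => (h t)%:C * kz z t).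
  exact/esym/cI_eq.
have mh : measurable_fun setT h.
  have me (m c : R) : measurable_fun setT (fun t : R => em m (c * t)).
    apply: (measurableT_comp (_ : measurable_fun setT (em m))).
      by apply: continuous_measurable_fun => y; exact: cont_em.
    by apply: measurable_funM => //; exact: measurable_cst.
  apply: measurable_funM; first exact: measurable_cst.
  by apply: measurable_funM; [exact: measurable_powR|exact: measurable_funM].
(* The exponent at infinity is nu - (mu+nu+1)/2 - 1, below -1 precisely because nu - mu < 1. *)
have ih : int0 (fun t => `|h t| * (1 + t)^-1).
  have al0 : 0 < (a / 2) ^+ 2 by rewrite exprn_gt0// divr_gt0.
  have be0 : 0 < (b / 2) ^+ 2 by rewrite exprn_gt0// divr_gt0.
  have [C C0 hC] := @em_prod_wt R mu nu nu _ ((a / 2) ^+ 2) _ ((b / 2) ^+ 2) al0 be0.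
  set q := - ((mu + nu + 1) / 2) in hC; pose D := (a / 2) `^ mu * (b / 2) `^ nu.
  have D0 : 0 <= D by rewrite mulr_ge0// powR_ge0.
  have iw : int0 (wt nu (q - 1)) by apply: int0_wt; rewrite /q; lra.
  apply: (int0_le _ (int0Z (D * C) iw)).
    have m1 : mfun0 (fun t : R => (1 + t)^-1).
      apply: mfun0_cont => t t0; apply: cvgV; first by rewrite gt_eqF//; lra.
      by apply: cvgD; [exact: cvg_cst|exact: cvg_id].
    by apply: measurable_funM m1; apply: measurableT_comp => //; exact: measurable_funS mh.
  move=> t t0; have t1 : 0 < 1 + t by lra.
  rewrite normrM normr_id (gtr0_norm (_ : 0 < (1 + t)^-1)) ?invr_gt0// /h /bessel_prod -/D normrM (ger0_norm D0).
  have pm : (1 + t) `^ (-1) = (1 + t)^-1 by rewrite powRN powRr1// ltW.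
  have -> : D * C * wt nu (q - 1) t = D * (C * wt nu q t) * (1 + t)^-1.
    by rewrite /wt (powRDx _ (-1) t1) pm; ring.
  by rewrite ler_wpM2r ?invr_ge0 ?(ltW t1)// ler_wpM2l//; exact: hC.
have fE s t : 0 < t -> (expR (- (s * t)))%:C * g t = (expR (- (s * t)) * h t)%:C.
  by move=> t0; rewrite gE// -rmorphM.
split.
- exact: cint0_eq i1.
- by rewrite lhsE cIE.
- move=> s s0; apply: cint0_eq (cint0_real (int0_laplace mh ih s0)) => t t0.
  by rewrite fE.
- move=> Rz; have [C _ hC] := kz_bound L_pi; rewrite -zL in hC.
  (* The iterated integral converges to the Stieltjes integral itself, so the formula for [lhs] is
     the one already proved. *)
  exists (cI (fun t => (h t)%:C * kz z t)) => //.
  have lE : (fun s => cexp (- z * s%:C) * cintegral `]0, +oo[ (fun t => (expR (- (s * t)))%:C * g t)) =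
     fun s => cexp (- z * s%:C) * (lap h s)%:C.
    apply/funext => s; congr (_ * _); rewrite -cI_real; apply: cI_eq => t t0; exact: fE.
  rewrite lE; apply: (@iterated_laplace _ _ mh ih _ Rz _ C).
  + by move=> t /hC[].
  + move=> t t0; have [_] := hC t t0; rewrite powRN powRr1//; lra.
  + by move=> t t0; rewrite zL; exact: ccont_kz.
Qed.
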